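(* Let $m\in\mathbb N$ and, for $i=1,\dots,m$, let $\lambda^i>0$, $c_i>0$ and $\mu^i_0,\mu^i_1>0$ be constants with $$\lambda^i\geq\mu^i_1-\mu^i_0\geq0 .$$ For each $i$ let $\sigma^i$ be an exponentially distributed random time with parameter $\lambda^i$, and let $N^i$ be a counting process whose intensity switches from $\mu^i_0$ to $\mu^i_1$ at time $\sigma^i$, all random variables being independent for different $i$. Let $(\mathcal A_t)_{t\in[0,\infty)}$ be the filtration generated by $(N^1_t,\dots,N^m_t)_{t\in[0,\infty)}$, and put $$Z^i_t=1_{\{\sigma^i\geq t\}}+c_i\,(t-\sigma^i)^+,\qquad X^i_t=E(Z^i_t\mid\mathcal A_t),\qquad \pi^i_t=P(\sigma^i\leq t\mid\mathcal A_t).$$ Then the stopping time $$\tau^*=\inf\left\{t:\ \sum_{i=1}^m(c_i+\lambda^i)\pi^i_t\geq\sum_{i=1}^m\lambda^i\right\}$$ is optimal for the problem of minimizing $E\left(\sum_{i=1}^mX^i_\tau\right)$ over all $(\mathcal A_t)$-stopping times $\tau$, i.e. $$E\left(\sum_{i=1}^mX^i_{\tau^*}\right)=\inf_\tau E\left(\sum_{i=1}^mX^i_\tau\right).$$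
   Context: ''Counting process whose intensity switches from $\mu^i_0$ to $\mu^i_1$ at $\sigma^i$'' means: with respect to the filtration $\mathcal F_t=\sigma(N^i_s,1_{\{\sigma^i\le s\}}:s\le t,\ i=1,\dots,m)$, $N^i$ has intensity $\mu^i_01_{\{t<\sigma^i\}}+\mu^i_11_{\{t\geq\sigma^i\}}$ (conditionally on $\sigma^i$, it is a Poisson process with this rate), with $N^i_0=0$. Right-continuous versions of the conditional expectations $X^i$ and posterior probabilities $\pi^i$ are used; explicitly $\pi^i_t=\phi^i_t/(1+\phi^i_t)$ with $$\phi^i_t=\lambda^i e^{(\lambda^i+\mu_0^i-\mu_1^i)t}e^{N^i_t\log(\mu_1^i/\mu^i_0)}\int_0^te^{-(\lambda^i+\mu_0^i-\mu_1^i)s}e^{-N^i_s\log(\mu_1^i/\mu^i_0)}\,ds .$$ Stopping times may take the value $\infty$, and since this is a minimization problem the gain at $\infty$ is the limit superior $\limsup_{t\to\infty}\sum_iX^i_t$. *)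

(* Defs.v *)
From HB Require Import structures.
From mathcomp Require Import all_boot all_order all_algebra.
From mathcomp Require Import all_classical all_reals all_analysis.

Set Implicit Arguments.
Unset Strict Implicit.
Unset Printing Implicit Defensive.

Import Order.TTheory GRing.Theory Num.Theory.
Import numFieldNormedType.Exports.

Local Open Scope classical_set_scope.
Local Open Scope ring_scope.

(* Time is the half-line [0, +oo[ of a realType R;
   processes are functions on all of R whose values at negative times never
   matter. *)

Section conditioning.
Context {d : measure_display} {Omega : measurableType d} {R : realType}.
Implicit Types (P : probability Omega R) (G : set (set Omega)).

(* g is a version of E(f | G), for an integrable f. *)
Definition is_cond_exp P G (f g : Omega -> R) :=
  [/\ forall B : set R, measurable B -> G (g @^-1` B),
      P.-integrable setT (EFin \o g)
    & forall A, G A ->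
        (\int[P]_(w in A) (g w)%:E = \int[P]_(w in A) (f w)%:E)%E].

(* Y is a version, with right-continuous paths, of t |-> E(Z_t | A_t). *)
Definition right_continuous_version P (A : R -> set (set Omega))
    (Z Y : R -> Omega -> R) :=
  (forall t, 0 <= t -> is_cond_exp P (A t) (Z t) (Y t)) /\
  (forall w t, 0 <= t -> Y s w @[s --> t^'+] --> Y t w).

Definition is_martingale P (F : R -> set (set Omega)) (M : R -> Omega -> R) :=
  forall s t, 0 <= s -> s <= t -> is_cond_exp P (F s) (M t) (M s).

(* Independence of a finite family of sigma-algebras; since each of them
   contains setT, the product rule over subfamilies is included. *)
Definition independent_sigma_algebras P (I : finType)
    (G : I -> set (set Omega)) :=
  forall A : I -> set Omega, (forall i, G i (A i)) ->
    (P (\bigcap_(i in setT) A i) = \prod_(i : I) P (A i))%E.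

Definition stopping_time (A : R -> set (set Omega)) (tau : Omega -> \bar R) :=
  (forall w, 0 <= tau w)%E /\
  (forall t, 0 <= t -> A t [set w | (tau w <= t%:E)%E]).

(* The value at time tau of the path x, which at +oo is limsup_{t -> +oo} x t;
   the value at -oo is irrelevant, stopping times being nonnegative. *)
Definition stopped_value (x : R -> R) (tau : \bar R) : \bar R :=
  match tau with
  | r%:E => (x r)%:E
  | +oo%E => limf_esup (EFin \o x) (pinfty_nbhs R)
  | -oo%E => 0%E
  end.

End conditioning.

Section counting_processes.
Context {d : measure_display} {Omega : measurableType d} {R : realType}.
Implicit Types (P : probability Omega R) (N : R -> Omega -> nat).

Definition counting_process N :=
  [/\ forall t, 0 <= t -> measurable_fun setT (N t),
      forall w, N 0 w = 0%N,
      forall w s t, 0 <= s -> s <= t -> (N s w <= N t w)%N,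
      forall w t, 0 <= t -> \forall s \near t^'+, N s w = N t w
    & forall w t, 0 < t -> \forall s \near t^'-, (N t w <= (N s w).+1)%N].

Definition switching_rate (mu0 mu1 s u : R) : R :=
  if u < s then mu0 else mu1.

(* F-intensity of a counting process, here with integrable compensator. *)
Definition has_intensity P (F : R -> set (set Omega)) N
    (rate : R -> Omega -> R) :=
  is_martingale P F (fun t w =>
    (N t w)%:R - \int[lebesgue_measure]_(u in `[0, t]) rate u w).

(* Conditionally on sigma, N is a Poisson process with the rate function
   rate (sigma w): its increments over consecutive intervals are conditionally
   independent and Poisson distributed.  The times are strictly increasing
   because poisson_pmf 0 is not the mass function of the Dirac mass at 0. *)
Definition conditionally_poisson P (sigma : Omega -> R) N
    (rate : R -> R -> R) :=
  forall (n : nat) (t : nat -> R) (k : nat -> nat) (B : set R),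
    0 <= t 0%N -> (forall j, (j < n)%N -> t j < t j.+1) -> measurable B ->
    (P (sigma @^-1` B `&`
        [set w | forall j, (j < n)%N -> N (t j.+1) w = (N (t j) w + k j)%N])
     = \int[P]_(w in sigma @^-1` B)
        (\prod_(j < n) poisson_pmf
          (\int[lebesgue_measure]_(u in `[t j, t j.+1]) rate (sigma w) u)%R
          (k j))%:E)%E.

Definition switches_intensity P (F : R -> set (set Omega))
    (sigma : Omega -> R) N (mu0 mu1 : R) :=
  [/\ counting_process N,
      has_intensity P F N (fun u w => switching_rate mu0 mu1 (sigma w) u)
    & conditionally_poisson P sigma N (switching_rate mu0 mu1)].

End counting_processes.

Section disorder.
Context {d : measure_display} {Omega : measurableType d} {R : realType}.
Context {m : nat}.
Implicit Types (sigma : 'I_m -> Omega -> R) (N : 'I_m -> R -> Omega -> nat).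

(* Generators of sigma(N^i_s : s <= t, i). *)
Definition observed_events N (t : R) : set (set Omega) :=
  \bigcup_(i in [set: 'I_m]) \bigcup_(s in `[0, t])
    preimage_set_system setT (N i s) measurable.

Definition observed_filtration N (t : R) : set (set Omega) :=
  <<s observed_events N t >>.

(* sigma(N^i_s, 1_{sigma^i <= s} : s <= t, i) *)
Definition full_filtration sigma N (t : R) : set (set Omega) :=
  <<s observed_events N t `|`
      \bigcup_(i in [set: 'I_m]) \bigcup_(s in `[0, t])
        preimage_set_system setT
          (\1_[set w | sigma i w <= s] : Omega -> R) measurable >>.

(* sigma(sigma^i, N^i_t : t >= 0) *)
Definition coordinate_sigma_algebra sigma N (i : 'I_m) : set (set Omega) :=
  <<s preimage_set_system setT (sigma i) measurable `|`
      \bigcup_(t in `[0, +oo[) preimage_set_system setT (N i t) measurable >>.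

Definition penalty (c : 'I_m -> R) sigma (i : 'I_m) (t : R) (w : Omega) : R :=
  \1_[set w | t <= sigma i w] w + c i * Num.max (t - sigma i w) 0.

End disorder.

Section posterior.
Context {R : realType}.

(* The path functionals phi and phi / (1 + phi) of an observed path n, the
   latter giving the posterior probability of {sigma <= t}. *)
Definition posterior_odds (lambda mu0 mu1 : R) (n : R -> nat) (t : R) : R :=
  lambda * expR ((lambda + mu0 - mu1) * t) * expR ((n t)%:R * ln (mu1 / mu0)) *
  \int[lebesgue_measure]_(s in `[0, t])
    (expR (- (lambda + mu0 - mu1) * s) * expR (- (n s)%:R * ln (mu1 / mu0))).

Definition posterior (lambda mu0 mu1 : R) (n : R -> nat) (t : R) : R :=
  posterior_odds lambda mu0 mu1 n t / (1 + posterior_odds lambda mu0 mu1 n t).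

End posterior.

(* inf {t >= 0 : sum_i (c_i + lambda^i) pi^i_t >= sum_i lambda^i}, with
   inf set0 = +oo. *)
Definition threshold_time {R : realType} {Omega : Type} {m : nat}
    (lambda c : 'I_m -> R) (pi : 'I_m -> R -> Omega -> R)
    (w : Omega) : \bar R :=
  ereal_inf [set t%:E | t in
    [set t | 0 <= t /\
      \sum_(i < m) lambda i <= \sum_(i < m) (c i + lambda i) * pi i t w]].

(* Main.v *)
Require Import Defs.
From HB Require Import structures.
From mathcomp Require Import all_boot all_order all_algebra.
From mathcomp Require Import all_classical all_reals all_analysis.
From mathcomp Require Import measurable_realfun zify ring lra.

Set Implicit Arguments.
Unset Strict Implicit.
Unset Printing Implicit Defensive.

Import Order.TTheory GRing.Theory Num.Theory.
Import numFieldNormedType.Exports.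

Local Open Scope classical_set_scope.
Local Open Scope ring_scope.

(* Bayes' rule: on a cell of the path space, that is for prescribed increments of
   N over finitely many intervals of [0, t], the joint law of the cell and sigma is
   explicit, and the odds phi satisfy
     P(A, sigma <= t) = E[1_A phi_t 1_{sigma > t}].
   This follows by inserting the switching time s in the grid and summing over the
   increments before s (binomial theorem), then integrating over s (Fubini).
   Cells generate the observations, the other coordinates factor out by
   independence, and the identity gives pi = phi / (1 + phi).

   The drift of sum_i X^i is Y = sum_i (c_i + lambda^i) pi^i - sum_i lambda^i, by
   the memoryless property of sigma.  As lambda^i >= mu^i_1 - mu^i_0 >= 0, the odds
   phi^i, hence Y, are nondecreasing: stopping as soon as Y >= 0 collects exactly
   the negative drift.  On the grid of times k/n the drift is known up to
   O(1/n^2) per step, and right continuity yields the comparison of stopping times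
   in the limit.  Moreover phi^i_t >= lambda^i t makes tau* bounded, while
   sum_i X^i is almost surely unbounded at late times, so that the limit superior
   convention excludes stopping times infinite with positive probability. *)

(** No change of measure is invoked. On [{t < sigma}] the path has rate [mu0] on all of [[0, t]];
    moving the switch back to [s] costs the likelihood ratio [(mu1 / mu0)^(jumps after s) exp (-
    (mu1 - mu0) (t - s))], and the exponential density at [s] over the probability of a switch after
    [t] is [lambda exp (lambda (t - s))]. Their product is the integrand of [phi], whence the
    exponent [lambda + mu0 - mu1]. The Poisson property speaks of increments over given intervals
    only, so the ratio is verified cell by cell. Three obstacles shape the stopping argument. Bounds
    on [X] hold almost surely at each fixed time, so they are collected on a countable mesh and
    extended by right continuity. The value at [+oo] is a limit superior over a continuum, so costs
    are bounded below by measurable minorants. Finally [X] may grow linearly, so cutting an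
    unbounded [tau] at [T'] leaves the mean of [X] at [T'] over [{tau > T'}], which need not vanish;
    late costs are instead compared with the penalty at a fixed earlier time, below which later
    penalties fall by at most [m]. *)

(** * Path cells, their refinement at a switching time, and Poisson weights *)

Section grids.
Context {R : realType}.
Implicit Types (n : R -> nat) (t s : R) (l : seq (R * nat)).

(* A list of pairs (t_j, k_j) stands for the times t_0 < t_1 < ... together with
   prescribed increments k_j of the path over (t_(j-1), t_j]; [weight L] is the
   product of the Poisson masses of these increments. *)
Fixpoint cell n t0 l : bool :=
  if l is (t, k) :: l' then (n t == n t0 + k)%N && cell n t l' else true.

(** [poisson_pmf] without its case distinction on the rate, so that the scaling and convolution
    identities are plain algebra. *)
Definition pois (rate : R) k : R := rate ^+ k * k`!%:R^-1 * expR (- rate).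

Fixpoint weight (L : R -> R -> R) t0 l : R :=
  if l is (t, k) :: l' then pois (L t0 t) k * weight L t l' else 1.

Definition grid t0 l := path <%R t0 (unzip1 l).
Definition grid_end t0 l := last t0 (unzip1 l).

(* Inserts the time [s], [a] of the increments of its interval falling before
   [s]; [count_at] is the increment of that interval and [count_after] the sum of
   the later ones. *)
Fixpoint refine s a l : seq (R * nat) :=
  if l is (t, k) :: l' then
    if s < t then [:: (s, a), (t, (k - a)%N) & l'] else (t, k) :: refine s a l'
  else [::].

Fixpoint count_at s l : nat :=
  if l is (t, k) :: l' then if s < t then k else count_at s l' else 0.

Fixpoint count_after s l : nat :=
  if l is (t, k) :: l' then
    if s < t then sumn (unzip2 l') else count_after s l'
  else 0.

Lemma grid_le_end t0 l : grid t0 l -> t0 <= grid_end t0 l.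
Proof.
elim: l t0 => [|[t k] l IH] t0 //= /andP[t0t gl].
exact: le_trans (ltW t0t) (IH _ gl).
Qed.

Lemma grid_refine t0 l s a : grid t0 l -> t0 < s -> s \notin unzip1 l ->
  grid t0 (refine s a l).
Proof.
rewrite /grid; elim: l t0 => [|[t k] l IH] t0 //= /andP[t0t gl] t0s.
rewrite inE negb_or => /andP[st sl].
case: ltP => ts /=; first by rewrite t0s ts.
by rewrite t0t IH// lt_neqAle eq_sym st ts.
Qed.

Lemma grid_end_refine t0 l s a : grid_end t0 (refine s a l) = grid_end t0 l.
Proof.
rewrite /grid_end; elim: l t0 => [|[t k] l IH] t0 //=.
by case: ltP => ts //=.
Qed.

Lemma cell_end n t0 l : cell n t0 l -> n (grid_end t0 l) = (n t0 + sumn (unzip2 l))%N.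
Proof.
elim: l t0 => [|[t k] l IH] t0 /=; first by rewrite addn0.
by move=> /andP[/eqP e /IH]; rewrite /grid_end /= => ->; rewrite e addnA.
Qed.

(** A monotone path of the cell lies in exactly one refined cell: [a] must be its increment from the
    preceding grid time to [s]. Off the cell every refined cell fails as well. On the refined cell
    the number of jumps after [s] is prescribed, so any function [f] of it becomes a constant. *)
Lemma cell_refine n t0 l s (f : nat -> R) :
  (forall u v, t0 <= u -> u <= v -> (n u <= n v)%N) ->
  grid t0 l -> t0 < s -> s < grid_end t0 l -> s \notin unzip1 l ->
  (cell n t0 l)%:R * f (n (grid_end t0 l) - n s)%N =
  \sum_(a < (count_at s l).+1) (cell n t0 (refine s a l))%:R *
     f (count_at s l - a + count_after s l)%N.
Proof.
elim: l t0 => [|[t k] l IH] t0 nmon gl t0s sl.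
  by move: (lt_trans t0s sl); rewrite ltxx.
move: gl; rewrite /grid /= => /andP[t0t gl].
rewrite inE negb_or /= => /andP[st snl].
rewrite /grid_end /= -/(grid_end t l).
case: ltP => ts /=.
  have n0s : (n t0 <= n s)%N by apply: nmon => //; exact: ltW.
  have nst : (n s <= n t)%N by apply: nmon; exact: ltW.
  have [c|c] := boolP ((n t == n t0 + k)%N && cell n t l); last first.
    rewrite mul0r big1// => a _.
    rewrite (_ : [&& _ , _ & _] = false) ?mul0r//.
    apply/negbTE; apply: contra c => /and3P[/eqP e1 /eqP e2 ->].
    rewrite andbT e2 e1 -addnA subnKC// -ltnS; exact: ltn_ord.
  move: c => /andP[/eqP e c].
  have ak : (n s - n t0 < k.+1)%N by rewrite ltnS leq_subLR -e.
  rewrite (bigD1 (Ordinal ak))//= big1 ?addr0.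
    rewrite subnKC// eqxx c andbT /=.
    rewrite (_ : (n t == _)%N) ?(mul1r, cell_end c).
      by congr f; rewrite e; lia.
    apply/eqP; rewrite e; lia.
  move=> a; rewrite -(inj_eq val_inj)/= => /negbTE na.
  rewrite (_ : (n s == _)%N = false) ?mul0r//.
  apply/negP => /eqP; move: na => /negP na e'; apply: na; apply/eqP; lia.
have {}ts : t < s by rewrite lt_neqAle eq_sym st.
have nmon' u v : t <= u -> u <= v -> (n u <= n v)%N.
  by move=> tu; apply: nmon; exact: le_trans (ltW t0t) tu.
have [e|e] := eqVneq (n t) (n t0 + k)%N => /=.
  by rewrite (IH t).
by rewrite mul0r big1// => a _; rewrite mul0r.
Qed.

Lemma pois_scale (x r : R) k :
  pois (r * x) k = r ^+ k * expR ((1 - r) * x) * pois x k.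
Proof.
rewrite /pois exprMn.
have -> : - (r * x) = (1 - r) * x + - x by ring.
by rewrite expRD; ring.
Qed.

(** Convolution of two Poisson laws: the factor [r ^+ (k - a)] changes the second rate from [y] to
    [r * y] at the price of [expR ((r - 1) * y)]. *)
Lemma pois_binom (x y r : R) k :
  \sum_(a < k.+1) r ^+ (k - a) * (pois x a * pois y (k - a)) =
  expR ((r - 1) * y) * pois (x + r * y) k.
Proof.
rewrite /pois [x + _]addrC exprDn !big_distrl/= big_distrr/=; apply: eq_bigr => a _.
have ak : (a <= k)%N by rewrite -ltnS.
have -> : - (r * y + x) = (1 - r) * y + (- x + - y) by ring.
rewrite !expRD mulrAC exprMn -[_ *+ 'C(_, _)]mulr_natr.
have -> : (r - 1) * y = - ((1 - r) * y) by ring.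
rewrite [expR (- ((1 - r) * y))]expRN.
have e0 : expR ((1 - r) * y) != 0 by rewrite expR_eq0.
have := bin_fact ak; rewrite mulnC => /(congr1 (fun j => j%:R : R)).
rewrite !natrM => <-.
have a0 : a`!%:R != 0 :> R by rewrite pnatr_eq0 -lt0n fact_gt0.
have b0 : (k - a)`!%:R != 0 :> R by rewrite pnatr_eq0 -lt0n fact_gt0.
have c0 : 'C(k, a)%:R != 0 :> R by rewrite pnatr_eq0 -lt0n bin_gt0.
by field; rewrite e0 a0 b0 c0.
Qed.

(* The integral over [a, b] of the rate switching from mu0 to mu1 at s. *)
Definition switched (mu0 mu1 s a b : R) : R :=
  mu0 * (Num.min s b - Num.min s a) +
  mu1 * ((b - a) - (Num.min s b - Num.min s a)).

(** After [s] the rate is [mu1] throughout, so each interval contributes a pure rescaling of its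
    rate by [mu1 / mu0], as in [pois_scale]. *)
Lemma weight_after (mu0 mu1 s t0 : R) l : grid t0 l -> s <= t0 -> 0 < mu0 ->
  (mu1 / mu0) ^+ sumn (unzip2 l) * weight (fun a b => mu0 * (b - a)) t0 l =
  expR ((mu1 - mu0) * (grid_end t0 l - t0)) * weight (switched mu0 mu1 s) t0 l.
Proof.
rewrite /grid_end; elim: l t0 => [|[t k] l IH] t0 /=.
  by rewrite subrr mulr0 expR0.
move=> /andP[t0t gl] st0 mu0_gt0.
have st := le_trans st0 (ltW t0t).
have mu00 : mu0 != 0 by rewrite gt_eqF.
rewrite exprD mulrACA IH//.
have -> : switched mu0 mu1 s t0 t = (mu1 / mu0) * (mu0 * (t - t0)).
  by rewrite /switched !min_l// subrr subr0 mulr0 add0r mulrA divfK.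
rewrite (pois_scale (mu0 * (t - t0)) (mu1 / mu0)).
have -> : last t (unzip1 l) - t0 = (last t (unzip1 l) - t) + (t - t0) by ring.
rewrite [(mu1 - mu0) * (_ + (t - t0))]mulrDr expRD.
have -> : (1 - mu1 / mu0) * (mu0 * (t - t0)) = - ((mu1 - mu0) * (t - t0)) by field.
rewrite expRN.
have e0 : expR ((mu1 - mu0) * (t - t0)) != 0 by rewrite expR_eq0.
by move: (expR _) e0 (weight _ _ _) => x x0 y; field.
Qed.

(* The factor (mu1/mu0)^(jumps after s) is the likelihood ratio of the path
   switching at [s] to the path with constant rate [mu0]. *)
Lemma weight_refine (mu0 mu1 s t0 : R) l :
  grid t0 l -> t0 < s -> s < grid_end t0 l -> s \notin unzip1 l -> 0 < mu0 ->
  \sum_(a < (count_at s l).+1)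
    (mu1 / mu0) ^+ (count_at s l - a + count_after s l) *
    weight (fun a b => mu0 * (b - a)) t0 (refine s a l) =
  expR ((mu1 - mu0) * (grid_end t0 l - s)) * weight (switched mu0 mu1 s) t0 l.
Proof.
elim: l t0 => [|[t k] l IH] t0 gl t0s sl.
  by move: (lt_trans t0s sl); rewrite ltxx.
move: gl; rewrite /grid /= => /andP[t0t gl].
rewrite inE negb_or /= => /andP[st snl] mu0_gt0.
move: sl; rewrite /grid_end /= -/(grid_end t l) => sl.
have mu00 : mu0 != 0 by rewrite gt_eqF.
case: ltP => ts /=.
  have := weight_after mu1 gl (ltW ts) mu0_gt0 => H.
  pose r := mu1 / mu0.
  (* Only the interval containing [s] depends on [a]; the later intervals factor out and are handled
     by [weight_after]. *)
  transitivity ((\sum_(a < k.+1) r ^+ (k - a) * (pois (mu0 * (s - t0)) a *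
     pois (mu0 * (t - s)) (k - a))) *
    (r ^+ sumn (unzip2 l) * weight (fun a b => mu0 * (b - a)) t l)).
    rewrite big_distrl/=; apply: eq_bigr => a _.
    by rewrite exprD -/r; ring.
  rewrite pois_binom H.
  have -> : grid_end t l - s = (grid_end t l - t) + (t - s) by ring.
  have -> : switched mu0 mu1 s t0 t = mu0 * (s - t0) + r * (mu0 * (t - s)).
    rewrite /switched (min_l (ltW ts)) (min_r (ltW t0s)) /r.
    by field.
  have -> : (r - 1) * (mu0 * (t - s)) = (mu1 - mu0) * (t - s).
    by rewrite /r; field.
  by rewrite [(mu1 - mu0) * (_ + (t - s))]mulrDr expRD; ring.
have {}ts : t < s by rewrite lt_neqAle eq_sym st.
have -> : switched mu0 mu1 s t0 t = mu0 * (t - t0).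
  by rewrite /switched (min_r (ltW ts)) (min_r (ltW t0s)) subrr mulr0 addr0.
rewrite mulrCA -(IH t)// big_distrr/=; apply: eq_bigr => a _.
by rewrite mulrCA.
Qed.

End grids.

Lemma indic_mkset (T : Type) (R : pzRingType) (p : pred T) (w : T) :
  \1_[set x | p x] w = (p w)%:R :> R.
Proof.
by rewrite indicE; congr (_%:R); congr nat_of_bool; apply/idP/idP; rewrite inE.
Qed.

Lemma bounded_integrable d (T : measurableType d) (R : realType)
    (mu : {measure set T -> \bar R}) (D : set T) (f : T -> R) (M : R) :
  measurable D -> (mu D < +oo)%E -> measurable_fun D f ->
  (forall x, D x -> `|f x| <= M) -> mu.-integrable D (EFin \o f).
Proof.
move=> mD muD mf fM; apply: measurable_bounded_integrable => //.
exists M; split; first exact: num_real.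
by move=> M' /ltW MM' x Dx; exact: le_trans (fM x Dx) MM'.
Qed.

(** * Cell probabilities given the switching time *)

Section conditional_poisson_cells.
Context {R : realType}.
Notation leb := (@lebesgue_measure R).

Lemma integral_switching_rate (mu0 mu1 s a b : R) : a < b ->
  \int[leb]_(u in `[a, b]) switching_rate mu0 mu1 s u = switched mu0 mu1 s a b.
Proof.
move=> ab.
have const (x c y : R) : x <= y -> \int[leb]_(u in `[x, y]) c = c * (y - x).
  move=> xy; rewrite Rintegral_cst//= lebesgue_measure_itv/= lte_fin.
  by case: ltP => //= yx; rewrite (le_anti (introT andP (conj xy yx))) subrr mulr0.
have const' (x c y : R) : x <= y -> \int[leb]_(u in `[x, y[) c = c * (y - x).
  move=> xy; rewrite Rintegral_cst//= lebesgue_measure_itv/= lte_fin.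
  by case: ltP => //= yx; rewrite (le_anti (introT andP (conj xy yx))) subrr mulr0.
rewrite /switched /switching_rate.
have [sa|as_] := leP s a.
  rewrite (min_l (le_trans sa (ltW ab))) subrr subr0 mulr0 add0r -const ?ltW//.
  apply: eq_Rintegral => u; rewrite inE/= in_itv/= => /andP[au _].
  by rewrite ltNge (le_trans sa au).
have [sb|bs] := ltP b s.
  rewrite subrr mulr0 addr0 -const ?ltW//.
  apply: eq_Rintegral => u; rewrite inE/= in_itv/= => /andP[_ ub].
  by rewrite (le_lt_trans ub sb).
have -> : `[a, b]%classic = `[a, s[%classic `|` `[s, b]%classic.
  by rewrite -itv_bndbnd_setU// bnd_simp// ltW.
rewrite Rintegral_setU//=.
- congr (_ + _).
    rewrite -(const' a mu0 s) ?ltW//; apply: eq_Rintegral => u.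
    by rewrite inE/= in_itv/= => /andP[_ ->].
  have -> : b - a - (s - a) = b - s by ring.
  rewrite -(const s mu1 b)//; apply: eq_Rintegral => u.
  by rewrite inE/= in_itv/= => /andP[su _]; rewrite ltNge su.
- rewrite -itv_bndbnd_setU ?bnd_simp// ?ltW//.
  apply: (@bounded_integrable _ _ _ _ _ _ (`|mu0| + `|mu1|)) => //=.
  + by rewrite lebesgue_measure_itv/=; case: ifP => // _; rewrite ltry.
  + by apply: measurable_funTS; apply: measurable_fun_ifT => //; exact: measurable_fun_ltr.
  + by move=> x _; case: ifP => _; rewrite ?lerDl ?lerDr.
- apply/disj_setPS => u [/=]; rewrite !in_itv/= => /andP[_ us] /andP[su _].
  by move: us; rewrite ltNge su.
Qed.

Lemma switched_gt0 (mu0 mu1 s a b : R) : 0 < mu0 -> 0 < mu1 -> a < b ->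
  0 < switched mu0 mu1 s a b.
Proof.
move=> mu0_gt0 mu1_gt0 ab; rewrite /switched.
by have [sa|as_] := leP s a; have [sb|bs] := leP s b; nra.
Qed.

Lemma measurable_switched (mu0 mu1 a b : R) :
  measurable_fun setT (fun s : R => switched mu0 mu1 s a b).
Proof.
apply: measurable_funD; apply: measurable_funM => //.
  by apply: measurable_funB; apply: measurable_minr.
by apply: measurable_funB => //; apply: measurable_funB; apply: measurable_minr.
Qed.

Lemma measurable_weight (mu0 mu1 t0 : R) l :
  measurable_fun setT (fun s : R => weight (switched mu0 mu1 s) t0 l).
Proof.
elim: l t0 => [|[t k] l IH] t0 //=.
apply: measurable_funM => //; rewrite /pois.
apply: measurable_funM.
  apply: measurable_funM => //.
  by apply: measurable_funX; exact: measurable_switched.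
by apply: measurableT_comp => //; apply: measurableT_comp => //; exact: measurable_switched.
Qed.

Lemma weight_ge0 (L : R -> R -> R) t0 l :
  (forall a b, a < b -> 0 <= L a b) -> grid t0 l -> 0 <= weight L t0 l.
Proof.
move=> L0; elim: l t0 => [|[t k] l IH] t0 //= /andP[t0t gl].
by rewrite mulr_ge0 ?IH// /pois !mulr_ge0 ?expR_ge0 ?invr_ge0// exprn_ge0// L0.
Qed.

Lemma weight_prod (mu0 mu1 s t0 : R) l : 0 < mu0 -> 0 < mu1 -> grid t0 l ->
  weight (switched mu0 mu1 s) t0 l =
  \prod_(j < size l) poisson_pmf (\int[leb]_(u in
     `[nth 0 (t0 :: unzip1 l) j, nth 0 (t0 :: unzip1 l) j.+1])
     switching_rate mu0 mu1 s u) (nth 0%N (unzip2 l) j).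
Proof.
move=> mu0_gt0 mu1_gt0; elim: l t0 => [|[t k] l IH] t0 /=; first by rewrite big_ord0.
move=> /andP[t0t gl]; rewrite big_ord_recl /= integral_switching_rate// IH//.
congr (_ * _); first by rewrite /poisson_pmf switched_gt0.
Qed.

Lemma cell_nth (n : R -> nat) t0 l : cell n t0 l <->
  (forall j, (j < size l)%N -> n (nth 0 (t0 :: unzip1 l) j.+1) =
    (n (nth 0%R (t0 :: unzip1 l) j) + nth 0 (unzip2 l) j)%N).
Proof.
elim: l t0 => [|[t k] l IH] t0 //=.
split=> [/andP[/eqP e /IH cl] [|j]//=|H].
  by rewrite ltnS; exact: cl.
apply/andP; split; first by apply/eqP; exact: (H 0%N).
by apply/IH => j jl; exact: (H j.+1).
Qed.

Context {d : measure_display} {Omega : measurableType d} (P : probability Omega R).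

Lemma conditionally_poisson_cell (sigma : Omega -> R) N (mu0 mu1 t0 : R) l B :
  conditionally_poisson P sigma N (switching_rate mu0 mu1) ->
  0 < mu0 -> 0 < mu1 -> 0 <= t0 -> grid t0 l -> measurable B ->
  (P (sigma @^-1` B `&` [set w | cell (N ^~ w) t0 l]) =
   \int[P]_(w in sigma @^-1` B)
     (weight (switched mu0 mu1 (sigma w)) t0 l)%:E)%E.
Proof.
move=> cp mu0_gt0 mu1_gt0 t00 gl mB.
have H := cp (size l) (nth 0 (t0 :: unzip1 l)) (nth 0%N (unzip2 l)) B.
have -> : [set w | cell (N^~ w) t0 l] =
  [set w | forall j, (j < size l)%N -> N (nth 0 (t0 :: unzip1 l) j.+1) w =
    (N (nth 0%R (t0 :: unzip1 l) j) w + nth 0 (unzip2 l) j)%N].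
  by apply/seteqP; split => w /=; rewrite cell_nth.
rewrite H//; last first.
  move=> j jl; have /(pathP 0) := gl; apply; by rewrite size_map.
by apply: eq_integral => w _; rewrite weight_prod.
Qed.

End conditional_poisson_cells.

(** * Image measures of measures with a density *)

Section image_density.
Context {d d' : measure_display} {T : measurableType d} {U : measurableType d'}.
Context {R : realType} (mu : {measure set T -> \bar R}) (phi : T -> U).
Hypothesis mphi : measurable_fun setT phi.
Local Open Scope ereal_scope.

(** When [phi] is the identity into the same set with a coarser sigma-algebra, this is the
    restriction of the measure with density [p]; integrals over observed events are treated in this
    way. *)
Lemma image_density_measure (p : T -> \bar R) :
  measurable_fun setT p -> (forall x, 0 <= p x) ->
  {m : {measure set U -> \bar R} | forall A, m A = \int[mu]_(x in phi @^-1` A) p x}.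
Proof.
move=> mp p0; pose m A := \int[mu]_(x in phi @^-1` A) p x.
have m0 : m set0 = 0 by rewrite /m preimage_set0 integral_set0.
have mge0 A : 0 <= m A by apply: integral_ge0.
have madd : semi_sigma_additive m.
  move=> /= F mF tF mUF; rewrite /m; apply: cvg_toP.
    apply: ereal_nondecreasing_is_cvgn => i j ij.
    by apply: lee_sum_nneg_natr => // k _ _; apply: integral_ge0.
  rewrite preimage_bigcup ge0_integral_bigcup//.
  - by move=> k; rewrite -[_ @^-1` _]setTI; exact: mphi.
  - exact: measurable_funTS.
  - apply/trivIsetP => i j _ _ ij; rewrite -preimage_setI.
    by move/trivIsetP : tF => -> //; rewrite preimage_set0.
pose mix := isMeasure.Build _ _ _ m m0 mge0 madd.
by exists (HB.pack m mix : {measure set U -> \bar R}).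
Qed.

Import HBNNSimple.

(** For an indicator this is the description of [nu]; linearity extends it to simple functions and
    monotone convergence to [h]. *)
Lemma ge0_integral_image_density (nu : {measure set U -> \bar R}) (p : T -> R)
    (h : U -> \bar R) :
  measurable_fun setT p -> (forall x, 0 <= p x)%R ->
  (forall A, measurable A -> nu A = \int[mu]_(x in phi @^-1` A) (p x)%:E) ->
  measurable_fun setT h -> (forall x, 0 <= h x) ->
  \int[nu]_x h x = \int[mu]_x (h (phi x) * (p x)%:E).
Proof.
move=> mp p0 nuE mh h0.
have mp' : measurable_fun setT (EFin \o p) by exact/measurable_EFinP.
have p0' x : 0 <= (p x)%:E by rewrite lee_fin.
pose hn : {nnsfun U >-> R}^nat := nnsfun_approx measurableT mh.
have mhn n : measurable_fun setT (hn n \o phi) by exact: measurableT_comp.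
have mpre n y : measurable (phi @^-1` (hn n @^-1` [set y])).
  by rewrite -[_ @^-1` _]setTI; exact: mhn.
have hn_mono x : nondecreasing_seq (hn ^~ x).
  by move=> i j ij; have /lefP := nd_nnsfun_approx measurableT mh ij; exact.
transitivity (limn (fun n => \int[nu]_x (hn n x)%:E)).
  rewrite -monotone_convergence//.
  - apply: eq_integral => x _; apply/esym/cvg_lim => //.
    exact: (cvg_nnsfun_approx measurableT mh).
  - by move=> n; exact/measurable_EFinP.
  - by move=> n x _; rewrite lee_fin; exact: fun_ge0.
  - by move=> x _ i j ij; rewrite lee_fin; exact: hn_mono.
transitivity (limn (fun n => \int[mu]_x ((hn n (phi x))%:E * (p x)%:E))); last first.
  rewrite -monotone_convergence//.
  - apply: eq_integral => x _; apply/cvg_lim => //; apply: cvgeZr => //.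
    exact: (cvg_nnsfun_approx measurableT mh).
  - move=> n; apply: emeasurable_funM => //.
    by apply/measurable_EFinP; exact: mhn.
  - by move=> n x _; rewrite mule_ge0// lee_fin; exact: fun_ge0.
  - by move=> x _ i j ij; rewrite lee_wpmul2r// lee_fin; apply: hn_mono.
congr (limn _); apply/funext => n.
transitivity (\int[mu]_x (\sum_(y \in range (hn n))
    (y%:E * ((\1_(hn n @^-1` [set y]) (phi x))%:E * (p x)%:E)))); last first.
  apply: eq_integral => x _; rewrite [X in X%:E * _]fimfunE -fsumEFin//.
  rewrite ge0_mule_fsuml//; last first.
    by move=> y; rewrite EFinM; apply: nnfun_muleindic_ge0.
  by apply: eq_fsbigr => y _; rewrite EFinM muleA.
have mi y : measurable_fun setT (fun x => (\1_(hn n @^-1` [set y]) (phi x))%:E : \bar R).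
  apply/measurable_EFinP; apply: (measurableT_comp _ mphi).
  by apply: measurable_indic; rewrite -[_ @^-1` _]setTI; exact: measurable_funPT.
rewrite ge0_integral_fsum//; last 2 first.
- by move=> y; apply: measurable_funeM; exact: emeasurable_funM.
- by move=> y x _; rewrite muleA mule_ge0// -EFinM; exact: nnfun_muleindic_ge0.
rewrite integralT_nnsfun sintegralE; apply: eq_fsbigr => y; rewrite inE => -[x _ <-].
rewrite ge0_integralZl//.
- rewrite nuE; last by rewrite -[_ @^-1` _]setTI; exact: measurable_funPT.
  rewrite integral_mkcond; congr (_ * _); apply: eq_integral => z _.
  by rewrite epatch_indic muleC.
- exact: emeasurable_funM.
- by move=> z _; rewrite mule_ge0.
- by rewrite lee_fin; exact: fun_ge0.
Qed.

End image_density.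

(** * Comparison of integrals on a generated sigma-algebra *)

Section generated_sigma_algebra.
Context {d : measure_display} {T : measurableType d} {R : realType}.
Variables (mu : {measure set T -> \bar R}) (G : set (set T)).
Hypothesis Gm : G `<=` measurable.

Lemma g_sigma_algebra_sub_measurable : <<s G >> `<=` measurable.
Proof. exact: smallest_sub (@sigma_algebra_measurable _ T) Gm. Qed.

Lemma measurable_fun_g_sigma_algebra d' (U : measurableType d') (h : T -> U) :
  @measurable_fun _ _ (g_sigma_algebraType G) U setT h ->
  measurable_fun setT h.
Proof.
by move=> mh _ B mB; apply: g_sigma_algebra_sub_measurable; exact: mh.
Qed.

Local Open Scope ereal_scope.

(** The densities [f] and [g] define two measures that agree on a pi-system containing the whole
    space; as the first has finite mass, they agree on the generated sigma-algebra. *)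
Lemma integral_g_sigma_algebra_unique (f g : T -> \bar R) :
  setI_closed G -> G setT ->
  measurable_fun setT f -> measurable_fun setT g ->
  (forall x, 0 <= f x) -> (forall x, 0 <= g x) -> \int[mu]_x f x < +oo ->
  (forall A, G A -> \int[mu]_(x in A) f x = \int[mu]_(x in A) g x) ->
  forall A, <<s G >> A -> \int[mu]_(x in A) f x = \int[mu]_(x in A) g x.
Proof.
move=> GI GT mf mg f0 g0 foo fg.
have [m1 m1E] := image_density_measure mu (@measurable_id _ T setT) mf f0.
have [m2 m2E] := image_density_measure mu (@measurable_id _ T setT) mg g0.
move=> A GA; rewrite -[LHS]m1E -[RHS]m2E.
apply: (@g_sigma_algebra_measure_unique _ _ _ G Gm (fun=> setT) _ _ m1 m2 GI) => //.
- by rewrite bigcup_const.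
- by move=> B GB; rewrite m1E m2E; exact: fg.
- by move=> _; rewrite m1E.
Qed.

(** The two densities induce the same measure on [<<s G>>], and an [h] measurable for [<<s G>>] sees
    nothing else. This passes from test events to nonnegative test functions. *)
Lemma ge0_integral_g_sigma_algebra (f g : T -> R) (h : T -> \bar R) :
  measurable_fun setT f -> measurable_fun setT g ->
  (forall x, 0 <= f x)%R -> (forall x, 0 <= g x)%R ->
  (forall A, <<s G >> A ->
    \int[mu]_(x in A) (f x)%:E = \int[mu]_(x in A) (g x)%:E) ->
  @measurable_fun _ _ (g_sigma_algebraType G) _ setT h -> (forall x, 0 <= h x) ->
  \int[mu]_x (h x * (f x)%:E) = \int[mu]_x (h x * (g x)%:E).
Proof.
move=> mf mg f0 g0 fg mh h0.
have mid : measurable_fun setT (id : T -> g_sigma_algebraType G).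
  by move=> _ B GB; rewrite setTI; exact: g_sigma_algebra_sub_measurable.
have mf' : measurable_fun setT (EFin \o f) by exact/measurable_EFinP.
have [nu nuE] := image_density_measure mu mid mf' (fun x => f0 x : 0 <= (f x)%:E).
rewrite -(ge0_integral_image_density mid (nu := nu))//.
by apply: (ge0_integral_image_density mid) => // A GA; rewrite nuE; exact: fg.
Qed.

End generated_sigma_algebra.

(** * Monotonicity of the integral off a null set; sums over countable fibres *)

Section integral_lower_bound.
Context {d : measure_display} {T : measurableType d} {R : realType}.
Variable mu : {measure set T -> \bar R}.
Local Open Scope ereal_scope.
Import HBNNSimple.

(** Here [f] will be a stopped value, whose measurability is unclear because of the limit superior
    at [+oo]. The integral of a nonnegative function is a supremum over simple functions below it,
    hence monotone in any case, and the negative part of [f] lives on the null set [Z]. *)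
Lemma ge0_integral_le_off_null (g f : T -> \bar R) (Z : set T) :
  measurable Z -> mu Z = 0 -> measurable_fun setT g -> (forall x, 0 <= g x) ->
  (forall x, ~ Z x -> g x <= f x) ->
  \int[mu]_x g x <= \int[mu]_x f x.
Proof.
move=> mZ muZ mg g0 gf.
have sup_le (a b : T -> \bar R) : (forall x, 0 <= a x) -> (forall x, 0 <= b x) ->
    (forall x, a x <= b x) -> \int[mu]_x a x <= \int[mu]_x b x.
  move=> a0 b0 ab; rewrite !ge0_integralTE//.
  apply: le_ereal_sup => _ [h ha <-] /=; exists h => // x.
  exact: le_trans (ha x) (ab x).
have fn0 : \int[mu]_x f^\- x = 0.
  apply/eqP; rewrite eq_le integral_ge0// andbT.
  have Zoo : \int[mu]_x (if x \in Z then +oo else 0) = 0.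
    rewrite [LHS](_ : _ = \int[mu]_(x in Z) +oo).
      by rewrite integral_cst//= muZ mule0.
    by rewrite [RHS]integral_mkcond.
  rewrite -[leRHS]Zoo; apply: sup_le => // x; first by case: ifPn.
  case: ifPn => [|]; first by rewrite leey.
  rewrite notin_setE => nZ; rewrite funenegE ge_max lexx andbT leeNl oppe0.
  exact: le_trans (g0 x) (gf x nZ).
rewrite [leRHS]integralE fn0 sube0.
have -> : \int[mu]_x g x = \int[mu]_x (g \_ (~` Z)) x.
  by rewrite -integral_mkcond -setTD; exact: ge0_negligible_integral.
apply: sup_le => // x; first exact: erestrict_ge0.
rewrite patchE; case: ifPn => [|_]; last by rewrite funeposE le_max lexx orbT.
move=> /set_mem nZ; rewrite funeposE le_max.
by rewrite gf.
Qed.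

End integral_lower_bound.

Lemma measurable_fun_select d (T : measurableType d) (R : realType)
    (k : T -> nat) (F : nat -> T -> R) :
  (forall n, measurable (k @^-1` [set n])) ->
  (forall n, measurable_fun setT (F n)) ->
  measurable_fun setT (fun x => F (k x) x).
Proof.
move=> mk mF _ B mB; rewrite setTI.
have -> : (fun x => F (k x) x) @^-1` B =
    \bigcup_n (k @^-1` [set n] `&` F n @^-1` B).
  apply/seteqP; split => [x Bx|x [n _ [/= <-]]//]; by exists (k x).
apply: bigcupT_measurable => n; apply: measurableI => //.
by rewrite -[_ @^-1` _]setTI; exact: mF.
Qed.

Section countable_preimage.
Context {d : measure_display} {T : measurableType d} {K : countType}.
Variable k : T -> K.
Hypothesis mk : forall v, measurable (k @^-1` [set v]).

(** Indexing by the codes [pickle v] makes the decomposition a union over [nat], ready for countable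
    additivity; each piece is empty or a genuine fibre. *)
Let fiber (S : set K) (n : nat) : set T :=
  k @^-1` [set v | pickle v = n /\ S v].

Let fiberE S n : fiber S n = set0 \/ exists v, fiber S n = k @^-1` [set v].
Proof.
have [[v [vn Sv]]|nv] := pselect (exists v, pickle v = n /\ S v).
  right; exists v; apply/seteqP; split => x; rewrite /fiber/= -vn.
    by move=> [/(pcan_inj pickleK)].
  by move=> ->.
left; apply/seteqP; split => // x; rewrite /fiber/= => kx.
by apply: nv; exists (k x).
Qed.

Let bigcup_fiber S : k @^-1` S = \bigcup_n fiber S n.
Proof.
by apply/seteqP; split => [x Sx|x [n _ []]//]; exists (pickle (k x)).
Qed.

Let mfiber S n : measurable (fiber S n).
Proof. by have [->|[v ->]] := fiberE S n. Qed.

Lemma measurable_countable_preimage (S : set K) : measurable (k @^-1` S).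
Proof. by rewrite bigcup_fiber; exact: bigcupT_measurable. Qed.

Lemma eq_integral_countable_preimage (R : realType)
    (mu : {measure set T -> \bar R}) (f g : T -> \bar R) (S : set K) :
  measurable_fun setT f -> measurable_fun setT g ->
  (forall x, 0 <= f x)%E -> (forall x, 0 <= g x)%E ->
  (forall v, \int[mu]_(x in k @^-1` [set v]) f x =
             \int[mu]_(x in k @^-1` [set v]) g x)%E ->
  (\int[mu]_(x in k @^-1` S) f x = \int[mu]_(x in k @^-1` S) g x)%E.
Proof.
move=> mf mg f0 g0 fg.
have tF : trivIset setT (fiber S).
  apply/trivIsetP => i j _ _ /eqP ij; apply/seteqP; split => // x [[ki _] [kj _]].
  by apply: ij; rewrite -ki.
rewrite bigcup_fiber !ge0_integral_bigcup//; try exact: measurable_funTS.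
apply: eq_eseriesr => n _.
by have [->|[v ->]] := fiberE S n; rewrite ?integral_set0.
Qed.

End countable_preimage.

(** * Cells generate the events observed at finitely many times *)

Fixpoint increments {R : realType} (n : R -> nat) t0 (G : seq R) : seq (R * nat) :=
  if G is t :: G' then (t, (n t - n t0)%N) :: increments n t G' else [::].

Section increments.
Context {R : realType}.
Implicit Types (n : R -> nat) (G : seq R).

Lemma unzip1_increments n t0 G : unzip1 (increments n t0 G) = G.
Proof. by elim: G t0 => //= t G IH t0; rewrite IH. Qed.

(** From a common initial value, increments and values determine each other. Monotonicity of [n0]
    makes the truncated subtraction in [increments] exact. *)
Lemma cell_increments n0 n t0 G :
  (forall u v, t0 <= u -> u <= v -> (n0 u <= n0 v)%N) ->
  n t0 = n0 t0 -> path <%R t0 G ->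
  cell n t0 (increments n0 t0 G) <-> map n G = map n0 G.
Proof.
elim: G t0 => //= t G IH t0 nmon nt0 /andP[t0t gG].
have n0t : (n0 t0 <= n0 t)%N by apply: nmon => //; exact: ltW.
rewrite nt0 subnKC//; split.
  move=> /andP[/eqP nt c]; rewrite nt; congr cons.
  apply/(IH t) => //; move=> u v tu; apply: nmon; exact: le_trans (ltW t0t) tu.
move=> [nt mG]; rewrite nt eqxx /=; apply/(IH t) => //.
by move=> u v tu; apply: nmon; exact: le_trans (ltW t0t) tu.
Qed.

(** The time [t] is added so that the grid ends there; [0] is dropped since the grid already starts
    at it, and the count vanishes there. *)
Definition time_grid (t : R) (F : seq R) : seq R :=
  sort <=%R (undup [seq u <- t :: F | 0 < u]).

Lemma mem_time_grid t F u : (u \in time_grid t F) = (0 < u) && (u \in t :: F).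
Proof. by rewrite mem_sort mem_undup mem_filter. Qed.

Lemma path_time_grid t F : path <%R 0 (time_grid t F).
Proof.
have : sorted <%R (time_grid t F).
  by rewrite sort_lt_sorted undup_uniq.
have : {in time_grid t F, forall u, 0 < u}.
  by move=> u; rewrite mem_time_grid => /andP[].
case: (time_grid t F) => //= u G H ->; rewrite andbT; apply: H.
exact: mem_head.
Qed.

Lemma path_le_last (s u : R) G : path <%R s G -> u \in s :: G -> u <= last s G.
Proof.
elim: G s u => [|v G IH] s u /=; first by rewrite inE => _ /eqP ->.
move=> /andP[sv pG]; rewrite inE => /predU1P[->|]; last exact: IH.
by apply: le_trans (ltW sv) (IH _ _ pG _); rewrite mem_head.
Qed.

Lemma last_time_grid t F : 0 <= t -> {in F, forall u, u <= t} ->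
  last 0 (time_grid t F) = t.
Proof.
move=> t0 Ft; apply/eqP; rewrite eq_le; apply/andP; split.
  have : last 0 (time_grid t F) \in 0 :: time_grid t F by exact: mem_last.
  rewrite inE => /predU1P[->//|]; rewrite mem_time_grid inE => /andP[_].
  by move=> /predU1P[->//|/Ft].
apply: path_le_last (path_time_grid t F) _.
by rewrite inE mem_time_grid mem_head andbT eq_sym -le_eqVlt.
Qed.

End increments.

Section cells_generate.
Context {d : measure_display} {T : measurableType d} {R : realType}.
Variables (n : R -> T -> nat).
Hypothesis mn : forall t, 0 <= t -> measurable_fun setT (n t).

Lemma measurable_map_fiber (F : seq R) (v : seq nat) : {in F, forall u, 0 <= u} ->
  measurable ((fun w => map (n ^~ w) F) @^-1` [set v]).
Proof.
elim: F v => [|u F IH] [|k v] F0.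
- rewrite (_ : _ @^-1` _ = setT)//; by apply/seteqP; split.
- rewrite (_ : _ @^-1` _ = set0)//; by apply/seteqP; split.
- rewrite (_ : _ @^-1` _ = set0)//; by apply/seteqP; split.
rewrite (_ : _ @^-1` _ = n u @^-1` [set k] `&` (fun w => map (n ^~ w) F) @^-1` [set v]).
  apply: measurableI.
    by rewrite -[_ @^-1` _]setTI; apply: mn => //; apply: F0; rewrite mem_head.
  by apply: IH => s sF; apply: F0; rewrite inE sF orbT.
by apply/seteqP; split => w /= [-> ->].
Qed.

Lemma measurable_map_preimage (F : seq R) (S : set (seq nat)) :
  {in F, forall u, 0 <= u} -> measurable [set w | S (map (n ^~ w) F)].
Proof.
move=> F0; apply: (@measurable_countable_preimage _ _ _ (fun w => map (n ^~ w) F)).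
by move=> v; exact: measurable_map_fiber.
Qed.

Hypothesis n0 : forall w, n 0 w = 0%N.
Hypothesis n_mono : forall w s t, 0 <= s -> s <= t -> (n s w <= n t w)%N.

(** The values at the times of [F] are a function of the values along [time_grid t F]. The event is
    thus a countable disjoint union of fibres of the latter, and the nonempty ones are cells ending
    at [t]. *)
Lemma eq_integral_cells (mu : {measure set T -> \bar R}) (f g : T -> \bar R) t :
  measurable_fun setT f -> measurable_fun setT g ->
  (forall x, 0 <= f x)%E -> (forall x, 0 <= g x)%E -> 0 <= t ->
  (forall l, grid 0 l -> grid_end 0 l = t ->
     \int[mu]_(x in [set w | cell (n ^~ w) 0 l]) f x =
     \int[mu]_(x in [set w | cell (n ^~ w) 0 l]) g x)%E ->
  forall (F : seq R) (S : set (seq nat)), {in F, forall u, 0 <= u <= t} ->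
  (\int[mu]_(x in [set w | S (map (n ^~ w) F)]) f x =
   \int[mu]_(x in [set w | S (map (n ^~ w) F)]) g x)%E.
Proof.
move=> mf mg f0 g0 t0 fg F S Ft; pose G := time_grid t F.
(* [S'] is [S] read off the grid: a time of [F] is either [0], where the count is [0], or a point of
   [G]. *)
pose S' := [set u | S [seq (if s == 0 then 0%N else nth 0%N u (index s G)) | s <- F]].
have nF w : [seq (if s == 0 then 0%N else nth 0%N (map (n ^~ w) G) (index s G)) | s <- F] =
    [seq n s w | s <- F].
  apply/eq_in_map => s sF; have [->|s0] := eqVneq s 0; first by rewrite n0.
  have sG : s \in G.
    rewrite mem_time_grid inE sF orbT andbT lt_neqAle eq_sym s0.
    by case/andP: (Ft s sF).
  by rewrite (nth_map 0) ?nth_index// index_mem.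
have -> : [set w | S (map (n ^~ w) F)] = (fun w => map (n ^~ w) G) @^-1` S'.
  by apply/seteqP; split => w; rewrite /S'/= nF.
have G0 : {in G, forall u, 0 <= u}.
  by move=> u; rewrite mem_time_grid => /andP[/ltW].
apply: eq_integral_countable_preimage => //.
  by move=> v; exact: measurable_map_fiber.
(* A nonempty fibre is the cell of any one of its paths [w0]. *)
move=> v; have [[w0 wv]|nv] := pselect (exists w, map (n ^~ w) G = v); last first.
  rewrite (_ : _ @^-1` _ = set0) ?integral_set0//.
  by apply/seteqP; split => // w wv; apply: nv; exists w.
have := fg (increments (n ^~ w0) 0 G).
rewrite /grid /grid_end unzip1_increments path_time_grid last_time_grid//; last first.
  by move=> u /Ft /andP[].
move=> /(_ isT erefl).
rewrite (_ : [set w | _] = (fun w => map (n ^~ w) G) @^-1` [set v])//.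
by apply/seteqP; split => w /=; rewrite -wv cell_increments ?n0 ?path_time_grid//;
  move=> u u' u0; exact: n_mono.
Qed.

End cells_generate.

(** * Independent coordinates and the observed filtration *)

Section disorder_sigma_algebras.
Context {d : measure_display} {Omega : measurableType d} {R : realType}.
Context {m : nat} (P : probability Omega R).
Variables (sigma : 'I_m -> Omega -> R) (N : 'I_m -> R -> Omega -> nat).
Hypothesis msigma : forall i, measurable_fun setT (sigma i).
Hypothesis cN : forall i, counting_process (N i).
Hypothesis indep : independent_sigma_algebras P (coordinate_sigma_algebra sigma N).

Let mN i t : 0 <= t -> measurable_fun setT (N i t).
Proof. by case: (cN i) => + _ _ _ _; exact. Qed.

Definition coordinate_events i : set (set Omega) :=
  preimage_set_system setT (sigma i) measurable `|`
  \bigcup_(t in `[0, +oo[) preimage_set_system setT (N i t) measurable.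

Lemma coordinate_events_measurable i : coordinate_events i `<=` measurable.
Proof.
move=> A [[B mB <-]|[t /=]]; first exact: msigma.
by rewrite in_itv/= andbT => t0 [B mB <-]; exact: mN.
Qed.

Lemma coordinate_measurable i A :
  coordinate_sigma_algebra sigma N i A -> measurable A.
Proof. by apply: g_sigma_algebra_sub_measurable; exact: coordinate_events_measurable. Qed.

(** [Omega] with the sigma-algebra of one coordinate, so that being a functional of that coordinate
    is plain [measurable_fun]. *)
Definition coordinate_type i := g_sigma_algebraType (coordinate_events i).

Lemma coordinate_measurable_sigma i :
  measurable_fun setT (sigma i : coordinate_type i -> R).
Proof.
by move=> _ B mB; apply: sub_sigma_algebra; left; exists B.
Qed.

Lemma coordinate_measurable_N i t : 0 <= t ->
  measurable_fun setT (N i t : coordinate_type i -> nat).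
Proof.
move=> t0 _ B mB; apply: sub_sigma_algebra; right; exists t; last by exists B.
by rewrite /= in_itv/= t0.
Qed.

Lemma observed_events_measurable t : observed_events N t `<=` measurable.
Proof.
move=> A [i _ [s /=]]; rewrite in_itv/= => /andP[s0 _] [B mB <-]; exact: mN.
Qed.

Lemma observed_measurable t A : observed_filtration N t A -> measurable A.
Proof. by apply: g_sigma_algebra_sub_measurable; exact: observed_events_measurable. Qed.

Lemma observed_filtration_le s t : s <= t ->
  observed_filtration N s `<=` observed_filtration N t.
Proof.
move=> st; apply: sub_sigma_algebra2 => A [i _ [u /=]]; rewrite in_itv/= => /andP[u0 us] [B mB <-].
exists i => //; exists u; last by exists B.
by rewrite /= in_itv/= u0 (le_trans us st).
Qed.

Lemma fine_fin_numE (A : set Omega) : measurable A -> ((fine (P A))%:E = P A)%E.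
Proof. by move=> mA; rewrite fineK// fin_num_measure. Qed.

(** By independence the indicator of [B], the intersection of the events of the other coordinates,
    and the constant [P B] have equal integrals over every event of coordinate [i]. Hence they also
    do against the weight [f * \1_(A i)]. *)
Lemma integral_indep_coordinate i (f : Omega -> R) (A : 'I_m -> set Omega) :
  measurable_fun setT (f : coordinate_type i -> R) -> (forall x, 0 <= f x) ->
  (forall j, coordinate_sigma_algebra sigma N j (A j)) ->
  (\int[P]_(x in \bigcap_(j in setT) A j) (f x)%:E =
   (\prod_(j < m | j != i) P (A j)) * \int[P]_(x in A i) (f x)%:E)%E.
Proof.
move=> mf f0 cA.
have mA j : measurable (A j) by exact: coordinate_measurable (cA j).
have setTc j : coordinate_sigma_algebra sigma N j setT.
  exact: (@measurableT _ (coordinate_type j)).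
pose B := \bigcap_(j in [set j | j != i]) A j.
have mB : measurable B by apply: fin_bigcap_measurable => [|j _]; [exact: finite_finset|].
have AB C : \bigcap_(j in setT) (if j == i then C else A j) = C `&` B.
  apply/seteqP; split => [x H|x [Cx Bx] j _].
    split; first by have := H i Logic.I; rewrite eqxx.
    by move=> j /= ji; have := H j Logic.I; rewrite (negbTE ji).
  by case: ifPn => // ji; exact: Bx.
have PAB C : coordinate_sigma_algebra sigma N i C ->
    P (C `&` B) = (P C * \prod_(j < m | j != i) P (A j))%E.
  move=> cC; rewrite -AB indep; last by move=> j; case: eqP => [->|].
  rewrite (bigD1 i)//= eqxx; congr (_ * _)%E.
  by apply: eq_bigr => j /negbTE ->.
have PB : P B = (\prod_(j < m | j != i) P (A j))%E.
  by have := PAB setT (setTc i); rewrite setTI probability_setT mul1e.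
rewrite -PB.
have -> : \bigcap_(j in setT) A j = A i `&` B.
  rewrite -AB; apply: eq_bigcapr => j _; by case: eqP => // ->.
have mf' := measurable_fun_g_sigma_algebra (@coordinate_events_measurable i) mf.
have H := @ge0_integral_g_sigma_algebra _ _ _ P _ (@coordinate_events_measurable i)
  (\1_B) (cst (fine (P B))) (fun x => (f x * \1_(A i) x)%:E).
transitivity (\int[P]_x ((f x * \1_(A i) x)%:E * (\1_B x)%:E))%E.
  rewrite integral_mkcond; apply: eq_integral => x _.
  by rewrite epatch_indic indicI/= !EFinM muleA.
rewrite H//.
- under eq_integral do rewrite /= muleC.
  rewrite ge0_integralZl//.
  + rewrite fine_fin_numE//; congr (_ * _)%E.
    rewrite [in RHS]integral_mkcond; apply: eq_integral => x _.
    by rewrite epatch_indic/= EFinM.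
  + apply/measurable_EFinP; apply: measurable_funM => //; exact: measurable_indic.
  + by move=> x _; rewrite lee_fin mulr_ge0.
  + by rewrite lee_fin fine_ge0.
- by move=> x; rewrite fine_ge0.
- move=> C cC; have mC := coordinate_measurable cC.
  transitivity (P (C `&` B)); first by rewrite integral_indic// setIC.
  by rewrite PAB// /= integral_cst//= fine_fin_numE// PB muleC.
- apply/measurable_EFinP; apply: measurable_funM => //.
  by apply: measurable_indic; exact: cA.
- by move=> x; rewrite lee_fin mulr_ge0.
Qed.

(** One list of times serves all coordinates, so that the intersection of two cylinders is obtained
    by concatenating their lists. *)
Definition cylinder (t : R) : set (set Omega) :=
  [set A | exists F : seq R, exists S : 'I_m -> set (seq nat),
    {in F, forall u, 0 <= u <= t} /\
    A = \bigcap_(j in setT) [set w | S j (map (N j ^~ w) F)]].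

(** Cylinders are a pi-system generating the observations. On a cylinder the other coordinates
    contribute the same factor to both sides, and what remains is an event of coordinate [i] at
    finitely many times. *)
Lemma eq_integral_observed i (f g : Omega -> R) t : 0 <= t ->
  measurable_fun setT (f : coordinate_type i -> R) ->
  measurable_fun setT (g : coordinate_type i -> R) ->
  (forall x, 0 <= f x) -> (forall x, 0 <= g x) ->
  (\int[P]_x (f x)%:E < +oo)%E ->
  (forall l, grid 0 l -> grid_end 0 l = t ->
     \int[P]_(x in [set w | cell (N i ^~ w) 0 l]) (f x)%:E =
     \int[P]_(x in [set w | cell (N i ^~ w) 0 l]) (g x)%:E)%E ->
  forall A, observed_filtration N t A ->
  (\int[P]_(x in A) (f x)%:E = \int[P]_(x in A) (g x)%:E)%E.
Proof.
move=> t0 mf mg f0 g0 foo fg A oA.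
have mf' := measurable_fun_g_sigma_algebra (@coordinate_events_measurable i) mf.
have mg' := measurable_fun_g_sigma_algebra (@coordinate_events_measurable i) mg.
have F0 (F : seq R) : {in F, forall u, 0 <= u <= t} -> {in F, forall u, 0 <= u}.
  by move=> Ft u /Ft /andP[].
have [_ N0 Nmono _ _] := cN i.
apply: (@integral_g_sigma_algebra_unique _ _ _ P (cylinder t)) => //.
- move=> B [F [S [Ft ->]]]; apply: fin_bigcap_measurable => [|j _]; first exact: finite_finset.
  by apply: measurable_map_preimage; [exact: mN|exact: F0].
- move=> B C [F [S [Ft ->]]] [F' [S' [Ft' ->]]].
  exists (F ++ F'), (fun j => [set v | S j (take (size F) v) /\ S' j (drop (size F) v)]).
  split; first by move=> u; rewrite mem_cat => /orP[/Ft|/Ft'].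
  rewrite -bigcapI; apply: eq_bigcapr => j _; apply/seteqP; split => w /=.
    by move=> [Sw S'w]; rewrite map_cat take_size_cat ?drop_size_cat ?size_map.
  by rewrite map_cat take_size_cat ?drop_size_cat ?size_map.
- exists [::], (fun=> setT); split => //.
  by apply/seteqP; split.
- exact/measurable_EFinP.
- exact/measurable_EFinP.
- move=> B [F [S [Ft ->]]].
  have cS j : coordinate_sigma_algebra sigma N j [set w | S j (map (N j ^~ w) F)].
    apply: (@measurable_map_preimage _ (coordinate_type j) _ (N j)); last exact: F0.
    by move=> u; exact: coordinate_measurable_N.
  rewrite !(@integral_indep_coordinate i)//; congr (_ * _)%E.
  by apply: (eq_integral_cells _ _ _ _ _ _ _ t0) => //; try exact/measurable_EFinP;
    exact: mN.
- move: A oA; apply: sub_sigma_algebra2 => A [j _ [s /=]]; rewrite in_itv/= => /andP[s0 st] [B mB <-].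
  rewrite setTI.
  (* A generator concerns one time and one coordinate; [head] reads the only count in the list, and
     the other coordinates are unconstrained. *)
  exists [:: s], (fun k => if k == j then [set v | B (head 0%N v)] else setT).
  split; first by move=> u; rewrite inE => /eqP ->; rewrite s0 st.
  apply/seteqP; split => w /=; last by move=> /(_ j Logic.I); rewrite eqxx.
  by move=> Bw k _; case: eqP => // ->.
Qed.

End disorder_sigma_algebras.

(** * Right-continuous processes along grids *)

Section upper_grid_points.
Context {R : realType}.
Implicit Types (s : R) (n k : nat).

(** Index of the first multiple of [n.+1%:R^-1] strictly above [s]: a limit from the right only
    concerns times strictly after [s]. *)
Definition grid_index n s : nat := (Num.truncn (n.+1%:R * s)).+1.
Definition grid_point n s : R := (grid_index n s)%:R / n.+1%:R.

Lemma lt_grid_index n s k : 0 <= s -> (k < grid_index n s)%N = (k%:R / n.+1%:R <= s).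
Proof.
move=> s0; rewrite ltnS truncn_ge_nat ?mulr_ge0//.
by rewrite ler_pdivrMr ?ltr0n// mulrC.
Qed.

Lemma grid_point_gt n s : 0 <= s -> s < grid_point n s.
Proof. by move=> s0; rewrite ltNge -lt_grid_index// ltnn. Qed.

Lemma grid_point_le n s : 0 <= s -> grid_point n s <= s + n.+1%:R^-1.
Proof.
move=> s0; rewrite /grid_point /grid_index -natr1 mulrDl mul1r lerD2r.
by rewrite -lt_grid_index.
Qed.

Lemma cvg_grid_point s : 0 <= s -> grid_point n s @[n --> \oo] --> s.
Proof.
move=> s0; apply: (@squeeze_cvgr _ _ _ _ (cst s) (fun n => s + n.+1%:R^-1)).
- by apply: nearW => n; rewrite grid_point_le// ltW// grid_point_gt.
- exact: cvg_cst.
- rewrite -[X in _ --> X]addr0; apply: cvgD; first exact: cvg_cst.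
  exact: (@cvg_harmonic R).
Qed.

Lemma right_continuous_grid_point (x : R -> R) s (l : R) : 0 <= s ->
  x u @[u --> s^'+] --> l -> x (grid_point n s) @[n --> \oo] --> l.
Proof.
move=> s0 /(@cvg_at_rightP R) xl; apply: (xl (grid_point ^~ s)).
split; last exact: cvg_grid_point.
by move=> n; exact: grid_point_gt.
Qed.

Lemma measurable_grid_index d (T : measurableType d) n (y : T -> R) k :
  (forall x, 0 <= y x) -> measurable_fun setT y ->
  measurable ((fun x => grid_index n (y x)) @^-1` [set k]).
Proof.
move=> y0 my; have [->|k0] := posnP k.
  by rewrite (_ : _ @^-1` _ = set0)//; apply/seteqP; split.
rewrite (_ : _ @^-1` _ = y @^-1` `[k.-1%:R / n.+1%:R, k%:R / n.+1%:R[).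
  by rewrite -[_ @^-1` _]setTI; exact: my.
apply/seteqP; split => x /=; rewrite in_itv/= -lt_grid_index// ltNge -lt_grid_index//.
  by move=> ->; rewrite prednK// leqnn ltnn.
by rewrite prednK// -leqNgt => /andP[? ?]; apply/eqP; rewrite eqn_leq; apply/andP.
Qed.

End upper_grid_points.

Section right_continuous_process.
Context {d : measure_display} {T : measurableType d} {R : realType}.

(* Processes are only controlled at nonnegative times. *)
Definition clamp (t s : R) : R := Num.min t (Num.max 0 s).

Lemma clamp_itv t s : 0 <= t -> 0 <= clamp t s <= t.
Proof. by move=> t0; rewrite /clamp le_min ge_min t0 lexx le_max lexx. Qed.

Lemma clamp_id t s : 0 <= s <= t -> clamp t s = s.
Proof. by move=> /andP[s0 st]; rewrite /clamp max_r// min_r. Qed.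

Lemma measurable_clamp t : measurable_fun setT (clamp t).
Proof. by apply: measurable_minr => //; exact: measurable_maxr. Qed.

(** Progressive measurability: the value at a time is the limit of the values at the next grid
    points. Cutting these off at [t] ensures that only times in [[0, t]] are read, so it applies to
    the information at [t]. *)
Lemma measurable_right_continuous (x : R -> T -> R) t : 0 <= t ->
  (forall s, 0 <= s <= t -> measurable_fun setT (x s)) ->
  (forall w s, 0 <= s -> x u w @[u --> s^'+] --> x s w) ->
  measurable_fun setT (fun p : T * R => x (clamp t p.2) p.1).
Proof.
move=> t0 mx xr.
pose xn n (p : T * R) := x (Num.min t (grid_point n (clamp t p.2))) p.1.
apply: (@measurable_fun_cvg _ _ _ _ xn).
- move=> n; rewrite /xn /grid_point.
  have mk k : measurable ((fun p : T * R => grid_index n (clamp t p.2)) @^-1` [set k]).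
    apply: measurable_grid_index; first by move=> p; case/andP: (clamp_itv p.2 t0).
    by apply: measurableT_comp measurable_snd; exact: measurable_clamp.
  apply: (measurable_fun_select (F := fun k p => x (Num.min t (k%:R / n.+1%:R)) p.1) mk).
  move=> k; apply: measurableT_comp measurable_fst; apply: mx.
  by rewrite ge_min lexx/= andbT le_min t0 divr_ge0.
move=> [w s] _; rewrite /xn/=.
have /andP[] := clamp_itv s t0; set s' := clamp t s => s'0.
rewrite le_eqVlt => /predU1P[->|s't].
  rewrite (_ : (fun n => _) = fun=> x t w); first exact: cvg_cst.
  by apply/funext => n; rewrite min_l// ltW// grid_point_gt.
have /(@cvg_at_rightP R) xl := xr w s' s'0.
apply: (xl (fun n => Num.min t (grid_point n s'))); split.
  by move=> n; rewrite lt_min s't grid_point_gt.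
apply: (@squeeze_cvgr _ _ _ _ (cst s') (fun n => grid_point n s')).
- apply: nearW => n; apply/andP; split; last by rewrite ge_min lexx orbT.
  by rewrite le_min !ltW// grid_point_gt.
- exact: cvg_cst.
- exact: cvg_grid_point.
Qed.

End right_continuous_process.

(** * The odds as a functional of one path *)

Section odds_of_path.
Context {R : realType}.
Notation leb := (@lebesgue_measure R).
Variables (lambda mu0 mu1 : R).
Implicit Types (n : R -> nat) (s t u : R).
Hypotheses (lambda_gt0 : 0 < lambda) (mu0_gt0 : 0 < mu0).
Hypotheses (mu_le : 0 <= mu1 - mu0) (lambda_ge : mu1 - mu0 <= lambda).

(** Between jumps the odds solve [phi' = lambda + kappa phi], and a jump multiplies them by
    [mu1 / mu0]. Their monotonicity rests on [kappa >= 0] and [ln (mu1 / mu0) >= 0]. *)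
Let kappa := lambda + mu0 - mu1.
Let kappa_ge0 : 0 <= kappa.
Proof. by rewrite /kappa -addrA -opprB subr_ge0. Qed.
Let lnr_ge0 : 0 <= ln (mu1 / mu0).
Proof. by rewrite ln_ge0// ler_pdivlMr// mul1r -subr_ge0. Qed.

Definition right_continuous_path (n : R -> nat) :=
  forall t, 0 <= t -> \forall s \near t^'+, n s = n t.
Definition nondecreasing_path (n : R -> nat) :=
  forall s t, 0 <= s -> s <= t -> (n s <= n t)%N.

Lemma cvg_right_continuous_path n t : right_continuous_path n -> 0 <= t ->
  ((n u)%:R : R) @[u --> t^'+] --> ((n t)%:R : R).
Proof.
move=> nr t0; apply: cvg_near_cst; near=> u; congr (_%:R).
by near: u; exact: nr.
Unshelve. all: by end_near. Qed.

Lemma measurable_clamped_path (n : R -> nat) t : right_continuous_path n -> 0 <= t ->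
  measurable_fun setT (fun s : R => (n (clamp t s))%:R : R).
Proof.
move=> nr t0.
have := @measurable_right_continuous _ unit R (fun s _ => (n s)%:R) t t0.
have H1 : forall s : R, 0 <= s <= t -> measurable_fun setT (fun _ : unit => (n s)%:R : R) by [].
move=> /(_ H1 (fun _ s => @cvg_right_continuous_path n s nr)) H.
exact: (measurableT_comp H (pair1_measurable tt)).
Qed.

Definition odds_weight (n : R -> nat) (s : R) : R :=
  expR (- kappa * s) * expR (- (n s)%:R * ln (mu1 / mu0)).

Lemma odds_weight_ge0 n s : 0 <= odds_weight n s.
Proof. by rewrite mulr_ge0// expR_ge0. Qed.

Lemma odds_weight_le1 n s : 0 <= s -> odds_weight n s <= 1.
Proof.
move=> s0; rewrite /odds_weight -expRD -expR0 ler_expR.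
by rewrite !mulNr -opprD oppr_le0 addr_ge0// mulr_ge0.
Qed.

Lemma measurable_odds_weight n t : right_continuous_path n -> 0 <= t ->
  measurable_fun `[0, t] (odds_weight n).
Proof.
move=> nr t0.
apply: (eq_measurable_fun (fun s => odds_weight n (clamp t s))).
  by move=> s; rewrite inE/= in_itv/= => st; rewrite clamp_id.
apply: measurable_funTS; rewrite /odds_weight; apply: measurable_funM.
  apply: measurableT_comp => //; apply: measurable_funM => //.
  exact: measurable_clamp.
apply: measurableT_comp => //; apply: measurable_funM => //.
by apply: measurableT_comp => //; exact: measurable_clamped_path.
Qed.

Lemma integrable_odds_weight n t : right_continuous_path n -> 0 <= t ->
  leb.-integrable `[0, t] (EFin \o odds_weight n).
Proof.
move=> nr t0; apply: (@bounded_integrable _ _ _ _ _ _ 1) => //.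
- by rewrite /= lebesgue_measure_itv/=; case: ifP => // _; rewrite ltry.
- exact: measurable_odds_weight.
- move=> s /=; rewrite in_itv/= => /andP[s0 _].
  by rewrite ger0_norm ?odds_weight_ge0// odds_weight_le1.
Qed.

Definition odds_integral n t : R := \int[leb]_(s in `[0, t]) odds_weight n s.

Lemma posterior_oddsE n t : posterior_odds lambda mu0 mu1 n t =
  lambda * expR (kappa * t) * expR ((n t)%:R * ln (mu1 / mu0)) * odds_integral n t.
Proof. by []. Qed.

Lemma Rintegral_cst_itv0 (c t : R) : 0 <= t ->
  \int[leb]_(s in `[0, t]) c = c * t.
Proof.
move=> t0; rewrite Rintegral_cst//= lebesgue_measure_itv/= lte_fin.
by case: ltP => /= t0'; rewrite ?subr0// (le_anti (introT andP (conj t0 t0'))).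
Qed.

Lemma odds_integral_ge0 n t : 0 <= odds_integral n t.
Proof. by apply: Rintegral_ge0 => s _; exact: odds_weight_ge0. Qed.

(** The integrand lies between 0 and 1. The lower bound serves the monotonicity of the odds, the
    upper one their right continuity. *)
Lemma odds_integral_lipschitz n s t : right_continuous_path n -> 0 <= s -> s <= t ->
  odds_integral n s <= odds_integral n t <= odds_integral n s + (t - s).
Proof.
move=> nr s0 st; have t0 := le_trans s0 st.
rewrite -subr_ge0 -[X in _ && X]lerBlDl.
have -> : odds_integral n t - odds_integral n s =
    \int[leb]_(u in `]s, t]) odds_weight n u.
  rewrite /odds_integral Rintegral_itvB ?bnd_simp//.
  exact: integrable_odds_weight.
rewrite Rintegral_ge0 ?andTb; last by move=> u _; exact: odds_weight_ge0.
have -> : t - s = \int[leb]_(u in `]s, t]) 1.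
  rewrite Rintegral_cst//= lebesgue_measure_itv/= lte_fin mul1r.
  case: ltP => //= ts; by rewrite (le_anti (introT andP (conj st ts))) subrr.
apply: le_Rintegral => //.
- apply: integrableS (integrable_odds_weight nr t0) => //.
  by apply: subset_itvr; rewrite bnd_simp.
- apply: (@bounded_integrable _ _ _ _ _ _ 1) => //.
    by rewrite /= lebesgue_measure_itv/=; case: ifP => // _; rewrite ltry.
  by move=> ? _; rewrite normr1.
- move=> u /=; rewrite in_itv/= => /andP[su _].
  by rewrite odds_weight_le1// (le_trans s0 (ltW su)).
Qed.

Lemma odds_integral_lb n t : right_continuous_path n -> nondecreasing_path n ->
  0 <= t -> odds_weight n t * t <= odds_integral n t.
Proof.
move=> nr nd t0; rewrite -Rintegral_cst_itv0//; apply: le_Rintegral => //.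
- apply: (@bounded_integrable _ _ _ _ _ _ 1) => //.
    by rewrite /= lebesgue_measure_itv/=; case: ifP => // _; rewrite ltry.
  by move=> ? _; rewrite ger0_norm ?odds_weight_ge0// odds_weight_le1.
- exact: integrable_odds_weight.
- move=> s /=; rewrite in_itv/= => /andP[s0 st].
  apply: ler_pM; rewrite ?expR_ge0// ler_expR !mulNr lerN2.
    by rewrite ler_wpM2l.
  by rewrite ler_wpM2r// ler_nat; exact: nd.
Qed.

Lemma posterior_odds_ge0 n t : 0 <= posterior_odds lambda mu0 mu1 n t.
Proof.
rewrite posterior_oddsE !mulr_ge0 ?expR_ge0 ?odds_integral_ge0//.
exact: ltW.
Qed.

Lemma posterior_odds_nondecreasing n s t :
  right_continuous_path n -> nondecreasing_path n -> 0 <= s -> s <= t ->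
  posterior_odds lambda mu0 mu1 n s <= posterior_odds lambda mu0 mu1 n t.
Proof.
move=> nr nd s0 st; rewrite !posterior_oddsE.
apply: ler_pM; rewrite ?odds_integral_ge0//.
- by rewrite !mulr_ge0 ?expR_ge0// ltW.
- apply: ler_pM; rewrite ?expR_ge0//.
  + by rewrite mulr_ge0 ?expR_ge0// ltW.
  + by rewrite ler_pM2l// ler_expR ler_wpM2l.
  + by rewrite ler_expR ler_wpM2r// ler_nat; exact: nd.
- by case/andP: (odds_integral_lipschitz nr s0 st).
Qed.

(** The integrand is nonincreasing in time, so the integral is at least [t] times its final value,
    and that value is [lambda] divided by the prefactor of the integral. *)
Lemma posterior_odds_lb n t : right_continuous_path n -> nondecreasing_path n ->
  0 <= t -> lambda * t <= posterior_odds lambda mu0 mu1 n t.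
Proof.
move=> nr nd t0; rewrite posterior_oddsE.
have c0 : 0 < lambda * expR (kappa * t) * expR ((n t)%:R * ln (mu1 / mu0)).
  by rewrite !mulr_gt0// expR_gt0.
apply: le_trans (ler_wpM2l (ltW c0) (odds_integral_lb nr nd t0)).
rewrite /odds_weight !mulNr !expRN.
have e1 := expR_gt0 (kappa * t); have e2 := expR_gt0 ((n t)%:R * ln (mu1 / mu0)).
move: (expR _) e1 (expR _) e2 => a a0 b b0.
have -> // : lambda * a * b * (a^-1 * b^-1 * t) = lambda * t.
by field; rewrite !gt_eqF.
Qed.

Lemma posterior_odds_right_continuous n t : right_continuous_path n -> 0 <= t ->
  posterior_odds lambda mu0 mu1 n u @[u --> t^'+] --> posterior_odds lambda mu0 mu1 n t.
Proof.
move=> nr t0; under eq_fun do rewrite posterior_oddsE; rewrite posterior_oddsE.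
apply: cvgM; first apply: cvgM.
- apply: cvgM; first exact: cvg_cst.
  apply: cvg_at_right_filter; apply: continuous_comp; last exact: continuous_expR.
  by apply: continuousM => //; exact: cvg_cst.
- apply: cvg_near_cst; near=> u; congr (expR (_%:R * _)).
  by near: u; exact: nr.
- apply: (@squeeze_cvgr _ _ _ _ (cst (odds_integral n t))
    (fun u => odds_integral n t + (u - t))).
  + near=> u; apply: odds_integral_lipschitz => //.
  + exact: cvg_cst.
  + rewrite -[X in _ --> X]addr0 -[X in _ + X](subrr t).
    apply: cvgD; first exact: cvg_cst.
    apply: cvgB; last exact: cvg_cst.
    by apply: cvg_at_right_filter; exact: cvg_id.
Unshelve. all: by end_near. Qed.

(* Given the path on [0, t], the density of a switch at [s] divided by the
   probability of a switch after [t]. *)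
Definition odds_kernel (n : R -> nat) t s : R :=
  lambda * expR (kappa * (t - s)) *
  expR (((n t)%:R - (n s)%:R) * ln (mu1 / mu0)).

Lemma odds_kernel_ge0 n t s : 0 <= odds_kernel n t s.
Proof. by rewrite !mulr_ge0 ?expR_ge0// ltW. Qed.

(** Moving the prefactor under the integral sign gives a nonnegative kernel to which Tonelli
    applies; [clamp] and the indicator extend it to all real [s]. *)
Lemma posterior_odds_kernel n t : right_continuous_path n -> 0 <= t ->
  ((posterior_odds lambda mu0 mu1 n t)%:E =
   \int[leb]_s (odds_kernel n t (clamp t s) * \1_`[0%R, t] s)%:E)%E.
Proof.
move=> nr t0; set c := lambda * expR (kappa * t) * expR ((n t)%:R * ln (mu1 / mu0)).
have -> : posterior_odds lambda mu0 mu1 n t =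
    \int[leb]_(s in `[0, t]) (c * odds_weight n s).
  by rewrite posterior_oddsE RintegralZl//; exact: integrable_odds_weight.
rewrite /Rintegral fineK; last first.
  apply: integrable_fin_num => //.
  exact: (integrableZl _ c (integrable_odds_weight nr t0)).
rewrite integral_mkcond; apply: eq_integral => s _.
rewrite patchE indicE; case: ifPn => [|_]; last by rewrite mulr0.
rewrite inE/= in_itv/= => st; rewrite mulr1 clamp_id//; congr EFin.
rewrite /c /odds_kernel /odds_weight.
have -> : kappa * (t - s) = kappa * t + - kappa * s by ring.
have -> : ((n t)%:R - (n s)%:R) * ln (mu1 / mu0) =
  (n t)%:R * ln (mu1 / mu0) + (- (n s)%:R) * ln (mu1 / mu0) by ring.
by rewrite !expRD; ring.
Qed.

End odds_of_path.

Section odds_measurability.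
Context {d : measure_display} {T : measurableType d} {R : realType}.
Variables (lambda mu0 mu1 : R) (N : R -> T -> nat) (t : R).
Hypotheses (lambda_gt0 : 0 < lambda) (mu0_gt0 : 0 < mu0).
Hypotheses (mu_le : 0 <= mu1 - mu0) (lambda_ge : mu1 - mu0 <= lambda).
Hypothesis t0 : 0 <= t.
Hypothesis mN : forall s, 0 <= s <= t -> measurable_fun setT (N s).
Hypothesis Nr : forall w, right_continuous_path (N ^~ w).
Notation leb := (@lebesgue_measure R).

Lemma measurable_odds_kernel : measurable_fun setT (fun p : T * R =>
  (odds_kernel lambda mu0 mu1 (N ^~ p.1) t (clamp t p.2) * \1_`[0, t] p.2 : R)).
Proof.
rewrite /odds_kernel.
have mNR s : 0 <= s <= t -> measurable_fun setT (fun w => (N s w)%:R : R).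
  by move=> /mN mNs; exact: measurableT_comp.
have mNc := @measurable_right_continuous _ T R (fun s w => (N s w)%:R) t t0 mNR
  (fun w s => @cvg_right_continuous_path R _ s (Nr w)).
apply: measurable_funM; last first.
  have m1 : measurable_fun setT (\1_`[0, t] : R -> R) by exact: measurable_indic.
  exact: (measurableT_comp m1 measurable_snd).
apply: measurable_funM.
  apply: measurable_funM => //; apply: measurableT_comp => //.
  apply: measurable_funM => //; apply: measurable_funB => //.
  exact: (measurableT_comp (measurable_clamp t) measurable_snd).
apply: measurableT_comp => //; apply: measurable_funM => //.
apply: measurable_funB => //.
have mNt : measurable_fun setT (fun w => (N t w)%:R : R) by apply: mNR; rewrite t0 lexx.
exact: (measurableT_comp mNt measurable_fst).
Qed.

(** A partial integral of a jointly measurable kernel. As [T] is generic and only times up to [t]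
    enter, it may be [Omega] with the sigma-algebra of one coordinate or with that of the
    observations up to [t]. *)
Lemma measurable_posterior_odds :
  measurable_fun setT (fun w => posterior_odds lambda mu0 mu1 (N ^~ w) t).
Proof.
apply/measurable_EFinP.
pose h (p : T * R) : \bar R :=
  (odds_kernel lambda mu0 mu1 (N ^~ p.1) t (clamp t p.2) * \1_`[0%R, t] p.2)%:E.
rewrite (_ : _ \o _ = fubini_F leb h); last first.
  by apply/funext => w; rewrite /fubini_F /h/= posterior_odds_kernel.
apply: measurable_fun_fubini_tonelli_F.
  by apply/measurable_EFinP; exact: measurable_odds_kernel.
by move=> p; rewrite lee_fin mulr_ge0// odds_kernel_ge0.
Qed.

End odds_measurability.

Lemma weight_ext (R : realType) (L L' : R -> R -> R) t0 l :
  (forall a b, t0 <= a -> a < b -> b <= grid_end t0 l -> L a b = L' a b) ->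
  grid t0 l -> weight L t0 l = weight L' t0 l.
Proof.
elim: l t0 => [|[t k] l IH] t0 //= LL' /andP[t0t gl].
rewrite LL'//; last exact: (grid_le_end gl).
by rewrite IH// => a b ta; apply: LL'; exact: le_trans (ltW t0t) ta.
Qed.

(** * One coordinate: cells together with a late switch *)

Section single_coordinate.
Context {d : measure_display} {Omega : measurableType d} {R : realType}.
Context (P : probability Omega R).
Notation leb := (@lebesgue_measure R).
Variables (lambda mu0 mu1 : R).
Hypotheses (lambda_gt0 : 0 < lambda) (mu0_gt0 : 0 < mu0) (mu1_gt0 : 0 < mu1).
Variables (sigma : {RV P >-> R}) (N : R -> Omega -> nat).
Hypothesis sigma_exp : forall B : set R, measurable B ->
  distribution P sigma B = exponential_prob lambda B.
Hypothesis cN : counting_process N.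
Hypothesis cp : conditionally_poisson P sigma N (switching_rate mu0 mu1).

Implicit Types (s t : R).

Lemma counting_path_right_continuous w : right_continuous_path (N ^~ w).
Proof. by move=> t t0; case: cN => _ _ _ + _; exact. Qed.

Lemma counting_path_nondecreasing w : nondecreasing_path (N ^~ w).
Proof. by move=> s t s0 st; case: cN => _ _ + _ _; apply. Qed.

Lemma measurable_cell t0 l : 0 <= t0 -> grid t0 l ->
  measurable [set w | cell (N ^~ w) t0 l].
Proof.
have [mN _ _ _ _] := cN.
elim: l t0 => [|[t k] l IH] t0 t00 /=; first by move=> _; rewrite (_ : mkset _ = setT)//; apply/seteqP.
move=> /andP[t0t gl]; have t'0 := le_trans t00 (ltW t0t).
rewrite (_ : mkset _ =
  [set w | [set v : seq nat | nth 0%N v 1 = (nth 0%N v 0 + k)%N] (map (N ^~ w) [:: t0; t])] `&`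
  [set w | cell (N ^~ w) t l]).
  apply: measurableI; last exact: IH.
  apply: (@measurable_map_preimage _ Omega R N mN [:: t0; t]) => u.
  by rewrite !inE => /orP[] /eqP ->.
by apply/seteqP; split => w /= => [/andP[/eqP]|[/eqP -> ->]].
Qed.

Lemma ge0_integral_exponential (h : R -> \bar R) :
  measurable_fun setT h -> (forall x, 0 <= h x)%E ->
  (\int[P]_w h (sigma w) =
   \int[leb]_x (h x * (exponential_pdf lambda x)%:E))%E.
Proof.
move=> mh h0; rewrite -(ge0_integral_distribution sigma mh h0).
apply: (@ge0_integral_image_density _ _ (measurableTypeR R) R R leb id
  (@measurable_id _ _ setT) (distribution P sigma) (exponential_pdf lambda)) => //.
- exact: measurable_exponential_pdf.
- by move=> x; apply: exponential_pdf_ge0; exact: ltW.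
Qed.

Lemma measurable_sigma_gt s : measurable [set w | s < sigma w].
Proof.
rewrite (_ : mkset _ = sigma @^-1` `]s, +oo[).
  by rewrite -[_ @^-1` _]setTI; exact: measurable_funPT.
by apply/seteqP; split => w /=; rewrite in_itv/= andbT.
Qed.

Lemma measurable_sigma_le s : measurable [set w | sigma w <= s].
Proof.
rewrite (_ : mkset _ = ~` [set w | s < sigma w]).
  exact/measurableC/measurable_sigma_gt.
by apply/seteqP; split => w /=; rewrite leNgt => /negP.
Qed.

Lemma probability_sigma_le s : 0 <= s ->
  (P [set w | (sigma w <= s)%R] = (1 - expR (- lambda * s))%:E)%E.
Proof.
have H u : P [set w | sigma w <= u] = exponential_prob lambda `]-oo, u].
  by rewrite -sigma_exp// /distribution /pushforward; congr (P _).
have H0 (B : set R) : B `<=` [set x | x < 0] -> exponential_prob lambda B = 0%E.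
  move=> B0; rewrite /exponential_prob integral0_eq// => x /B0 x0.
  by rewrite lt0_exponential_pdf.
rewrite le_eqVlt => /predU1P[<-|s0].
  rewrite mulr0 expR0 subrr H.
  rewrite (_ : `]-oo, 0%R] = `]-oo, 0%R[ `|` [set 0%R])%classic; last first.
    by rewrite setUitv1// bnd_simp.
  rewrite /exponential_prob ge0_integral_setU//=.
  - rewrite integral_set1 adde0; apply: (H0 `]-oo, 0%R[%classic) => x /=.
    by rewrite in_itv.
  - apply/measurable_funTS/measurable_EFinP; exact: measurable_exponential_pdf.
  - by move=> x _; rewrite lee_fin exponential_pdf_ge0// ltW.
  - by apply/disj_setPS => x [/=]; rewrite in_itv/= => + e; rewrite e ltxx.
rewrite H (_ : `]-oo, s] = `]-oo, 0%R[ `|` `[0%R, s])%classic; last first.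
  by rewrite -itv_bndbnd_setU// bnd_simp// ltW.
rewrite /exponential_prob ge0_integral_setU//=.
- rewrite [X in (X + _)%E](H0 `]-oo, 0%R[%classic) ?add0e; last first.
    by move=> x /=; rewrite in_itv.
  by have := exponential_prob_itv0c lambda s0; rewrite /exponential_prob => ->.
- apply/measurable_funTS/measurable_EFinP; exact: measurable_exponential_pdf.
- by move=> x _; rewrite lee_fin exponential_pdf_ge0// ltW.
- apply/disj_setPS => x [/=]; rewrite !in_itv/= => x0 /andP[+ _].
  by rewrite leNgt x0.
Qed.

Lemma probability_sigma_gt s : 0 <= s ->
  (P [set w | (s < sigma w)%R] = (expR (- lambda * s))%:E)%E.
Proof.
move=> s0; rewrite (_ : mkset _ = ~` [set w | sigma w <= s]).
  rewrite probability_setC ?probability_sigma_le//; last exact: measurable_sigma_le.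
  by rewrite -EFinB; congr EFin; ring.
by apply/seteqP; split => w /=; rewrite ltNge => /negP.
Qed.

Notation pre_weight := (weight (fun a b => mu0 * (b - a)) 0).

(** If the switch comes after the grid has ended, the integrated rates are those of a constant
    [mu0], so the weight does not depend on [sigma] and leaves the integral. *)
Lemma cell_sigma_gt l s : grid 0 l -> grid_end 0 l <= s ->
  P ([set w | s < sigma w] `&` [set w | cell (N ^~ w) 0 l]) =
  (pre_weight l * expR (- lambda * s))%:E.
Proof.
move=> gl ls; have s0 := le_trans (grid_le_end gl) ls.
have -> : [set w | s < sigma w] = sigma @^-1` `]s, +oo[.
  by apply/seteqP; split => w /=; rewrite in_itv/= andbT.
rewrite (conditionally_poisson_cell cp)//.
rewrite (eq_integral (cst (pre_weight l)%:E)); last first.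
  move=> w; rewrite inE/= in_itv/= andbT => sw; congr EFin; apply: weight_ext => //.
  move=> a b _ ab bl; rewrite /switched.
  have bs := ltW (le_lt_trans (le_trans bl ls) sw).
  by rewrite (min_r bs) (min_r (le_trans (ltW ab) bs)) subrr mulr0 addr0.
rewrite integral_cst//; last by rewrite -[_ @^-1` _]setTI; exact: measurable_funPT.
rewrite EFinM; congr (_ * _)%E; rewrite -probability_sigma_gt//; congr (P _).
by apply/seteqP; split => w /=; rewrite in_itv/= andbT.
Qed.

(** Both sides factor by [cell_sigma_gt] with the same weight, since the cell ends at [s]; what is
    left is the memoryless property of the exponential law. *)
Lemma memoryless_cell l s u : grid 0 l -> grid_end 0 l = s -> s <= u ->
  (\int[P]_(w in [set w | cell (N ^~ w) 0 l]) (\1_[set w | (u < sigma w)%R] w)%:E =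
   \int[P]_(w in [set w | cell (N ^~ w) 0 l])
     (expR (- lambda * (u - s)) * \1_[set w | (s < sigma w)%R] w)%:E)%E.
Proof.
move=> gl ls su; have s0 : 0 <= s by rewrite -ls; exact: grid_le_end.
have mc := measurable_cell (lexx 0) gl.
have msu := measurable_sigma_gt u; have mss := measurable_sigma_gt s.
have E v : (\int[P]_(w in [set w | cell (N ^~ w) 0 l])
    (\1_[set w | (v < sigma w)%R] w)%:E =
    P ([set w | (v < sigma w)%R] `&` [set w | cell (N ^~ w) 0 l]))%E.
  by rewrite integral_indic//; exact: measurable_sigma_gt.
rewrite E cell_sigma_gt ?ls//.
under eq_integral do rewrite EFinM.
rewrite ge0_integralZl ?lee_fin ?expR_ge0//; last first.
  by apply/measurable_EFinP; exact: measurable_indic.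
rewrite E cell_sigma_gt ?ls// -EFinM; congr EFin.
rewrite mulrCA -expRD; congr (_ * expR _); ring.
Qed.

End single_coordinate.

(** * Bayes' rule on cells *)

Section odds_on_cells.
Context {d : measure_display} {Omega : measurableType d} {R : realType}.
Context (P : probability Omega R).
Notation leb := (@lebesgue_measure R).
Variables (lambda mu0 mu1 : R).
Hypotheses (lambda_gt0 : 0 < lambda) (mu0_gt0 : 0 < mu0) (mu1_gt0 : 0 < mu1).
Hypotheses (mu_le : 0 <= mu1 - mu0) (lambda_ge : mu1 - mu0 <= lambda).
Variables (sigma : {RV P >-> R}) (N : R -> Omega -> nat).
Hypothesis sigma_exp : forall B : set R, measurable B ->
  distribution P sigma B = exponential_prob lambda B.
Hypothesis cN : counting_process N.
Hypothesis cp : conditionally_poisson P sigma N (switching_rate mu0 mu1).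

Implicit Types (s t : R).

Let odds t w := posterior_odds lambda mu0 mu1 (N ^~ w) t.

(** For [s >= 0], the density at [s] of the law of [sigma] restricted to the cell. *)
Let cell_density l s : R :=
  weight (switched mu0 mu1 s) 0 l * (lambda * expR (- lambda * s)).

Lemma integral_cell_sigma_le l t : grid 0 l -> grid_end 0 l = t ->
  (\int[P]_(w in [set w | cell (N ^~ w) 0 l]) (\1_[set w | (sigma w <= t)%R] w)%:E =
   \int[leb]_s (cell_density l s * \1_`[0%R, t] s)%:E)%E.
Proof.
move=> gl lt; have t0 : 0 <= t by rewrite -lt; exact: grid_le_end.
have mc := measurable_cell cN (lexx 0) gl.
have w0 s : 0 <= weight (switched mu0 mu1 s) 0 l.
  by apply: weight_ge0 => // a b ab; apply/ltW/switched_gt0.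
have -> : [set w | (sigma w <= t)%R] = sigma @^-1` `]-oo, t].
  by apply/seteqP; split => w /=; rewrite in_itv.
transitivity (P (sigma @^-1` `]-oo, t] `&` [set w | cell (N ^~ w) 0 l])).
  by rewrite integral_indic// -[_ @^-1` _]setTI; exact: measurable_funPT.
rewrite (conditionally_poisson_cell cp)//.
transitivity (\int[P]_w (fun s => (weight (switched mu0 mu1 s) 0 l *
    \1_`]-oo, t] s)%:E) (sigma w))%E.
  rewrite integral_mkcond; apply: eq_integral => w _.
  by rewrite epatch_indic/= EFinM.
rewrite (ge0_integral_exponential lambda_gt0 sigma_exp
  (h := fun s => (weight (switched mu0 mu1 s) 0 l * \1_`]-oo, t] s)%:E)).
- apply: eq_integral => s _; rewrite -EFinM /cell_density; congr EFin.
  have [s0|s0] := leP 0 s.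
    have -> : \1_`]-oo, t] s = \1_`[0, t] s :> R.
      by rewrite !indicE !mem_setE !in_itv/= s0.
    by rewrite exponential_pdfE//; ring.
  have -> : \1_`[0, t] s = 0 :> R.
    by rewrite indicE memNset//= in_itv/= leNgt s0.
  by rewrite lt0_exponential_pdf// !mulr0.
- apply/measurable_EFinP; apply: measurable_funM; first exact: measurable_weight.
  exact: measurable_indic.
- by move=> s; rewrite lee_fin mulr_ge0.
Qed.

(** On a refined cell the kernel is the constant [c * r ^+ e a], and on [{t < sigma}] the cell has
    its weight under the constant rate [mu0]. [weight_refine] then sums these to the weight of a
    path switching at [s]. Being inserted into the grid, [s] must not be one of its points. *)
Lemma integral_cell_kernel l t s : grid 0 l -> grid_end 0 l = t ->
  0 < s -> s < t -> s \notin unzip1 l ->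
  (\int[P]_(w in [set w | cell (N ^~ w) 0 l])
     (odds_kernel lambda mu0 mu1 (N ^~ w) t s *
      \1_[set w | (t < sigma w)%R] w)%:E = (cell_density l s)%:E)%E.
Proof.
move=> gl lt s0 st sl; have t0 : 0 <= t by rewrite -lt; exact: grid_le_end.
pose c := lambda * expR ((lambda + mu0 - mu1) * (t - s)).
pose r := mu1 / mu0.
pose e (a : nat) := (count_at s l - a + count_after s l)%N.
pose ev a := [set w | cell (N ^~ w) 0 (refine s a l)].
have r0 : 0 < r by rewrite divr_gt0.
have c0 : 0 < c by rewrite mulr_gt0// expR_gt0.
have mev a : measurable (ev a).
  by apply: measurable_cell; rewrite ?grid_refine.
have mst := measurable_sigma_gt sigma t.
transitivity (\int[P]_w \sum_(a < (count_at s l).+1)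
   ((c * r ^+ e a)%:E * (\1_(ev a `&` [set w | (t < sigma w)%R]) w)%:E))%E.
  rewrite integral_mkcond; apply: eq_integral => w _.
  rewrite epatch_indic -EFinM.
  under eq_bigr do rewrite -EFinM.
  rewrite sumEFin; congr EFin.
  have := cell_refine (fun k => r ^+ k) (@counting_path_nondecreasing _ _ _ _ cN w) gl s0.
  rewrite lt => /(_ st sl) H.
  have -> : odds_kernel lambda mu0 mu1 (N ^~ w) t s = c * r ^+ (N t w - N s w)%N.
    rewrite /odds_kernel -/c; congr (_ * _).
    rewrite -natrB ?expRM_natl ?lnK//; last first.
      by apply: (counting_path_nondecreasing cN); exact: ltW.
  have cE l' := indic_mkset R (fun w => cell (N ^~ w) 0 l') w.
  rewrite cE; set b := \1_ _ w.
  have -> : c * r ^+ (N t w - N s w) * b * (cell (N ^~ w) 0 l)%:R =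
    c * b * ((cell (N ^~ w) 0 l)%:R * r ^+ (N t w - N s w)) by ring.
  rewrite H big_distrr/=; apply: eq_bigr => a _.
  by rewrite indicI/= -/b cE /e; ring.
rewrite ge0_integral_sum//; last 2 first.
- move=> a; apply: measurable_funeM; apply/measurable_EFinP.
  by apply: measurable_indic; exact: measurableI.
- by move=> a w _; rewrite -EFinM lee_fin !mulr_ge0// ?exprn_ge0// ltW.
transitivity (\sum_(a < (count_at s l).+1)
   (c * r ^+ e a * (weight (fun a b => mu0 * (b - a)) 0 (refine s a l) *
      expR (- lambda * t)))%:E)%E.
  apply: eq_bigr => a _; rewrite ge0_integralZl//.
  - rewrite integral_indic//; last exact: measurableI.
    rewrite [RHS]EFinM; congr (_ * _)%E.
    rewrite -(cell_sigma_gt lambda_gt0 mu0_gt0 mu1_gt0 sigma_exp cp).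
    + by rewrite setIT setIC.
    + exact: grid_refine.
    + by rewrite grid_end_refine lt.
  - by apply/measurable_EFinP; apply: measurable_indic; exact: measurableI.
  - by rewrite lee_fin !mulr_ge0// ?exprn_ge0// ltW.
rewrite sumEFin; congr EFin.
transitivity (c * expR (- lambda * t) *
  \sum_(a < (count_at s l).+1) r ^+ e a *
    weight (fun a b => mu0 * (b - a)) 0 (refine s a l)).
  by rewrite big_distrr/=; apply: eq_bigr => a _; ring.
rewrite weight_refine ?lt// /cell_density /c.
(* The exponents of the kernel, of the survival probability and of [weight_refine] add up to that of
   the exponential density at [s]. *)
have -> : - lambda * s =
  (lambda + mu0 - mu1) * (t - s) + - lambda * t + (mu1 - mu0) * (t - s) by ring.
by rewrite !expRD; ring.
Qed.

Lemma odds_cell l t : grid 0 l -> grid_end 0 l = t ->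
  (\int[P]_(w in [set w | cell (N ^~ w) 0 l]) (\1_[set w | (sigma w <= t)%R] w)%:E =
   \int[P]_(w in [set w | cell (N ^~ w) 0 l])
     (odds t w * \1_[set w | (t < sigma w)%R] w)%:E)%E.
Proof.
move=> gl lt; have t0 : 0 <= t by rewrite -lt; exact: grid_le_end.
rewrite integral_cell_sigma_le//.
have mc := measurable_cell cN (lexx 0) gl.
have mst := measurable_sigma_gt sigma t.
have [mN _ _ _ _] := cN.
have mN' s : 0 <= s <= t -> measurable_fun setT (N s) by move=> /andP[+ _]; exact: mN.
have Nr w : right_continuous_path (N ^~ w) by exact: counting_path_right_continuous.
set A := [set w | cell _ _ _].
pose q (p : Omega * R) : \bar R :=
  ((odds_kernel lambda mu0 mu1 (N ^~ p.1) t (clamp t p.2) * \1_`[0%R, t] p.2) *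
   (\1_[set w | (t < sigma w)%R] p.1 * \1_A p.1))%:E.
have k0 n s : 0 <= odds_kernel lambda mu0 mu1 n t s by exact: odds_kernel_ge0.
have q0 p : (0 <= q p)%E by rewrite lee_fin; do !apply: mulr_ge0 => //.
have mq : measurable_fun setT q.
  apply/measurable_EFinP; apply: measurable_funM.
    exact: measurable_odds_kernel.
  have m1 : measurable_fun setT (fun w => \1_[set w | (t < sigma w)%R] w * \1_A w : R).
    by apply: measurable_funM; exact: measurable_indic.
  exact: (measurableT_comp m1 measurable_fst).
transitivity (\int[P]_w \int[leb]_s q (w, s))%E; last first.
  rewrite [RHS]integral_mkcond; apply: eq_integral => w _.
  rewrite epatch_indic /q/= -EFinM -mulrA EFinM.
  under eq_integral do rewrite EFinM muleC.
  rewrite ge0_integralZl//.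
  - by rewrite -posterior_odds_kernel// muleC.
  - have := measurable_odds_kernel lambda mu0 mu1 t0 mN' Nr.
    by move=> /measurable_EFinP H; exact: (measurableT_comp H (pair1_measurable w)).
  - by move=> s _; rewrite lee_fin mulr_ge0.
rewrite fubini_tonelli//.
apply: ge0_ae_eq_integral => //.
- apply/measurable_EFinP; apply: measurable_funM; last exact: measurable_indic.
  apply: measurable_funM; first exact: measurable_weight.
  by apply: measurable_funM => //; apply: measurableT_comp => //; exact: measurable_funM.
- exact: (measurable_fun_fubini_tonelli_G _ mq).
- move=> s _; rewrite lee_fin !mulr_ge0 ?expR_ge0//; last exact: ltW.
  by apply: weight_ge0 => // a b ab; apply/ltW/switched_gt0.
- by move=> s _; exact: integral_ge0.
(* The times excluded in [integral_cell_kernel] are finitely many, hence Lebesgue null. *)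
exists [set` [:: 0, t & unzip1 l]]; split.
- apply: countable_measurable; first by move=> u; exact: measurable_set1.
  exact/finite_set_countable/finite_seq.
- exact/countable_lebesgue_measure0/finite_set_countable/finite_seq.
move=> s /= /not_implyP[_]; apply: contra_notP => /negP.
rewrite !inE !negb_or => /and3P[s0 st sl].
rewrite /q/=; have [st'|nst] := boolP (0 <= s <= t); last first.
  have -> : \1_`[0, t] s = 0 :> R.
    by rewrite indicE memNset//= in_itv/=; exact/negP.
  by rewrite mulr0 integral0_eq// => w _; rewrite mulr0 mul0r.
have -> : \1_`[0, t] s = 1 :> R by rewrite indicE mem_set//= in_itv.
rewrite clamp_id// mulr1 -(integral_cell_kernel gl lt)//.
- rewrite integral_mkcond; apply: eq_integral => w _.
  by rewrite epatch_indic/= mulr1 mulrA -EFinM.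
- by rewrite lt_neqAle eq_sym s0; case/andP: st'.
- by rewrite lt_neqAle st; case/andP: st'.
Qed.

End odds_on_cells.

(** * The posterior probabilities and their monotonicity *)

Section posterior_probability.
Context {R : realType} {d : measure_display} {Omega : measurableType d}.
Context (P : probability Omega R) {m : nat} (lambda mu0 mu1 : 'I_m -> R).
Hypotheses (lambda_gt0 : forall i, 0 < lambda i).
Hypotheses (mu0_gt0 : forall i, 0 < mu0 i) (mu1_gt0 : forall i, 0 < mu1 i).
Hypotheses (mu_le : forall i, 0 <= mu1 i - mu0 i).
Hypotheses (lambda_ge : forall i, mu1 i - mu0 i <= lambda i).
Variables (sigma : 'I_m -> {RV P >-> R}) (N : 'I_m -> R -> Omega -> nat).
Hypothesis sigma_exp : forall i (B : set R), measurable B ->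
  distribution P (sigma i) B = exponential_prob (lambda i) B.
Hypothesis cN : forall i, counting_process (N i).
Hypothesis cp : forall i,
  conditionally_poisson P (sigma i) (N i) (switching_rate (mu0 i) (mu1 i)).
Hypothesis indep : independent_sigma_algebras P (coordinate_sigma_algebra sigma N).

Implicit Types (s t u : R) (i : 'I_m).

Let odds i t w := posterior_odds (lambda i) (mu0 i) (mu1 i) (N i ^~ w) t.
Let pi i t w := posterior (lambda i) (mu0 i) (mu1 i) (N i ^~ w) t.

Let msigma i : measurable_fun setT (sigma i).
Proof. exact: measurable_funPT. Qed.

Lemma odds_ge0 i t w : 0 <= odds i t w.
Proof. exact: posterior_odds_ge0. Qed.

Lemma posterior_itv i t w : 0 <= pi i t w <= 1.
Proof.
have o0 := odds_ge0 i t w.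
rewrite /pi /posterior -/(odds i t w) divr_ge0 ?addr_ge0//=.
by rewrite ler_pdivrMr ?ltr_pwDl// mul1r lerDr.
Qed.

Let coordinate_measurable_sigma_gt i u :
  measurable ([set w | u < sigma i w] : set (coordinate_type sigma N i)).
Proof.
have H := @coordinate_measurable_sigma _ _ _ _ sigma N i measurableT `]u, +oo[%classic (measurable_itv _).
rewrite (_ : mkset _ = setT `&` sigma i @^-1` `]u, +oo[) //.
by apply/seteqP; split => w /=; rewrite in_itv/= andbT// => -[].
Qed.

Let coordinate_measurable_sigma_le i u :
  measurable ([set w | sigma i w <= u] : set (coordinate_type sigma N i)).
Proof.
rewrite (_ : mkset _ = ~` [set w | u < sigma i w]).
  exact: measurableC.
by apply/seteqP; split => w /=; rewrite leNgt => /negP.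
Qed.

Let bounded_indic (D : set Omega) : measurable D ->
  (\int[P]_x (\1_D x)%:E < +oo)%E.
Proof.
by move=> mD; rewrite integral_indic// setIT ltey_eq fin_num_measure.
Qed.

Lemma memoryless i s u A : 0 <= s -> s <= u -> observed_filtration N s A ->
  (\int[P]_(w in A) (\1_[set w | (u < sigma i w)%R] w)%:E =
   \int[P]_(w in A)
     (expR (- lambda i * (u - s)) * \1_[set w | (s < sigma i w)%R] w)%:E)%E.
Proof.
move=> s0 su; apply: (eq_integral_observed msigma cN indep (i := i)) => //.
- by apply: measurable_funM => //; exact: measurable_indic.
- exact: bounded_indic (measurable_sigma_gt _ _).
- by move=> l gl lt; exact: (memoryless_cell (lambda_gt0 i) (mu0_gt0 i) (mu1_gt0 i)
    (@sigma_exp i) (cN i) (cp i) gl lt su).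
Qed.

Lemma integral_sigma_le_odds i t A : 0 <= t -> observed_filtration N t A ->
  (\int[P]_(w in A) (\1_[set w | (sigma i w <= t)%R] w)%:E =
   \int[P]_(w in A) (odds i t w * \1_[set w | (t < sigma i w)%R] w)%:E)%E.
Proof.
move=> t0; apply: (eq_integral_observed msigma cN indep (i := i)) => //.
- apply: measurable_funM; last exact: measurable_indic.
  apply: measurable_posterior_odds => //.
    by move=> s /andP[s0 _]; exact: (@coordinate_measurable_N _ _ _ _ sigma N i s s0).
  by move=> w; exact: (@counting_path_right_continuous _ Omega R (N i) (cN i) w).
- by move=> w; rewrite mulr_ge0// odds_ge0.
- exact: bounded_indic (measurable_sigma_le _ _).
- by move=> l gl lt; exact: (odds_cell (lambda_gt0 i) (mu0_gt0 i) (mu1_gt0 i)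
    (mu_le i) (lambda_ge i) (@sigma_exp i) (cN i) (cp i) gl lt).
Qed.

Lemma observed_measurable_N i s t : 0 <= s <= t ->
  measurable_fun setT (N i s : g_sigma_algebraType (observed_events N t) -> nat).
Proof.
move=> st _ B mB; apply: sub_sigma_algebra; exists i => //; exists s; last by exists B.
by rewrite /= in_itv/=.
Qed.

Lemma observed_measurable_odds i t : 0 <= t ->
  measurable_fun setT (odds i t : g_sigma_algebraType (observed_events N t) -> R).
Proof.
move=> t0; apply: measurable_posterior_odds => //.
  by move=> s st; exact: (observed_measurable_N i st).
by move=> w; exact: (@counting_path_right_continuous _ Omega R (N i) (cN i) w).
Qed.

Let inv_odds_gt0 i t w : 0 < (1 + odds i t w)^-1.
Proof. by rewrite invr_gt0 ltr_pwDl// odds_ge0. Qed.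

Lemma observed_measurable_inv_odds i t : 0 <= t ->
  measurable_fun setT
    ((fun w => (1 + odds i t w)^-1) : g_sigma_algebraType (observed_events N t) -> R).
Proof.
move=> t0; have mo := observed_measurable_odds i t0.
have mo1 : measurable_fun setT ((fun w => 1 + odds i t w) :
    g_sigma_algebraType (observed_events N t) -> R) by exact: measurable_funD.
rewrite (_ : (fun w => _) = (fun x => x `^ (-1)) \o (fun w => 1 + odds i t w)).
  by apply: measurableT_comp mo1; exact: measurable_powR.
by apply/funext => w /=; rewrite powR_inv1// addr_ge0// odds_ge0.
Qed.

Lemma observed_measurable_posterior i t : 0 <= t ->
  measurable_fun setT (pi i t : g_sigma_algebraType (observed_events N t) -> R).
Proof.
move=> t0; apply: measurable_funM; first exact: observed_measurable_odds.
exact: observed_measurable_inv_odds.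
Qed.

Lemma measurable_posterior i t : 0 <= t -> measurable_fun setT (pi i t).
Proof.
move=> t0; apply: measurable_fun_g_sigma_algebra (observed_measurable_posterior i t0).
exact: observed_events_measurable.
Qed.

(** Weighting the odds identity by [\1_A / (1 + odds)] shows that [1 / (1 + odds)] over [A] and
    [{sigma <= t}] has the same integral as [pi] over [A] and [{t < sigma}]. Adding the integral of
    [pi] over [A] and [{sigma <= t}] gives the claim, as [1 / (1 + odds) + pi = 1]. *)
Lemma posterior_cond_exp i t : 0 <= t ->
  is_cond_exp P (observed_filtration N t) (\1_[set w | sigma i w <= t]) (pi i t).
Proof.
move=> t0; have mpi := measurable_posterior i t0.
have Gm := @observed_events_measurable _ _ _ _ N cN t.
split.
- by move=> B mB; rewrite -[_ @^-1` _]setTI; exact: observed_measurable_posterior.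
- apply: (@bounded_integrable _ _ _ _ _ _ 1) => //.
    by rewrite [X in (X < _)%E]probability_setT ltry.
  by move=> w _; case/andP: (posterior_itv i t w) => p0 p1; rewrite ger0_norm.
move=> A oA; have mA := observed_measurable cN oA.
have msg := measurable_sigma_gt (sigma i) t.
have msl := measurable_sigma_le (sigma i) t.
have modds : measurable_fun setT (odds i t).
  exact: measurable_fun_g_sigma_algebra (observed_measurable_odds i t0).
have := @ge0_integral_g_sigma_algebra _ _ _ P _ Gm
  (\1_[set w | (sigma i w <= t)%R]) (fun w => odds i t w * \1_[set w | (t < sigma i w)%R] w)
  (fun w => ((1 + odds i t w)^-1 * \1_A w)%:E).
have ih0 w : 0 <= (1 + odds i t w)^-1 by exact/ltW.
have pi0 w : 0 <= pi i t w by case/andP: (posterior_itv i t w).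
have mind D : measurable D -> measurable_fun setT (\1_D : Omega -> R).
  by exact: measurable_indic.
move=> /(_ (mind _ msl) (measurable_funM modds (mind _ msg))).
have h1 (w : Omega) : 0 <= \1_[set w | (sigma i w <= t)%R] w :> R by [].
move=> /(_ h1).
have h2 w : 0 <= odds i t w * \1_[set w | (t < sigma i w)%R] w.
  by rewrite mulr_ge0// odds_ge0.
move=> /(_ h2 (fun B oB => integral_sigma_le_odds i t0 oB)).
have h3 : measurable_fun setT
   ((fun w => ((1 + odds i t w)^-1 * \1_A w)%:E) :
      g_sigma_algebraType (observed_events N t) -> \bar R).
  apply/measurable_EFinP; apply: measurable_funM.
    exact: observed_measurable_inv_odds.
  exact: measurable_indic.
have h4 w : (0 <= ((1 + odds i t w)^-1 * \1_A w)%:E)%E by rewrite lee_fin mulr_ge0.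
move=> /(_ h3 h4) key.
have split_pi (f : Omega -> R) (B : set Omega) : measurable_fun setT f -> (forall w, 0 <= f w) ->
    measurable B ->
    (\int[P]_(w in B) (f w)%:E =
     \int[P]_w (f w * \1_B w)%:E)%E.
  move=> mf f0 mB; rewrite integral_mkcond; apply: eq_integral => w _.
  by rewrite epatch_indic.
rewrite (split_pi _ A mpi pi0 mA) (split_pi _ A (mind _ msl) h1 mA).
have mipi : measurable_fun setT (fun w => (1 + odds i t w)^-1).
  exact: measurable_fun_g_sigma_algebra (observed_measurable_inv_odds i t0).
transitivity (\int[P]_w ((pi i t w * \1_A w * \1_[set w | (t < sigma i w)%R] w)%:E +
   (pi i t w * \1_A w * \1_[set w | (sigma i w <= t)%R] w)%:E))%E.
  apply: eq_integral => w _; rewrite -EFinD -mulrDr; congr EFin.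
  rewrite !indicE; have [st|st] := leP (sigma i w) t.
    rewrite (memNset (_ : ~ [set w | t < sigma i w] w)) ?(mem_set (A := [set w | sigma i w <= t]))//.
      by rewrite add0r mulr1.
    by rewrite /= ltNge st.
  rewrite (memNset (_ : ~ [set w | sigma i w <= t] w)) ?(mem_set (A := [set w | t < sigma i w]))//.
    by rewrite addr0 mulr1.
  by rewrite /= leNgt st.
rewrite ge0_integralD//; last 4 first.
- by move=> w _; rewrite lee_fin; do !apply: mulr_ge0 => //.
- by apply/measurable_EFinP; do !apply: measurable_funM => //; exact: mind.
- by move=> w _; rewrite lee_fin; do !apply: mulr_ge0 => //.
- by apply/measurable_EFinP; do !apply: measurable_funM => //; exact: mind.
transitivity (\int[P]_w ((((1 + odds i t w)^-1 * \1_A w)%:E * (\1_[set w | (sigma i w <= t)%R] w)%:E) +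
   (pi i t w * \1_A w * \1_[set w | (sigma i w <= t)%R] w)%:E))%E; last first.
  apply: eq_integral => w _; rewrite -EFinM -EFinD; congr EFin.
  rewrite /pi /posterior -/(odds i t w); have := odds_ge0 i t w; move: (odds i t w) => x x0.
  by field; rewrite gt_eqF// ltr_pwDl.
rewrite ge0_integralD//; last 4 first.
- by move=> w _; rewrite -EFinM lee_fin; do !apply: mulr_ge0 => //.
- under eq_fun do rewrite -EFinM.
  by apply/measurable_EFinP; do !apply: measurable_funM => //; exact: mind.
- by move=> w _; rewrite lee_fin; do !apply: mulr_ge0 => //.
- by apply/measurable_EFinP; do !apply: measurable_funM => //; exact: mind.
rewrite key; congr (_ + _)%E; apply: eq_integral => w _; rewrite -EFinM; congr EFin.
by rewrite /pi /posterior -/(odds i t w); ring.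
Qed.

Lemma posterior_version i :
  right_continuous_version P (observed_filtration N)
    (fun t => \1_[set w | sigma i w <= t]) (pi i).
Proof.
split; first by move=> t; exact: posterior_cond_exp.
move=> w t t0; rewrite /pi /posterior.
have ro : odds i s w @[s --> t^'+] --> odds i t w.
  apply: posterior_odds_right_continuous => //.
  exact: counting_path_right_continuous.
apply: cvgM => //; apply: cvgV; first by rewrite gt_eqF// ltr_pwDl// odds_ge0.
by apply: cvgD => //; exact: cvg_cst.
Qed.

Lemma posterior_nondecreasing i w s t : 0 <= s -> s <= t -> pi i s w <= pi i t w.
Proof.
move=> s0 st; rewrite /pi /posterior -/(odds i s w) -/(odds i t w).
have : odds i s w <= odds i t w.
  apply: posterior_odds_nondecreasing => //.
    exact: counting_path_right_continuous.
  exact: counting_path_nondecreasing.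
have := odds_ge0 i s w; have := odds_ge0 i t w.
move: (odds i s w) (odds i t w) => x y y0 x0 xy.
by rewrite ler_pdivrMr ?ltr_pwDl// mulrAC ler_pdivlMr ?ltr_pwDl//; lra.
Qed.

Lemma posterior_lb i t w : 0 <= t ->
  lambda i * t / (1 + lambda i * t) <= pi i t w.
Proof.
move=> t0; rewrite /pi /posterior -/(odds i t w).
have : lambda i * t <= odds i t w.
  apply: posterior_odds_lb => //.
    exact: counting_path_right_continuous.
  exact: counting_path_nondecreasing.
have := odds_ge0 i t w; have : 0 <= lambda i * t by rewrite mulr_ge0// ltW.
move: (lambda i * t) (odds i t w) => x y x0 y0 xy.
by rewrite ler_pdivrMr ?ltr_pwDl// mulrAC ler_pdivlMr ?ltr_pwDl//; lra.
Qed.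

End posterior_probability.

(** The times [u n] may equal [s], which a limit from the right excludes; there the value is already
    the limit. *)
Lemma cvg_right_continuous_seq (R : realType) (x : R -> R) (s : R) (u : nat -> R) :
  x v @[v --> s^'+] --> x s -> (forall n, s <= u n) -> u n @[n --> \oo] --> s ->
  x (u n) @[n --> \oo] --> x s.
Proof.
move=> xs su us; apply/cvgrPdist_lt => e e0.
move/cvgrPdist_lt : xs => /(_ e e0); rewrite /at_right/= near_withinE => -[r /= r0 H].
move/cvgrPdist_lt : us => /(_ r r0); apply: filterS => n unr.
have := su n; rewrite le_eqVlt => /predU1P[<-|sun]; first by rewrite subrr normr0.
by apply: H.
Qed.

(** * Real-valued expectations over events *)

Section integration_on_events.
Context {d : measure_display} {Omega : measurableType d} {R : realType}.
Variable P : probability Omega R.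
Implicit Types (f g : Omega -> R) (A B : set Omega).

Definition E A f : R := \int[P]_(w in A) f w.

Let I f := P.-integrable setT (EFin \o f).

Lemma integrable_on A f : measurable A -> I f -> P.-integrable A (EFin \o f).
Proof. by move=> mA; apply: integrableS. Qed.

Lemma E_EFin A f : measurable A -> I f -> ((E A f)%:E = \int[P]_(w in A) (f w)%:E)%E.
Proof.
move=> mA If; rewrite /E /Rintegral fineK//.
by apply: integrable_fin_num => //; exact: integrable_on.
Qed.

Lemma E_setD A B f : measurable A -> measurable B -> B `<=` A -> I f ->
  E (A `\` B) f = E A f - E B f.
Proof.
move=> mA mB BA If; apply/eqP; rewrite eq_sym subr_eq; apply/eqP.
rewrite -{1}(setDUK BA) /E Rintegral_setU//; first by rewrite addrC.
- exact: measurableD.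
- by apply: integrable_on => //; rewrite setDUK.
- by apply/disj_setPS => w [Bw [_]].
Qed.

Lemma E_set0 f : E set0 f = 0.
Proof. exact: Rintegral_set0. Qed.

Lemma E_indic A f : E A f = E setT (fun w => f w * \1_A w).
Proof.
rewrite /E Rintegral_mkcond; congr (Rintegral _ _ _); apply/funext => w.
by rewrite patchE indicE; case: ifP => _; rewrite ?mulr1 ?mulr0.
Qed.

Lemma E_D A f g : measurable A -> I f -> I g ->
  E A (fun w => f w + g w) = E A f + E A g.
Proof. by move=> mA If Ig; rewrite /E RintegralD//; exact: integrable_on. Qed.

Lemma E_Zl A k f : measurable A -> I f -> E A (fun w => k * f w) = k * E A f.
Proof. by move=> mA If; rewrite /E RintegralZl//; exact: integrable_on. Qed.

Lemma E_cst A k : measurable A -> E A (cst k) = k * fine (P A).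
Proof. by move=> mA; rewrite /E Rintegral_cst. Qed.

Lemma le_E A f g : measurable A -> I f -> I g -> (forall w, A w -> f w <= g w) ->
  E A f <= E A g.
Proof. by move=> mA If Ig fg; apply: le_Rintegral => //; exact: integrable_on. Qed.

Lemma le_E_ae A f g : measurable A -> I f -> I g ->
  {ae P, forall w, f w <= g w} -> E A f <= E A g.
Proof.
move=> mA If Ig [Z [mZ PZ fgZ]].
have EZ h : I h -> E A h = E (A `\` Z) h.
  move=> Ih; rewrite /E /Rintegral; congr fine.
  by apply: negligible_integral => //; exact: integrable_on.
rewrite (EZ f)// (EZ g)//; apply: le_E => //; first exact: measurableD.
by move=> w [_ nZ]; apply: contrapT => fgw; apply/nZ/fgZ.
Qed.

Lemma integrable_bounded f M : measurable_fun setT f -> (forall w, `|f w| <= M) -> I f.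
Proof.
move=> mf fM; apply: (@bounded_integrable _ _ _ _ _ _ M) => //.
by rewrite [X in (X < _)%E]probability_setT ltry.
Qed.

Lemma integrable_mul_indic A f : measurable A -> I f -> I (fun w => f w * \1_A w).
Proof.
move=> mA If; have := integrable_on mA If.
rewrite integrable_mkcond//; congr (_.-integrable _ _).
by apply/funext => w; rewrite epatch_indic/= EFinM.
Qed.

End integration_on_events.

(** * Stopping on a mesh and comparison of drifts *)

Section discretized_stopping.
Context {d : measure_display} {Omega : measurableType d} {R : realType}.
Variables (P : probability Omega R) (Gen : R -> set (set Omega)).
Let Af t : set (set Omega) := <<s Gen t >>.
Hypothesis Gen_measurable : forall t, Gen t `<=` measurable.

Implicit Types (s t : R) (tau : Omega -> \bar R) (n k M : nat).

Lemma filtration_measurable t A : Af t A -> measurable A.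
Proof. by apply: g_sigma_algebra_sub_measurable; exact: Gen_measurable. Qed.

Definition mesh n k : R := k%:R / n.+1%:R.

Lemma mesh0 n : mesh n 0 = 0.
Proof. by rewrite /mesh mul0r. Qed.

Lemma mesh_ge0 n k : 0 <= mesh n k.
Proof. by rewrite divr_ge0. Qed.

Lemma mesh_le n k l : (k <= l)%N -> mesh n k <= mesh n l.
Proof. by move=> kl; rewrite ler_pM2r ?invr_gt0// ler_nat. Qed.

Lemma meshS n k : mesh n k.+1 = mesh n k + n.+1%:R^-1.
Proof. by rewrite /mesh -natr1 mulrDl mul1r. Qed.

Lemma mesh_mulr n T : mesh n (T * n.+1) = T%:R.
Proof. by rewrite /mesh natrM mulfK// pnatr_eq0. Qed.

Definition after tau t : set Omega := [set w | (t%:E < tau w)%E].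

Lemma after_filtration tau t : stopping_time Af tau -> 0 <= t -> Af t (after tau t).
Proof.
move=> [_ stau] t0; rewrite (_ : after tau t = ~` [set w | (tau w <= t%:E)%E]).
  by apply: (@measurableC _ (g_sigma_algebraType (Gen t))); exact: stau.
by apply/seteqP; split => w /=; rewrite /after/= ltNge => /negP.
Qed.

Lemma after_le tau s t : s <= t -> after tau t `<=` after tau s.
Proof. by move=> st w; rewrite /after/=; apply: le_lt_trans; rewrite lee_fin. Qed.

Variable X : R -> Omega -> R.
Hypothesis X_integrable : forall t, 0 <= t -> P.-integrable setT (EFin \o X t).

Let mEv tau n k : stopping_time Af tau -> measurable (after tau (mesh n k)).
Proof.
move=> st; apply: (@filtration_measurable (mesh n k)); apply: after_filtration => //.
exact: mesh_ge0.
Qed.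
Let IXk n k : P.-integrable setT (EFin \o X (mesh n k)).
Proof. by apply: X_integrable; exact: mesh_ge0. Qed.

(* [X] at the first mesh point that is at least [tau], cut off where
   [tau > mesh n M]. *)
Definition stopped_at_mesh tau n M (w : Omega) : R :=
  X 0 w * \1_(~` after tau 0) w +
  \sum_(k < M) X (mesh n k.+1) w *
    \1_(after tau (mesh n k) `\` after tau (mesh n k.+1)) w.

(** The mean of [X] at the first mesh point that is at least [tau], or at [mesh n M] if that comes
    first, written as a sum of increments. Each increment is taken over an event decided at the
    beginning of its step, where the drift estimate applies. *)
Definition drift_sum tau n M : R :=
  E P setT (X 0) + \sum_(k < M)
    (E P (after tau (mesh n k)) (X (mesh n k.+1)) -
     E P (after tau (mesh n k)) (X (mesh n k))).

Lemma integrable_stopped_at_mesh tau n M : stopping_time Af tau ->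
  P.-integrable setT (EFin \o stopped_at_mesh tau n M).
Proof.
move=> st; have mE := fun k => @mEv tau n k st.
elim: M => [|M IH].
  rewrite /stopped_at_mesh (_ : _ \o _ = EFin \o (fun w => X 0 w * \1_(~` after tau 0) w)).
    apply: integrable_mul_indic; last exact: X_integrable.
    by apply: measurableC; have := mE 0%N; rewrite mesh0.
  by apply/funext => w /=; rewrite big_ord0 addr0.
rewrite (_ : _ \o _ = (EFin \o stopped_at_mesh tau n M) \+ (EFin \o
  (fun w => X (mesh n M.+1) w * \1_(after tau (mesh n M) `\` after tau (mesh n M.+1)) w))).
  apply: integrableD => //; apply: integrable_mul_indic; last exact: IXk.
  by apply: measurableD; exact: mE.
by apply/funext => w /=; rewrite /stopped_at_mesh big_ord_recr/= addrA.
Qed.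

Lemma E_stopped_at_mesh_recr tau n M : stopping_time Af tau ->
  E P setT (stopped_at_mesh tau n M.+1) = E P setT (stopped_at_mesh tau n M) +
  E P (after tau (mesh n M) `\` after tau (mesh n M.+1)) (X (mesh n M.+1)).
Proof.
move=> st; have mE := fun k => @mEv tau n k st.
rewrite (E_indic P (_ `\` _)) -E_D//.
- congr (E _ _ _); apply/funext => w.
  by rewrite /stopped_at_mesh big_ord_recr/= addrA.
- exact: integrable_stopped_at_mesh.
- apply: integrable_mul_indic; last exact: IXk.
  by apply: measurableD; exact: mE.
Qed.

Lemma E_stopped_at_mesh tau n M : stopping_time Af tau ->
  E P setT (stopped_at_mesh tau n M) + E P (after tau (mesh n M)) (X (mesh n M)) =
  drift_sum tau n M.
Proof.
move=> st; have mE := fun k => @mEv tau n k st.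
elim: M => [|M IH]; rewrite /drift_sum.
  rewrite big_ord0 addr0 mesh0.
  rewrite (_ : stopped_at_mesh _ _ _ = fun w => X 0 w * \1_(~` after tau 0) w).
    have m0 : measurable (after tau 0) by have := mE 0%N; rewrite mesh0.
    rewrite -E_indic -setTD E_setD ?subrK//; exact: X_integrable.
  by apply/funext => w; rewrite /stopped_at_mesh big_ord0 addr0.
rewrite E_stopped_at_mesh_recr// big_ord_recr/= addrA -/(drift_sum tau n M) -IH.
rewrite E_setD//; first by ring.
by apply: after_le; rewrite mesh_le.
Qed.

Variable Y : R -> Omega -> R.
Hypothesis Y_integrable : forall t, 0 <= t -> P.-integrable setT (EFin \o Y t).
Variable C : R.
Hypothesis drift : forall s h A, 0 <= s -> 0 <= h -> Af s A ->
  h * E P A (Y s) <= E P A (X (s + h)) - E P A (X s) <= h * E P A (Y s) + C * h ^+ 2.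

(** Since [tau'] separates the signs of [Y], the drift collected before [tau'] is the negative part
    of [Y] with a minus sign, which is below [Y] restricted to any event. The upper drift bound is
    used for [tau'], the lower one for [tau]; the [M] errors [C / n.+1 ^ 2] make up the last
    term. *)
Lemma drift_sum_le tau tau' n M : stopping_time Af tau -> stopping_time Af tau' ->
  (forall w t, 0 <= t -> (t%:E < tau' w)%E -> Y t w <= 0) ->
  (forall w t, 0 <= t -> (tau' w <= t%:E)%E -> 0 <= Y t w) ->
  drift_sum tau' n M <= drift_sum tau n M + C * mesh n M * n.+1%:R^-1.
Proof.
move=> st st' Yneg Ypos.
have mE := fun k => @mEv tau n k st; have mE' := fun k => @mEv tau' n k st'.
have -> : C * mesh n M / n.+1%:R = \sum_(k < M) C * n.+1%:R^-1 ^+ 2.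
  by rewrite sumr_const card_ord /mesh -mulr_natl; ring.
rewrite /drift_sum -addrA lerD2l -big_split/=; apply: ler_sum => k _.
have h0 : 0 <= n.+1%:R^-1 :> R by rewrite invr_ge0.
have := drift (mesh_ge0 n k) h0 (after_filtration st (mesh_ge0 n k)).
have := drift (mesh_ge0 n k) h0 (after_filtration st' (mesh_ge0 n k)).
rewrite -meshS => /andP[_ H1] /andP[H2 _].
apply: (le_trans H1); rewrite lerD2r; apply: le_trans H2.
apply: ler_wpM2l => //; rewrite (E_indic P (after tau' _)) (E_indic P (after tau _)).
apply: le_E => //.
- by apply: integrable_mul_indic; [exact: mE'|apply: Y_integrable; exact: mesh_ge0].
- by apply: integrable_mul_indic; [exact: mE|apply: Y_integrable; exact: mesh_ge0].
move=> w _; have [tk|tk] := ltP (mesh n k)%:E (tau' w).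
  rewrite !indicE (mem_set (tk : after tau' _ w)) mulr1.
  have := Yneg w _ (mesh_ge0 n k) tk; case: (_ \in _) => Y0; first by rewrite mulr1.
  by rewrite mulr0.
rewrite !indicE (memNset (_ : ~ after tau' _ w)) ?mulr0; last by rewrite /after/= ltNge tk.
by rewrite mulr_ge0// Ypos// mesh_ge0.
Qed.

End discretized_stopping.

(** * Letting the mesh width tend to zero *)

Section mesh_limit.
Context {d : measure_display} {Omega : measurableType d} {R : realType}.
Variables (P : probability Omega R) (Gen : R -> set (set Omega)).
Let Af t : set (set Omega) := <<s Gen t >>.
Hypothesis Gen_measurable : forall t, Gen t `<=` measurable.
Variable X : R -> Omega -> R.
Hypothesis X_integrable : forall t, 0 <= t -> P.-integrable setT (EFin \o X t).
Hypothesis X_right_continuous :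
  forall w t, 0 <= t -> X s w @[s --> t^'+] --> X t w.
Variable K : R.
Hypothesis K_ge0 : 0 <= K.
Hypothesis X_bound : forall t, 0 <= t -> {ae P, forall w, 0 <= X t w <= K * (1 + t)}.

Implicit Types (s t : R) (tau : Omega -> \bar R) (n k M T : nat).

Lemma mesh_cell n (r : R) : 0 < r -> exists k, mesh n k < r <= mesh n k.+1.
Proof.
move=> r0; have N0 : 0 < n.+1%:R :> R by [].
have ex : exists k, r <= mesh n k.
  exists (Num.truncn (n.+1%:R * r)).+1; apply: ltW.
  by rewrite /mesh ltr_pdivlMr// mulrC; case/andP: (truncn_itv (ltW (mulr_gt0 N0 r0))).
have := ex_minnP ex => -[[|k] rk kmin]; first by move: rk; rewrite mesh0 leNgt r0.
exists k; rewrite rk andbT ltNge; apply/negP => /kmin; by rewrite ltnn.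
Qed.

Lemma stopped_at_meshE tau n M w (r : R) : tau w = r%:E -> 0 <= r <= mesh n M ->
  exists k, (k <= M)%N /\ r <= mesh n k <= r + n.+1%:R^-1 /\
    stopped_at_mesh X tau n M w = X (mesh n k) w.
Proof.
move=> tw /andP[r0 rM].
have aft t : \1_(after tau t) w = (t < r)%R%:R :> R.
  rewrite indicE; congr (_%:R); congr nat_of_bool.
  by apply/idP/idP; rewrite inE /after/= tw lte_fin.
have cellE a b : \1_(after tau a `\` after tau b) w = (a < r <= b)%R%:R :> R.
  rewrite indicE; congr (_%:R); congr nat_of_bool.
  apply/idP/idP; rewrite inE /after/= tw !lte_fin.
    by move=> [-> /negP]; rewrite -leNgt.
  by move=> /andP[-> rb]; split=> //; apply/negP; rewrite -leNgt.
have c0 : \1_(~` after tau 0) w = (r <= 0)%R%:R :> R.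
  rewrite indicE; congr (_%:R); congr nat_of_bool.
  by apply/idP/idP; rewrite inE /after/= tw lte_fin leNgt => /negP.
rewrite /stopped_at_mesh c0; under eq_bigr do rewrite cellE.
move: r0; rewrite le_eqVlt => /predU1P[<-|r0].
  exists 0%N; rewrite mesh0 lexx add0r invr_ge0 ler0n; split=> //; split=> //.
  rewrite mulr1 big1 ?addr0// => k _.
  by rewrite ltNge mesh_ge0/= mulr0.
have [k /andP[kr rk]] := mesh_cell n r0.
have kM : (k < M)%N.
  by rewrite ltnNge; apply/negP => /(@mesh_le R n) Mk; move: kr; rewrite ltNge (le_trans rM Mk).
exists k.+1; split=> //; split; first by rewrite rk meshS lerD2r ltW.
rewrite leNgt r0 mulr0 add0r (bigD1 (Ordinal kM))//= kr rk mulr1 big1 ?addr0//.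
move=> j; rewrite -(inj_eq val_inj)/= => jk.
have [jr|] := ltP (mesh n j) r; last by rewrite mulr0.
have [rj|] := leP r (mesh n j.+1); last by rewrite mulr0.
exfalso; move: jk; rewrite neq_ltn => /orP[jk|jk].
  by move: kr; rewrite ltNge (le_trans rj)// mesh_le.
by move: jr; rewrite ltNge (le_trans rk)// mesh_le.
Qed.

Lemma stopped_at_mesh_after tau n M w : (0 <= tau w)%E ->
  ((mesh n M)%:E < tau w)%E -> stopped_at_mesh X tau n M w = 0.
Proof.
move=> tw0 tw; rewrite /stopped_at_mesh big1.
  rewrite indicE memNset ?mulr0 ?addr0//= /after/=; apply; apply: le_lt_trans tw.
  by rewrite lee_fin mesh_ge0.
move=> k _; rewrite indicE memNset ?mulr0//= => -[_]; apply; rewrite /after/=.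
by apply: le_lt_trans tw; rewrite lee_fin mesh_le.
Qed.

(** The value 0 where [tau > T] keeps it below the almost surely nonnegative cost, whatever happens
    at [+oo]. *)
Definition stopped_upto tau T w : R :=
  if tau w is r%:E then (if r <= T%:R then X r w else 0) else 0.

(** [T * n.+1] is the index of time [T] in the mesh. The mesh points used are never before [tau] and
    converge to it, so right continuity suffices. *)
Lemma cvg_stopped_at_mesh tau T w : (0 <= tau w)%E ->
  stopped_at_mesh X tau n (T * n.+1) w @[n --> \oo] --> stopped_upto tau T w.
Proof.
move=> tw0; have late : (T%:R%:E < tau w)%E ->
    stopped_at_mesh X tau n (T * n.+1) w @[n --> \oo] --> (0 : R).
  move=> tw; rewrite (_ : (fun n => _) = fun=> 0); first exact: cvg_cst.
  by apply/funext => n; rewrite stopped_at_mesh_after// mesh_mulr.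
rewrite /stopped_upto; case tr : (tau w) => [r| |]; first last.
- by move: tw0; rewrite tr.
- by apply: late; rewrite tr ltry.
have [rT|Tr] := leP r T%:R; last by apply: late; rewrite tr lte_fin.
have r0 : 0 <= r by move: tw0; rewrite tr lee_fin.
have H n : exists u, (r <= u <= r + n.+1%:R^-1) /\
    stopped_at_mesh X tau n (T * n.+1) w = X u w.
  have [|k [_ [ku ->]]] := stopped_at_meshE (n := n) (M := T * n.+1) tr.
    by rewrite mesh_mulr r0 rT.
  by exists (mesh n k).
have /choice[u uP] := H.
rewrite (_ : (fun n => _) = fun n => X (u n) w); last first.
  by apply/funext => n; case: (uP n).
apply: (cvg_right_continuous_seq (x := X ^~ w)); first exact: X_right_continuous.
  by move=> n; case: (uP n) => /andP[].
apply: (@squeeze_cvgr _ _ _ _ (cst r) (fun n => r + n.+1%:R^-1)).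
- by apply: nearW => n; case: (uP n).
- exact: cvg_cst.
- rewrite -[X in _ --> X]addr0; apply: cvgD; first exact: cvg_cst.
  exact: (@cvg_harmonic R).
Qed.

(** The exceptional null set of [X_bound] depends on the time; only countably many mesh points are
    imposed, and right continuity extends the lower bound to all times. *)
Definition regular_path : set Omega :=
  [set w | forall n k, 0 <= X (mesh n k) w <= K * (1 + mesh n k)].

Lemma ae_regular_path : {ae P, forall w, regular_path w}.
Proof.
apply: ae_foralln => n; apply: ae_foralln => k.
by apply: X_bound; exact: mesh_ge0.
Qed.

Lemma regular_path_ge0 w t : regular_path w -> 0 <= t -> 0 <= X t w.
Proof.
move=> rw t0.
have := right_continuous_grid_point t0 (@X_right_continuous w t t0) => H.
rewrite -(cvg_lim _ H)//; apply: limr_ge; first by apply/cvg_ex; exists (X t w).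
by apply: nearW => n; case/andP: (rw n (grid_index n t)).
Qed.

Lemma stopped_at_mesh_bound tau n T w : (0 <= tau w)%E -> regular_path w ->
  0 <= stopped_at_mesh X tau n (T * n.+1) w <= K * (1 + T%:R).
Proof.
move=> tw0 rw; have KT0 : 0 <= K * (1 + T%:R) by rewrite mulr_ge0// addr_ge0.
have [Tt|tT] := ltP T%:R%:E (tau w).
  by rewrite stopped_at_mesh_after// ?mesh_mulr ?lexx.
case tr : (tau w) tw0 tT => [r| |]//; rewrite !lee_fin => r0 rT.
have [|k [kM [_ ->]]] := stopped_at_meshE (n := n) (M := T * n.+1) tr.
  by rewrite mesh_mulr r0.
case/andP: (rw n k) => -> /le_trans; apply.
by rewrite ler_wpM2l// lerD2l -(@mesh_mulr R n) mesh_le.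
Qed.

Lemma measurable_stopped_at_mesh tau n M : stopping_time Af tau ->
  measurable_fun setT (stopped_at_mesh X tau n M).
Proof.
move=> st; apply/measurable_EFinP.
exact: measurable_int (integrable_stopped_at_mesh Gen_measurable X_integrable n M st).
Qed.

Lemma measurable_stopped_upto tau T : stopping_time Af tau ->
  measurable_fun setT (stopped_upto tau T).
Proof.
move=> st; apply: (@measurable_fun_cvg _ _ _ _ (fun n => stopped_at_mesh X tau n (T * n.+1))).
  by move=> n; exact: measurable_stopped_at_mesh.
by move=> w _; apply: cvg_stopped_at_mesh; case: st => + _; exact.
Qed.

Lemma stopped_upto_limit tau T : stopping_time Af tau ->
  P.-integrable setT (EFin \o stopped_upto tau T) /\
  E P setT (stopped_at_mesh X tau n (T * n.+1)) @[n --> \oo] -->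
    E P setT (stopped_upto tau T).
Proof.
move=> st; have tau0 : forall w, (0 <= tau w)%E by case: st.
have [] := @dominated_convergence _ _ _ P setT measurableT
  (fun n => EFin \o stopped_at_mesh X tau n (T * n.+1))
  (EFin \o stopped_upto tau T) (cst (K * (1 + T%:R))%:E).
- by move=> n; apply/measurable_EFinP; exact: measurable_stopped_at_mesh.
- by apply/measurable_EFinP; exact: measurable_stopped_upto.
- apply: aeW => w _; apply: cvg_EFin; first exact: nearW.
  exact: cvg_stopped_at_mesh.
- by apply: integrable_bounded (cst (K * (1 + T%:R))) (K * (1 + T%:R)) _ _ => // w;
    rewrite ger0_norm// mulr_ge0// addr_ge0.
- apply: filterS ae_regular_path => w rw n _ /=; rewrite lee_fin.
  by case/andP: (stopped_at_mesh_bound n T (tau0 w) rw) => s0 s1; rewrite ger0_norm.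
move=> IL _ cL; split=> //.
rewrite -(E_EFin measurableT IL) in cL.
exact: (fine_cvg cL).
Qed.

End mesh_limit.

(** * Optimality of stopping when the drift changes sign *)

Section optimal_stopping.
Context {d : measure_display} {Omega : measurableType d} {R : realType}.
Variables (P : probability Omega R) (Gen : R -> set (set Omega)).
Let Af t : set (set Omega) := <<s Gen t >>.
Hypothesis Gen_measurable : forall t, Gen t `<=` measurable.
Hypothesis Af_le : forall s t, s <= t -> Af s `<=` Af t.
Variables (X Y Z : R -> Omega -> R) (C K M0 : R).
Hypothesis X_adapted : forall t, 0 <= t ->
  measurable_fun setT (X t : g_sigma_algebraType (Gen t) -> R).
Hypothesis X_integrable : forall t, 0 <= t -> P.-integrable setT (EFin \o X t).
Hypothesis X_right_continuous :
  forall w t, 0 <= t -> X s w @[s --> t^'+] --> X t w.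
Hypothesis K_ge0 : 0 <= K.
Hypothesis X_bound : forall t, 0 <= t -> {ae P, forall w, 0 <= X t w <= K * (1 + t)}.
Hypothesis Y_integrable : forall t, 0 <= t -> P.-integrable setT (EFin \o Y t).
Hypothesis drift : forall s h A, 0 <= s -> 0 <= h -> Af s A ->
  h * E P A (Y s) <= E P A (X (s + h)) - E P A (X s) <= h * E P A (Y s) + C * h ^+ 2.
Hypothesis Z_integrable : forall t, 0 <= t -> P.-integrable setT (EFin \o Z t).
Hypothesis Z_bound : forall t, 0 <= t -> {ae P, forall w, 0 <= Z t w <= K * (1 + t)}.
Hypothesis Z_X : forall t A, 0 <= t -> Af t A -> E P A (X t) = E P A (Z t).
Hypothesis M0_ge0 : 0 <= M0.
Hypothesis Z_late : forall s t A, 0 <= s -> s <= t -> Af t A ->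
  E P A (Z s) - M0 * fine (P A) <= E P A (X t).
Hypothesis growth : forall (b e : R), 0 < e -> exists T : nat, forall t A,
  T%:R <= t -> Af t A -> e <= fine (P A) -> b < E P A (X t).

Implicit Types (s t : R) (tau : Omega -> \bar R) (n k M T : nat).

Let after_meas tau t : stopping_time Af tau -> 0 <= t -> measurable (after tau t).
Proof.
move=> st t0; apply: (filtration_measurable Gen_measurable).
exact: (after_filtration st t0).
Qed.

Let p tau t := fine (P (after tau t)).

Lemma E_stopped_at_mesh_late tau n M j : stopping_time Af tau ->
  E P setT (stopped_at_mesh X tau n M) +
  (E P (after tau (mesh n M)) (Z (mesh n M)) -
   E P (after tau (mesh n (M + j))) (Z (mesh n M))) -
  M0 * (p tau (mesh n M) - p tau (mesh n (M + j))) <=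
  E P setT (stopped_at_mesh X tau n (M + j)).
Proof.
move=> st; elim: j => [|j IH]; first by rewrite addn0 !subrr mulr0 addr0 subr0.
have ma k : measurable (after tau (mesh n k)).
  by apply: after_meas => //; exact: mesh_ge0.
have sub : after tau (mesh n (M + j.+1)) `<=` after tau (mesh n (M + j)).
  by apply: after_le; apply: mesh_le; rewrite addnS.
rewrite addnS (E_stopped_at_mesh_recr Gen_measurable X_integrable n (M + j) st).
rewrite -addnS; set D := _ `\` _.
(* Stopping within a step is known only at its end, so [Z_late] is needed for events of the later
   time. *)
have fD : Af (mesh n (M + j.+1)) D.
  apply: (@measurableD _ (g_sigma_algebraType (Gen (mesh n (M + j.+1))))).
    apply: (@Af_le (mesh n (M + j))); first by rewrite mesh_le// addnS.
    by apply: (after_filtration st); exact: mesh_ge0.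
  by apply: (after_filtration st); exact: mesh_ge0.
have := Z_late (mesh_ge0 n M) (mesh_le n (leq_addr j.+1 M)) fD.
have -> : fine (P D) = p tau (mesh n (M + j)) - p tau (mesh n (M + j.+1)).
  rewrite /p -fineB ?fin_num_measure//; congr fine.
  rewrite /D measureD ?fin_num_measure ?ltey_eq ?fin_num_measure//.
  by congr (_ - P _)%E; rewrite setIidr.
rewrite /D E_setD//; last by apply: Z_integrable; exact: mesh_ge0.
by move: IH; rewrite !mulrBr; lra.
Qed.

(** Up to [T] the drifts are compared; beyond [T], costs are bounded below by [Z] at time [T], whose
    part on [{tau > T'}] is at most [K * (1 + T%:R) * p tau T'%:R]. The factor contains [T] and not
    [T'], so it disappears as [T'] grows. *)
Lemma stopped_upto_late tau tau' T T' :
  stopping_time Af tau -> stopping_time Af tau' ->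
  (forall w t, 0 <= t -> (t%:E < tau' w)%E -> Y t w <= 0) ->
  (forall w t, 0 <= t -> (tau' w <= t%:E)%E -> 0 <= Y t w) ->
  (forall w, (tau' w <= T%:R%:E)%E) -> (T <= T')%N ->
  E P setT (stopped_upto X tau' T) - K * (1 + T%:R) * p tau T'%:R - M0 * p tau T%:R <=
  E P setT (stopped_upto X tau T').
Proof.
move=> st st' Yneg Ypos tau'T TT'.
have [_ la] := stopped_upto_limit Gen_measurable X_integrable
  X_right_continuous K_ge0 X_bound T' st.
have [_ lb] := stopped_upto_limit Gen_measurable X_integrable
  X_right_continuous K_ge0 X_bound T st'.
have lb' : E P setT (stopped_at_mesh X tau' n (T * n.+1)) -
    (K * (1 + T%:R) * p tau T'%:R + M0 * p tau T%:R) - C * T%:R * n.+1%:R^-1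
    @[n --> \oo] -->
    E P setT (stopped_upto X tau' T) - (K * (1 + T%:R) * p tau T'%:R + M0 * p tau T%:R)
    - C * T%:R * 0.
  apply: cvgB; first by apply: cvgB lb _; exact: cvg_cst.
  by apply: cvgM; [exact: cvg_cst|exact: (@cvg_harmonic R)].
rewrite mulr0 subr0 opprD addrA in lb'.
apply: ler_cvg_to lb' la _; apply: nearW => n.
have MM' : (T' * n.+1 = T * n.+1 + (T' - T) * n.+1)%N by rewrite -mulnDl subnKC.
have := E_stopped_at_mesh_late n (T * n.+1) ((T' - T) * n.+1) st.
rewrite -MM' !mesh_mulr.
have T0 : 0 <= T%:R :> R by [].
have := E_stopped_at_mesh Gen_measurable X_integrable n (T * n.+1) st.
have := E_stopped_at_mesh Gen_measurable X_integrable n (T * n.+1) st'.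
have := drift_sum_le Gen_measurable Y_integrable drift n (T * n.+1) st st' Yneg Ypos.
rewrite !mesh_mulr.
have -> : after tau' T%:R = set0.
  by apply/seteqP; split => // w; rewrite /after/= ltNge tau'T.
rewrite E_set0 addr0.
have fT := after_filtration st T0.
rewrite -(Z_X T0 fT).
have : E P (after tau T'%:R) (Z T%:R) <= K * (1 + T%:R) * p tau T'%:R.
  have mT' : measurable (after tau T'%:R) by exact: after_meas.
  rewrite /p -E_cst//; apply: le_E_ae => //; first exact: Z_integrable.
  - by apply: (@integrable_bounded _ _ _ P _ `|K * (1 + T%:R)|).
  - by apply: filterS (Z_bound T0) => w /andP[].
have : 0 <= M0 * p tau T'%:R by rewrite mulr_ge0// fine_ge0.
rewrite (mulrBr M0); move: (C * T%:R / n.+1%:R) (K * (1 + T%:R) * _) => a b.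
move: (M0 * p tau T%:R) (M0 * p tau T'%:R) => u u'.
move: (E P setT _) (E P setT _) (E P setT _) (drift_sum _ _ _ _ _).
move: (drift_sum _ _ _ _ _) (E _ _ _) (E _ _ _) => v1 v2 v3 v4 v5 v6 v7.
by lra.
Qed.

(* Hence stopping at [+oo] with positive probability costs [+oo]. *)
Lemma ae_unbounded : {ae P, forall w, forall b j : nat, exists2 k, (j <= k)%N & b%:R < X k%:R w}.
Proof.
apply: ae_foralln => b; apply: ae_foralln => j.
pose D k := [set w | forall i, (j <= i <= k)%N -> X i%:R w <= b%:R].
have fD k : Af k%:R (D k).
  rewrite (_ : D k = \bigcap_(i in [set i | (j <= i <= k)%N]) [set w | X i%:R w <= b%:R]); last first.
    by apply/seteqP; split.
  apply: (@fin_bigcap_measurable _ (g_sigma_algebraType (Gen k%:R))).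
    apply: (@sub_finite_set _ _ `I_k.+1) => [i /= /andP[]//|]; exact: finite_II.
  move=> i /= /andP[_ ik]; apply: (@Af_le i%:R); first by rewrite ler_nat.
  have /(_ measurableT `]-oo, b%:R]%classic (measurable_itv _)) := X_adapted (ler0n R i).
  by rewrite setTI (_ : _ @^-1` _ = [set w | X i%:R w <= b%:R])//;
    apply/seteqP; split => w /=; rewrite in_itv.
have mD k : measurable (D k) by exact: filtration_measurable (fD k).
have mDD : measurable (\bigcap_k D k) by exact: bigcapT_measurable.
exists (\bigcap_k D k); split => //; last first.
  move=> w /= nw k _ i /andP[ji ik]; rewrite leNgt; apply/negP => bX.
  by apply: nw; exists i.
apply: contrapT => /eqP PD0.
have e0 : 0 < fine (P (\bigcap_k D k)).
  by rewrite fine_gt0// lt_neqAle eq_sym PD0 measure_ge0/= ltey_eq fin_num_measure.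
(* The observed events [D k] decrease to the bad event. If that had positive probability, [growth]
   would make the mean of [X] over [D k] exceed [b], although [X] is at most [b] there. *)
have [T HT] := growth b%:R e0.
pose k := maxn T j; have Tk : T%:R <= k%:R :> R by rewrite ler_nat leq_maxl.
have PDk : fine (P (\bigcap_k D k)) <= fine (P (D k)).
  rewrite fine_le ?fin_num_measure//; apply: le_measure; rewrite ?inE//.
  by move=> w; exact.
have := HT _ _ Tk (fD k) PDk; rewrite ltNge => /negP; apply.
apply: (@le_trans _ _ (E P (D k) (cst b%:R))).
  apply: le_E => //; first exact: X_integrable.
    by apply: (@integrable_bounded _ _ _ P _ b%:R) => // w; rewrite /= ger0_norm.
  by move=> w /(_ k); apply; rewrite leqnn leq_maxr.
rewrite E_cst//; apply: ler_piMr => //.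
by rewrite -[leRHS]/(fine 1%E) fine_le// ?fin_num_measure// probability_le1.
Qed.

Lemma bigcap_after tau : (forall w, 0 <= tau w)%E ->
  \bigcap_k after tau k%:R = [set w | tau w = +oo%E].
Proof.
move=> tau0; apply/seteqP; split => w /=; last by move=> tw k _; rewrite /after/= tw ltry.
have := tau0 w; rewrite /bigcap/after/=; case: (tau w) => [r| |]//; rewrite lee_fin => r0 H.
have := H (Num.truncn r).+1 Logic.I; rewrite lte_fin => /ltW.
by rewrite leNgt; case/andP: (truncn_itv r0) => _ ->.
Qed.

Lemma probability_after_cvg tau : stopping_time Af tau ->
  P [set w | tau w = +oo%E] = 0%E -> p tau k%:R @[k --> \oo] --> (0 : R).
Proof.
move=> st Poo.
have cap : \bigcap_k after tau k%:R = [set w | tau w = +oo%E].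
  by apply: bigcap_after; case: st.
suff : P (after tau k%:R) @[k --> \oo] --> P (\bigcap_k after tau k%:R).
  by rewrite cap Poo => /fine_cvg; exact.
apply: nonincreasing_cvg_mu.
- by rewrite ltey_eq fin_num_measure//; exact: after_meas.
- by move=> k; exact: after_meas.
- by apply: bigcapT_measurable => k; exact: after_meas.
- by move=> k l kl; apply/subsetPset/after_le; rewrite ler_nat.
Qed.

Lemma limf_esup_pinfty_unbounded (x : R -> R) :
  (forall b j : nat, exists2 k, (j <= k)%N & b%:R < x k%:R) ->
  limf_esup (EFin \o x) (pinfty_nbhs R) = +oo%E.
Proof.
move=> xoo; apply/eqP; rewrite -leye_eq; apply/ereal_infP => _ [V /= [M [_ VM]] <-].
rewrite leye_eq; apply/eqP; apply/eqyP => b b0.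
have [k + bk] := xoo (Num.truncn b).+1 (Num.truncn `|M|).+1; rewrite -(ler_nat R) => Mk.
apply: le_trans (_ : (x k%:R)%:E <= _)%E.
  rewrite lee_fin; apply: ltW; apply: lt_trans bk.
  by case/andP: (truncn_itv (ltW b0)).
apply: ereal_sup_ubound; exists k%:R => //; apply: VM; apply: lt_le_trans Mk.
apply: le_lt_trans (ler_norm M) _.
by case/andP: (truncn_itv (normr_ge0 M)).
Qed.

Lemma optimal_stopping tau tau' T0 :
  stopping_time Af tau -> stopping_time Af tau' ->
  (forall w t, 0 <= t -> (t%:E < tau' w)%E -> Y t w <= 0) ->
  (forall w t, 0 <= t -> (tau' w <= t%:E)%E -> 0 <= Y t w) ->
  (forall w, (tau' w <= T0%:R%:E)%E) ->
  (\int[P]_w stopped_value (X ^~ w) (tau' w) <=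
   \int[P]_w stopped_value (X ^~ w) (tau w))%E.
Proof.
move=> st st' Yneg Ypos tau'T0.
have tau0 w : (0 <= tau w)%E by case: st.
have tau'0 w : (0 <= tau' w)%E by case: st'.
have upto T (rho : Omega -> \bar R) w : (0 <= rho w <= T%:R%:E)%E ->
    stopped_value (X ^~ w) (rho w) = (stopped_upto X rho T w)%:E.
  rewrite /stopped_upto; case: (rho w) => [r| |] /andP[]//=.
  by rewrite !lee_fin => _ ->.
have tau'E T : (T0 <= T)%N -> (\int[P]_w stopped_value (X ^~ w) (tau' w) =
    (E P setT (stopped_upto X tau' T))%:E)%E.
  move=> T0T; have [I _] := stopped_upto_limit Gen_measurable X_integrable
    X_right_continuous K_ge0 X_bound T st'.
  rewrite E_EFin//; apply: eq_integral => w _; apply: upto.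
  by rewrite tau'0/= (le_trans (tau'T0 w))// lee_fin ler_nat.
pose v w := if tau w is r%:E then X r w else 0.
have mv : measurable_fun setT v.
  apply: (@measurable_fun_cvg _ _ _ _ (stopped_upto X tau)).
    move=> T; exact: (measurable_stopped_upto Gen_measurable X_integrable X_right_continuous T st).
  move=> w _; apply: cvg_near_cst; rewrite /v /stopped_upto; case: (tau w) => [r| |]; last 2 first.
  - exact: nearW.
  - exact: nearW.
  exists (Num.truncn `|r|).+1 => // T /= rT; rewrite ifT//; apply: le_trans (ler_norm r) _.
  apply: ltW; apply: lt_le_trans (_ : (Num.truncn `|r|).+1%:R <= _); last by rewrite ler_nat.
  by case/andP: (truncn_itv (normr_ge0 r)).
(* A measurable minorant of the cost of [tau] off a null set; the maximum with 0 is taken because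
   [X] is nonnegative only almost surely. *)
pose g w : \bar R := if tau w == +oo%E then +oo%E else (Num.max (v w) 0)%:E.
have moo : measurable [set w | tau w = +oo%E].
  by rewrite -bigcap_after//; apply: bigcapT_measurable => k; exact: after_meas.
have mg : measurable_fun setT g.
  apply: measurable_fun_ifT => //.
    apply: (measurable_fun_bool true); rewrite setTI.
    rewrite (_ : _ @^-1` _ = [set w | tau w = +oo%E])//.
    by apply/seteqP; split => w /= /eqP.
  by apply/measurable_EFinP; exact: measurable_maxr.
have g0 w : (0 <= g w)%E.
  by rewrite /g; case: ifP => _; rewrite ?leey// lee_fin le_max lexx orbT.
have [Zb [mZ PZ Zsub]] : {ae P, forall w, regular_path X K w /\
    forall b j : nat, exists2 k, (j <= k)%N & b%:R < X k%:R w}.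
  by apply: filterI; [exact: ae_regular_path|exact: ae_unbounded].
have gX w : ~ Zb w -> (g w <= stopped_value (X ^~ w) (tau w))%E.
  move=> nZ; have [rw uw] : regular_path X K w /\
    forall b j : nat, exists2 k, (j <= k)%N & b%:R < X k%:R w.
    by apply: contrapT => H; exact/nZ/Zsub.
  rewrite /g /v; have := tau0 w; case: (tau w) => [r| |]//=.
    rewrite lee_fin => r0; rewrite max_l// .
    exact: (regular_path_ge0 X_right_continuous rw).
  by rewrite limf_esup_pinfty_unbounded.
apply: le_trans (ge0_integral_le_off_null mZ PZ mg g0 gX).
(* If [tau] is infinite with positive probability, [g] has infinite integral; otherwise the tails of
   [tau] tend to 0. *)
have [Poo|Poo] := eqVneq (P [set w | tau w = +oo%E]) 0%E; last first.
  apply: le_trans (leey _) _.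
  have <- : (\int[P]_(w in [set w | tau w = +oo%E]) +oo = +oo)%E.
    rewrite integral_cst// gt0_mulye// lt_neqAle eq_sym Poo measure_ge0//.
  apply: le_trans (_ : (\int[P]_(w in [set w | tau w = +oo%E]) g w <= _)%E).
    apply: ge0_le_integral => //; first exact: measurable_funTS.
    by move=> w /= tw; rewrite /g tw eqxx.
  by apply: ge0_subset_integral.
have gT T : ((E P setT (stopped_upto X tau T))%:E <= \int[P]_w g w)%E.
  have [I _] := stopped_upto_limit Gen_measurable X_integrable
    X_right_continuous K_ge0 X_bound T st.
  rewrite E_EFin// integralE.
  apply: (@le_trans _ _ (\int[P]_w (fun w => (stopped_upto X tau T w)%:E)^\+ w)%E).
    by rewrite geeDl// oppe_le0 integral_ge0.
  have ms := measurable_stopped_upto Gen_measurable X_integrable X_right_continuous T st.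
  apply: ge0_le_integral => //.
    by apply: measurable_funepos; exact/measurable_EFinP.
  move=> w _; rewrite funeposE /g /stopped_upto /v.
  case: (tau w) => [r| |]//=; last 2 first.
  - by rewrite leey.
  - by rewrite -EFin_max.
  by case: ifP => _; rewrite -EFin_max lee_fin// maxxx le_max lexx orbT.
apply/lee_addgt0Pr => e e0.
have pcvg := probability_after_cvg st Poo.
have small (b : R) : 0 <= b -> exists k, forall l, (k <= l)%N -> b * p tau l%:R < e / 2.
  move=> b0; have : b * p tau k%:R @[k --> \oo] --> b * 0 by apply: cvgM => //; exact: cvg_cst.
  rewrite mulr0 => /cvgrPdist_lt /(_ (e / 2)) [|k _ H]; first by rewrite divr_gt0.
  exists k => l kl; have := H l kl; rewrite sub0r normrN; apply: le_lt_trans.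
  exact: ler_norm.
(* [T] is fixed before [T'], because the coefficient of the second error depends on [T]. *)
have [T1 HT1] := small M0 M0_ge0.
pose T := maxn T0 T1.
have [T2 HT2] := small (K * (1 + T%:R)) (mulr_ge0 K_ge0 (addr_ge0 ler01 (ler0n _ _))).
pose T' := maxn T T2.
rewrite (tau'E T) ?leq_maxl//.
have tau'T w : (tau' w <= T%:R%:E)%E.
  by apply: le_trans (tau'T0 w) _; rewrite lee_fin ler_nat leq_maxl.
have := stopped_upto_late st st' Yneg Ypos tau'T (leq_maxl T T2).
have := HT1 T (leq_maxr _ _); have := HT2 T' (leq_maxr _ _).
rewrite -/T'; move=> h2 h1 h.
apply: (@le_trans _ _ ((E P setT (stopped_upto X tau T'))%:E + e%:E)%E); last first.
  by rewrite leeD2r// gT.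
rewrite -EFinD lee_fin; move: h h1 h2.
move: (K * _ * _) (M0 * _) (E _ _ _) (E _ _ _) => x1 x2 x3 x4; lra.
Qed.

End optimal_stopping.

(** * Finite sums, almost sure signs and an exponential estimate *)

Section more_integration_on_events.
Context {d : measure_display} {Omega : measurableType d} {R : realType}.
Variable P : probability Omega R.
Implicit Types (f g : Omega -> R) (A : set Omega).

Lemma integrable_bigsum (I : eqType) (r : seq I) (f : I -> Omega -> R) :
  (forall i, P.-integrable setT (EFin \o f i)) ->
  P.-integrable setT (EFin \o (fun w => \sum_(i <- r) f i w)).
Proof.
move=> If; elim: r => [|i r IH].
  rewrite (_ : _ \o _ = cst 0%E); first exact: integrable0.
  by apply/funext => w /=; rewrite big_nil.
rewrite (_ : _ \o _ = (EFin \o f i) \+ (EFin \o (fun w => \sum_(j <- r) f j w))).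
  exact: integrableD.
by apply/funext => w /=; rewrite big_cons.
Qed.

Lemma E_bigsum (I : eqType) (r : seq I) (f : I -> Omega -> R) A : measurable A ->
  (forall i, P.-integrable setT (EFin \o f i)) ->
  E P A (fun w => \sum_(i <- r) f i w) = \sum_(i <- r) E P A (f i).
Proof.
move=> mA If; elim: r => [|i r IH].
  rewrite big_nil (_ : (fun w => _) = cst 0); first by rewrite E_cst// mul0r.
  by apply/funext => w; rewrite big_nil.
rewrite big_cons -IH -E_D//; last exact: integrable_bigsum.
by congr (E _ _ _); apply/funext => w; rewrite big_cons.
Qed.

Lemma E_B A f g : measurable A -> P.-integrable setT (EFin \o f) ->
  P.-integrable setT (EFin \o g) -> E P A (fun w => f w - g w) = E P A f - E P A g.
Proof. by move=> mA If Ig; rewrite /E RintegralB//; exact: integrable_on. Qed.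

(** On the event where [f] is negative, [|f| = - f] has nonpositive integral, so the event is null.
    For an adapted [f] this event is observed, which lets conditional expectations inherit
    bounds. *)
Lemma ae_ge0_E f : P.-integrable setT (EFin \o f) ->
  0 <= E P [set w | f w < 0] f -> {ae P, forall w, 0 <= f w}.
Proof.
move=> If E0; set D := [set w | f w < 0] in E0.
have mf : measurable_fun setT f by apply/measurable_EFinP; exact: measurable_int If.
have mD : measurable D.
  rewrite (_ : D = f @^-1` `]-oo, 0[); first by rewrite -[_ @^-1` _]setTI; exact: mf.
  by apply/seteqP; split => w /=; rewrite in_itv.
have abs0 : (\int[P]_(w in D) `|(f w)%:E| = 0)%E.
  apply/eqP; rewrite eq_le integral_ge0// andbT.
  rewrite (eq_integral (fun w => (-1 * f w)%:E))%E; last first.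
    by move=> w; rewrite inE/= => fw; rewrite mulN1r ltr0_norm.
  rewrite -(E_EFin mD (integrableZl measurableT (-1) If : P.-integrable setT
    (EFin \o (fun w => -1 * f w)))) E_Zl// lee_fin mulN1r oppr_le0//.
have mfD : measurable_fun D (EFin \o f) by apply: measurable_funTS; exact/measurable_EFinP.
have [Z [mZ PZ Zs]] := (ae_eq_integral_abs P mD mfD).1 abs0.
exists Z; split=> // w /= /negP; rewrite -ltNge => fw; apply: Zs => /= H.
by have := H fw => -[] f0; move: fw; rewrite f0 ltxx.
Qed.

End more_integration_on_events.

(** Both bounds come from [1 + y <= expR y], at [y = - x] and at [y = x]. *)
Lemma expRN_bounds (R : realType) (x : R) : 0 <= x -> 0 <= expR (- x) - 1 + x <= x ^+ 2.
Proof.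
move=> x0; have h1 := expR_ge1Dx (- x); have h2 := expR_ge1Dx x.
have e1 : expR (- x) <= (1 + x)^-1.
  by rewrite expRN lef_pV2// posrE ?expR_gt0// ltr_pwDl.
have e2 : (1 + x)^-1 <= 1 - x + x ^+ 2.
  rewrite -[leLHS]mul1r ler_pdivrMr ?ltr_pwDl//.
  have -> : (1 - x + x ^+ 2) * (1 + x) = 1 + x ^+ 3 by ring.
  by rewrite lerDl exprn_ge0.
by apply/andP; split; lra.
Qed.

(** * The disorder problem *)

Section disorder_problem.
Context {R : realType} {d : measure_display} {Omega : measurableType d}.
Context (P : probability Omega R) {m : nat} (lambda c mu0 mu1 : 'I_m -> R).
Hypotheses (lambda_gt0 : forall i, 0 < lambda i) (c_gt0 : forall i, 0 < c i).
Hypotheses (mu0_gt0 : forall i, 0 < mu0 i) (mu1_gt0 : forall i, 0 < mu1 i).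
Hypotheses (mu_le : forall i, 0 <= mu1 i - mu0 i).
Hypotheses (lambda_ge : forall i, mu1 i - mu0 i <= lambda i).
Variables (sigma : 'I_m -> {RV P >-> R}) (N : 'I_m -> R -> Omega -> nat).
Hypothesis sigma_exp : forall i (B : set R), measurable B ->
  distribution P (sigma i) B = exponential_prob (lambda i) B.
Hypothesis cN : forall i, counting_process (N i).
Hypothesis cp : forall i,
  conditionally_poisson P (sigma i) (N i) (switching_rate (mu0 i) (mu1 i)).
Hypothesis indep : independent_sigma_algebras P (coordinate_sigma_algebra sigma N).
Variable X : 'I_m -> R -> Omega -> R.
Hypothesis X_version : forall i, right_continuous_version P (observed_filtration N)
  (penalty c sigma i) (X i).

Implicit Types (s t u h : R) (i : 'I_m) (A : set Omega).

Let pi i t w := posterior (lambda i) (mu0 i) (mu1 i) (N i ^~ w) t.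
Let I f := P.-integrable setT (EFin \o f : Omega -> \bar R).

Let om t A : observed_filtration N t A -> measurable A.
Proof. exact: observed_measurable. Qed.

Let msigma i : measurable_fun setT (sigma i).
Proof. exact: measurable_funPT. Qed.

Let indic_integrable (D : set Omega) : measurable D -> I (\1_D).
Proof.
move=> mD; apply: (@integrable_bounded _ _ _ P _ 1); first exact: measurable_indic.
by move=> w; rewrite indicE; case: (_ \in _); rewrite ?normr0 ?normr1.
Qed.

Let Igt i s : I (\1_[set w | s < sigma i w]).
Proof. by apply: indic_integrable; exact: measurable_sigma_gt. Qed.
Let Ile i s : I (\1_[set w | sigma i w <= s]).
Proof. by apply: indic_integrable; exact: measurable_sigma_le. Qed.

Lemma E_indicE A (D : set Omega) : measurable A -> measurable D ->
  E P A (\1_D) = fine (P (D `&` A)).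
Proof. by move=> mA mD; rewrite /E /Rintegral integral_indic. Qed.

Lemma sigma_ae_neq i t : {ae P, forall w, sigma i w != t}.
Proof.
exists (sigma i @^-1` [set t]); split.
- by rewrite -[_ @^-1` _]setTI; exact: msigma.
- have -> : P (sigma i @^-1` [set t]) = distribution P (sigma i) [set t] by [].
  by rewrite sigma_exp// /exponential_prob integral_set1.
- by move=> w /= /negP; rewrite negbK => /eqP.
Qed.

Lemma sigma_ae_ge0 i : {ae P, forall w, 0 <= sigma i w}.
Proof.
exists [set w | sigma i w <= 0]; split.
- exact: measurable_sigma_le.
- have := probability_sigma_le (lambda_gt0 i) (@sigma_exp i) (lexx 0).
  by rewrite mulr0 expR0 subrr.
- by move=> w /= /negP; rewrite -ltNge => /ltW.
Qed.

Let late i t w := Num.max (t - sigma i w) 0.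

Let measurable_late i t : measurable_fun setT (late i t).
Proof. by apply: measurable_maxr => //; exact: measurable_funB. Qed.

Let measurable_ge i t : measurable [set w | t <= sigma i w].
Proof.
rewrite (_ : mkset _ = sigma i @^-1` `[t, +oo[).
  by rewrite -[_ @^-1` _]setTI; exact: msigma.
by apply/seteqP; split => w /=; rewrite in_itv/= andbT.
Qed.

Lemma penaltyE i t w :
  penalty c sigma i t w = \1_[set w | t <= sigma i w] w + c i * late i t w.
Proof. by []. Qed.

Lemma measurable_penalty i t : measurable_fun setT (penalty c sigma i t).
Proof.
apply: measurable_funD; first exact: measurable_indic.
by apply: measurable_funM => //; exact: measurable_late.
Qed.

Lemma penalty_ge0 i t w : 0 <= penalty c sigma i t w.
Proof.
by rewrite penaltyE addr_ge0// mulr_ge0 ?(ltW (c_gt0 i))// /late le_max lexx orbT.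
Qed.

Lemma X_integrable i t : 0 <= t -> I (X i t).
Proof. by move=> t0; have [] := (X_version i).1 t t0. Qed.

(** The penalty is nonnegative and has the same integral over the whole space as its integrable
    conditional expectation. *)
Lemma penalty_integrable i t : 0 <= t -> I (penalty c sigma i t).
Proof.
move=> t0; have [_ IX XZ] := (X_version i).1 t t0.
have oT : observed_filtration N t setT by exact: (@measurableT _ (g_sigma_algebraType (observed_events N t))).
apply/integrableP; split; first by apply/measurable_EFinP; exact: measurable_penalty.
rewrite (eq_integral (fun w => (penalty c sigma i t w)%:E)); last first.
  by move=> w _ /=; rewrite ger0_norm// penalty_ge0.
by rewrite -XZ// ltey_eq integrable_fin_num.
Qed.

Lemma E_X i t A : 0 <= t -> observed_filtration N t A ->
  E P A (X i t) = E P A (penalty c sigma i t).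
Proof.
move=> t0 oA; rewrite /E /Rintegral; congr fine.
by have [_ _] := (X_version i).1 t t0; exact.
Qed.

Let late_integrable i t : 0 <= t -> I (late i t).
Proof.
move=> t0; have mg := measurable_ge i t.
rewrite /I (_ : _ \o _ = fun w => ((c i)^-1%:E * (EFin \o
    (fun w => penalty c sigma i t w - \1_[set w | (t <= sigma i w)%R] w)%R) w)%E).
  apply: integrableZl => //.
  have := integrableB measurableT (penalty_integrable i t0) (indic_integrable mg).
  by congr (_.-integrable _ _).
apply/funext => w /=; rewrite -EFinM penaltyE; congr EFin.
by have := c_gt0 i => c0; field; rewrite gt_eqF.
Qed.

(** The penalty charges [t <= sigma], the memoryless identity concerns [t < sigma]; the law of
    [sigma] has no atoms. *)
Lemma E_penalty i t A : 0 <= t -> measurable A ->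
  E P A (penalty c sigma i t) =
  E P A (\1_[set w | t < sigma i w]) + c i * E P A (late i t).
Proof.
move=> t0 mA; rewrite -E_Zl//; last exact: late_integrable.
have -> : penalty c sigma i t = fun w => \1_[set w | t <= sigma i w] w + c i * late i t w by [].
have Ige := indic_integrable (measurable_ge i t).
have Igt' := Igt i t.
rewrite E_D//; last exact: (integrableZl measurableT (c i) (late_integrable i t0)).
congr (_ + _); apply/eqP; rewrite eq_le; apply/andP; split; apply: le_E_ae => //;
  apply: filterS (sigma_ae_neq i t) => w st;
  have e : (t <= sigma i w) = (t < sigma i w) by rewrite le_eqVlt eq_sym (negbTE st).
- by rewrite !indic_mkset e.
- by rewrite !indic_mkset e.
Qed.

Let posterior_integrable i t : 0 <= t -> I (pi i t).
Proof.
move=> t0; apply: (@integrable_bounded _ _ _ P _ 1).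
  exact: (measurable_posterior lambda_gt0 mu0_gt0 mu_le lambda_ge cN i t0).
move=> w; have /andP[p0 p1] := posterior_itv mu0 mu1 lambda_gt0 N i t w.
by rewrite ger0_norm.
Qed.

Lemma E_posterior i t A : 0 <= t -> observed_filtration N t A ->
  E P A (pi i t) = E P A (\1_[set w | sigma i w <= t]).
Proof.
move=> t0 oA; rewrite /E /Rintegral; congr fine.
by have [_ _] := posterior_cond_exp lambda_gt0 mu0_gt0 mu1_gt0 mu_le lambda_ge
  sigma_exp cN cp indep i t0; exact.
Qed.

Lemma E_memoryless i s u A : 0 <= s -> s <= u -> observed_filtration N s A ->
  E P A (\1_[set w | u < sigma i w]) =
  expR (- lambda i * (u - s)) * E P A (\1_[set w | s < sigma i w]).
Proof.
move=> s0 su oA; have mA := om oA; rewrite -(E_Zl _ mA (Igt i s)).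
rewrite /E /Rintegral; congr fine.
exact: (memoryless lambda_gt0 mu0_gt0 mu1_gt0 sigma_exp cN cp indep i s0 su oA).
Qed.

Lemma E_le_gt i s A : measurable A ->
  E P A (\1_[set w | sigma i w <= s]) + E P A (\1_[set w | s < sigma i w]) = fine (P A).
Proof.
move=> mA; rewrite -(E_D mA (Ile i s) (Igt i s)) -[RHS]mul1r -E_cst//; congr (E _ _ _); apply/funext => w.
by rewrite !indic_mkset/= leNgt; case: ltP; rewrite ?addr0 ?add0r.
Qed.

Lemma penalty_drift i s h A : 0 <= s -> 0 <= h -> observed_filtration N s A ->
  h * ((c i + lambda i) * E P A (pi i s) - lambda i * fine (P A)) <=
  E P A (penalty c sigma i (s + h)) - E P A (penalty c sigma i s) <=
  h * ((c i + lambda i) * E P A (pi i s) - lambda i * fine (P A)) +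
  (lambda i ^+ 2 + c i * lambda i) * h ^+ 2.
Proof.
move=> s0 h0 oA; have mA := om oA; have sh0 : 0 <= s + h by rewrite addr_ge0.
have su : s <= s + h by rewrite lerDl.
rewrite !E_penalty// E_posterior//.
have := E_le_gt i s mA.
set q := E P A (\1_[set w | sigma i w <= s]); set p := E P A (\1_[set w | s < sigma i w]).
have pu : E P A (\1_[set w | s + h < sigma i w]) = expR (- (lambda i * h)) * p.
  by rewrite (E_memoryless i s0 su oA); congr (expR _ * _); ring.
have p0 : 0 <= p by apply: Rintegral_ge0 => w _.
have p1 : p <= 1.
  rewrite /p E_indicE//; last exact: measurable_sigma_gt.
  rewrite -[leRHS]/(fine 1%E) fine_le// ?fin_num_measure ?probability_le1//;
    by apply: measurableI => //; exact: measurable_sigma_gt.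
have Il1 := late_integrable i s0; have Il2 := late_integrable i sh0.
have lo : h * q <= E P A (late i (s + h)) - E P A (late i s).
  rewrite -(E_B mA Il2 Il1) -(E_Zl h mA (Ile i s)); apply: le_E => //.
  - exact: (integrableZl measurableT h (Ile i s)).
  - exact: (integrableB measurableT Il2 Il1).
  move=> w _; rewrite indic_mkset /late.
  have [ss|ss] := leP (sigma i w) s.
    by rewrite mulr1 !max_l ?subr_ge0// ?(le_trans ss)//; lra.
  rewrite mulr0 (max_r (_ : s - sigma i w <= 0)) ?subr0 ?le_max ?lexx ?orbT//.
  by rewrite subr_le0 ltW.
have hi : E P A (late i (s + h)) - E P A (late i s) <= h * (q + (p - expR (- (lambda i * h)) * p)).
  have Ib : I (fun w => \1_[set w | s < sigma i w] w - \1_[set w | s + h < sigma i w] w).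
    exact: (integrableB measurableT (Igt i s) (Igt i (s + h))).
  have Id : I (fun w => \1_[set w | sigma i w <= s] w +
      (\1_[set w | s < sigma i w] w - \1_[set w | s + h < sigma i w] w)).
    exact: (integrableD measurableT (Ile i s) Ib).
  rewrite -pu -(E_B mA (Igt i s) (Igt i (s + h))) -(E_D mA (Ile i s) Ib).
  rewrite -(E_Zl h mA Id) -(E_B mA Il2 Il1); apply: le_E => //.
  - exact: (integrableB measurableT Il2 Il1).
  - exact: (integrableZl measurableT h Id).
  move=> w _; rewrite !indic_mkset /late.
  have [ss|ss] := leP (sigma i w) s.
    rewrite (max_l (_ : 0 <= s - sigma i w)) ?subr_ge0//.
    rewrite (max_l (_ : 0 <= s + h - sigma i w)) ?subr_ge0 ?(le_trans ss)//.
    by rewrite ltNge (le_trans ss su)/=; lra.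
  have s1 : s - sigma i w <= 0 by rewrite subr_le0 ltW.
  rewrite (max_r s1); have [uu|uu] := ltP (s + h) (sigma i w).
    have u1 : s + h - sigma i w <= 0 by rewrite subr_le0 ltW.
    by rewrite (max_r u1) !subrr addr0 mulr0.
  by rewrite max_l ?subr_ge0//=; lra.
rewrite pu => pq.
have := expRN_bounds (mulr_ge0 (ltW (lambda_gt0 i)) h0) => /andP[].
move: (expR _) pu hi => e pu hi e1 e2.
have ci := ltW (c_gt0 i); have li := ltW (lambda_gt0 i).
have lh : 0 <= lambda i * h by rewrite mulr_ge0.
rewrite -pq; set L1 := E P A (late i (s + h)) in lo hi *; set L0 := E P A (late i s) in lo hi *.
have e1p : 0 <= (e - 1 + lambda i * h) * p by rewrite mulr_ge0.
have e2p : (e - 1 + lambda i * h) * p <= (lambda i * h) ^+ 2.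
  by apply: le_trans e2; rewrite ler_piMr.
have clo := ler_wpM2l ci lo; have chi := ler_wpM2l ci hi.
have cp1 : c i * h * ((1 - e) * p) <= c i * h * (lambda i * h).
  apply: ler_wpM2l; first by rewrite mulr_ge0.
  by apply: le_trans (_ : (lambda i * h) * p <= _); [apply: ler_wpM2r => //; lra|rewrite ler_piMr].
apply/andP; split; nra.
Qed.

Let Xs t w := \sum_(i < m) X i t w.
Let Zs t w := \sum_(i < m) penalty c sigma i t w.
Let Ys t w := \sum_(i < m) (c i + lambda i) * pi i t w - \sum_(i < m) lambda i.
(** When [sigma i >= 0] the penalty is at most [1 + c i * t], hence at most
    [(1 + c i) * (1 + t)]. *)
Let K := \sum_(i < m) (1 + c i).
Let C := \sum_(i < m) (lambda i ^+ 2 + c i * lambda i).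
Let tau_star := threshold_time lambda c pi.

Let observed_meas t : observed_events N t `<=` measurable.
Proof. exact: observed_events_measurable. Qed.

Let Xs_integrable t : 0 <= t -> I (Xs t).
Proof. by move=> t0; apply: integrable_bigsum => i; exact: X_integrable. Qed.

Let Zs_integrable t : 0 <= t -> I (Zs t).
Proof. by move=> t0; apply: integrable_bigsum => i; exact: penalty_integrable. Qed.

Let weighted_posterior_integrable i t : 0 <= t -> I (fun w => (c i + lambda i) * pi i t w).
Proof.
move=> t0; exact: (integrableZl measurableT (c i + lambda i) (posterior_integrable i t0)).
Qed.

Let cst_integrable (a : R) : I (cst a).
Proof. by apply: (@integrable_bounded _ _ _ P _ `|a|). Qed.

Let Ys_integrable t : 0 <= t -> I (Ys t).
Proof.
move=> t0; have IS : I (fun w => \sum_(i < m) (c i + lambda i) * pi i t w).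
  by apply: integrable_bigsum => i; exact: weighted_posterior_integrable.
exact: (integrableB measurableT IS (cst_integrable _)).
Qed.

Let Xs_adapted t : 0 <= t ->
  measurable_fun setT (Xs t : g_sigma_algebraType (observed_events N t) -> R).
Proof.
move=> t0; apply: measurable_sum => i _ B mB; rewrite setTI.
by have [+ _ _] := (X_version i).1 t t0; exact.
Qed.

Let cvg_sum (f : 'I_m -> R -> R) t :
  (forall i, f i s @[s --> t^'+] --> f i t) ->
  \sum_(i < m) f i s @[s --> t^'+] --> \sum_(i < m) f i t.
Proof. by move=> H; apply: cvg_big => //; exact: add_continuous. Qed.

Let Xs_right_continuous w t : 0 <= t -> Xs s w @[s --> t^'+] --> Xs t w.
Proof. by move=> t0; apply: cvg_sum => i; exact: (X_version i).2. Qed.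

Let E_Xs t A : 0 <= t -> observed_filtration N t A -> E P A (Xs t) = E P A (Zs t).
Proof.
move=> t0 oA; have mA := om oA.
rewrite !E_bigsum//.
- by apply: eq_bigr => i _; exact: E_X.
- by move=> i; exact: penalty_integrable.
- by move=> i; exact: X_integrable.
Qed.

Let K_ge0 : 0 <= K.
Proof. by apply: sumr_ge0 => i _; rewrite addr_ge0// ltW. Qed.

Let Zs_bound t : 0 <= t -> {ae P, forall w, 0 <= Zs t w <= K * (1 + t)}.
Proof.
move=> t0; apply: filterS (filter_forall _ sigma_ae_ge0) => w s0.
rewrite sumr_ge0 => [|i _]; last exact: penalty_ge0.
rewrite /K big_distrl/=; apply: ler_sum => i _; rewrite penaltyE.
have ci := ltW (c_gt0 i).
have l1 : late i t w <= t by rewrite /late ge_max t0 andbT lerBlDr lerDl.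
have i1 : \1_[set w | t <= sigma i w] w <= 1 :> R.
  by rewrite indicE; case: (_ \in _).
by have := ler_wpM2l ci l1; nra.
Qed.

(** The events where [Xs] violates a bound are observed, and over them [Xs] and [Zs] have the same
    mean. *)
Let Xs_bound t : 0 <= t -> {ae P, forall w, 0 <= Xs t w <= K * (1 + t)}.
Proof.
move=> t0; have IX := Xs_integrable t0; have IZ := Zs_integrable t0.
have Icst := cst_integrable (K * (1 + t)).
have event (B : set R) : measurable B -> observed_filtration N t (Xs t @^-1` B).
  by move=> mB; rewrite -[_ @^-1` _]setTI; exact: Xs_adapted.
have lo : {ae P, forall w, 0 <= Xs t w}.
  apply: ae_ge0_E => //; have o : observed_filtration N t [set w | Xs t w < 0].
    rewrite (_ : mkset _ = Xs t @^-1` `]-oo, 0[); first exact: event.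
    by apply/seteqP; split => w /=; rewrite in_itv.
  rewrite E_Xs//; apply: Rintegral_ge0 => w _.
  by apply: sumr_ge0 => i _; exact: penalty_ge0.
have hi : {ae P, forall w, 0 <= K * (1 + t) - Xs t w}.
  apply: ae_ge0_E; first exact: (integrableB measurableT Icst IX).
  have o : observed_filtration N t [set w | K * (1 + t) - Xs t w < 0].
    rewrite (_ : mkset _ = Xs t @^-1` `]K * (1 + t), +oo[); first exact: event.
    by apply/seteqP; split => w /=; rewrite in_itv/= andbT subr_lt0.
  have mo := om o; rewrite (E_B mo Icst IX) E_Xs// -(E_B mo Icst IZ).
  rewrite -[leLHS](mul0r (fine (P [set w | K * (1 + t) - Xs t w < 0]))) -E_cst//.
  apply: (le_E_ae mo (cst_integrable 0) (integrableB measurableT Icst IZ)).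
  by apply: filterS (Zs_bound t0) => w /andP[_ H]; rewrite subr_ge0.
by apply: filterS (filterI lo hi) => w [l h]; rewrite l -subr_ge0.
Qed.

Let Xs_drift s h A : 0 <= s -> 0 <= h -> observed_filtration N s A ->
  h * E P A (Ys s) <= E P A (Xs (s + h)) - E P A (Xs s) <= h * E P A (Ys s) + C * h ^+ 2.
Proof.
move=> s0 h0 oA; have mA := om oA; have sh0 : 0 <= s + h by rewrite addr_ge0.
have su : s <= s + h by rewrite lerDl.
have oA' := observed_filtration_le su oA.
have IS : I (fun w => \sum_(i < m) (c i + lambda i) * pi i s w).
  by apply: integrable_bigsum => i; exact: weighted_posterior_integrable.
have -> : E P A (Ys s) =
    \sum_(i < m) ((c i + lambda i) * E P A (pi i s) - lambda i * fine (P A)).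
  rewrite (E_B mA IS (cst_integrable _)) E_cst// E_bigsum//; last first.
    by move=> i; exact: weighted_posterior_integrable.
  rewrite big_distrl/= -sumrB; apply: eq_bigr => i _.
  by rewrite (E_Zl _ mA (posterior_integrable i s0)).
rewrite !E_Xs// !E_bigsum//; last 2 first.
- by move=> i; exact: penalty_integrable.
- by move=> i; exact: penalty_integrable.
rewrite -sumrB !big_distrr/= /C big_distrl/= -big_split/=.
by apply/andP; split; apply: ler_sum => i _;
  case/andP: (penalty_drift i s0 h0 oA).
Qed.

(** Between [s] and [t] the delays only grow and each of the [m] indicators drops by at most 1. *)
Let Zs_late s t A : 0 <= s -> s <= t -> observed_filtration N t A ->
  E P A (Zs s) - m%:R * fine (P A) <= E P A (Xs t).
Proof.
move=> s0 st oA; have mA := om oA; have t0 := le_trans s0 st.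
rewrite E_Xs// -E_cst// -(E_B mA (Zs_integrable s0) (cst_integrable _)).
apply: le_E => //.
- exact: (integrableB measurableT (Zs_integrable s0) (cst_integrable _)).
- exact: Zs_integrable.
move=> w _; have -> : cst m%:R w = \sum_(i < m) 1 :> R by rewrite sumr_const card_ord.
rewrite /Zs -sumrB; apply: ler_sum => i _; rewrite !penaltyE.
have ci := ltW (c_gt0 i).
have l1 : late i s w <= late i t w by rewrite /late ge_max !le_max lexx orbT andbT lerD2r st.
have := ler_wpM2l ci l1.
have : 0 <= \1_[set w | t <= sigma i w] w :> R by [].
have : \1_[set w | s <= sigma i w] w <= 1 :> R by rewrite indicE; case: (_ \in _).
move: (\1_ _ w) (\1_ _ w) => a b; move: (c i * _) (c i * _) => a' b'; lra.
Qed.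

(** One coordinate suffices: if a switch after [t / 2] has probability at most [e / 2], then on a
    part of [A] of probability at least [e / 2] the delay cost at [t] is at least
    [c i * (t / 2)]. *)
Let Xs_growth (b e : R) : (0 < m)%N -> 0 < e -> exists T : nat, forall t A,
  T%:R <= t -> observed_filtration N t A -> e <= fine (P A) -> b < E P A (Xs t).
Proof.
move=> m0 e0; pose i := Ordinal m0.
have c0 := c_gt0 i; have l0 := lambda_gt0 i.
(* For [t > T0] the first term gives [2 / e < lambda i * (t / 2)], so that
   [expR (- lambda i * (t / 2)) <= e / 2]; the second gives [|b| < c i * (t / 2) * (e / 2)]. *)
pose T0 := 4 / (lambda i * e) + 4 * `|b| / (c i * e) + 1.
have T00 : 0 <= T0 by rewrite !addr_ge0// divr_ge0// ?mulr_ge0// ltW.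
exists (Num.truncn T0).+1 => t A Tt oA eA; have mA := om oA.
have {}Tt : T0 < t by apply: lt_le_trans Tt; case/andP: (truncn_itv T00).
have t0 : 0 < t by apply: le_lt_trans Tt.
have t20 : 0 <= t / 2 by rewrite divr_ge0// ltW.
have pA : E P A (\1_[set w | t / 2 < sigma i w]) <= e / 2.
  rewrite E_indicE//; last exact: measurable_sigma_gt.
  apply: (@le_trans _ _ (expR (- lambda i * (t / 2)))).
    rewrite -[leRHS]/(fine (expR (- lambda i * (t / 2)))%:E).
    rewrite -(probability_sigma_gt (lambda_gt0 i) (@sigma_exp i) t20).
    rewrite fine_le ?fin_num_measure//; try (by apply: measurableI => //; exact: measurable_sigma_gt);
      try exact: measurable_sigma_gt.
    apply: le_measure; rewrite ?inE//; try (by apply: measurableI => //; exact: measurable_sigma_gt);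
      try exact: measurable_sigma_gt.
  rewrite mulNr expRN; have := expR_ge1Dx (lambda i * (t / 2)).
  have x1 : 2 / e < lambda i * (t / 2).
    have : 4 / (lambda i * e) < t by apply: le_lt_trans Tt;
      rewrite /T0 -addrA lerDl addr_ge0// divr_ge0// ?mulr_ge0// ltW.
    rewrite ltr_pdivrMr ?mulr_gt0// ltr_pdivrMr//; nra.
  have e2 : 0 < 2 / e by rewrite divr_gt0.
  move=> x2; have -> : e / 2 = (2 / e)^-1 by rewrite invf_div.
  rewrite lef_pV2 ?posrE ?expR_gt0//; lra.
rewrite E_Xs//; last exact: ltW.
apply: (@lt_le_trans _ _ (E P A (fun w => c i * (t / 2) * \1_[set w | sigma i w <= t / 2] w))); last first.
  apply: le_E => //; last move=> w _.
  - exact: (integrableZl measurableT (c i * (t / 2)) (Ile i (t / 2))).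
  - exact/Zs_integrable/ltW.
  apply: (@le_trans _ _ (penalty c sigma i t w)); last first.
    by rewrite /Zs (bigD1 i)//= lerDl sumr_ge0// => j _; exact: penalty_ge0.
  rewrite penaltyE indic_mkset /late -mulrA.
  have [ss|ss] := leP (sigma i w) (t / 2).
    rewrite mulr1 -[leLHS]add0r lerD// ler_wpM2l ?(ltW c0)// le_max; apply/orP; left; lra.
  by rewrite !mulr0 addr_ge0// mulr_ge0 ?(ltW c0)// le_max lexx orbT.
rewrite (E_Zl _ mA (Ile i (t / 2))).
have := E_le_gt i (t / 2) mA.
move: (E P A _) (E P A _) pA => q p pA pq.
have qe : e / 2 <= q by lra.
have x1 : 4 * `|b| < t * (c i * e).
  rewrite -ltr_pdivrMr ?mulr_gt0//; apply: le_lt_trans Tt.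
  by rewrite /T0 addrAC lerDr addr_ge0// divr_ge0// mulr_ge0// ltW.
apply: le_lt_trans (ler_norm b) _.
apply: (@lt_le_trans _ _ (c i * (t / 2) * (e / 2))); first by lra.
by rewrite ler_pM2l// mulr_gt0// divr_gt0.
Qed.

Let Ys_nondecreasing w s t : 0 <= s -> s <= t -> Ys s w <= Ys t w.
Proof.
move=> s0 st; rewrite /Ys lerD2r; apply: ler_sum => i _.
apply: ler_wpM2l; first by rewrite addr_ge0// ltW.
exact: (posterior_nondecreasing lambda_gt0 mu0_gt0 mu_le lambda_ge cN i w s0 st).
Qed.

Let Ys_right_continuous w t : 0 <= t -> Ys s w @[s --> t^'+] --> Ys t w.
Proof.
move=> t0; apply: cvgB; last exact: cvg_cst.
apply: (cvg_sum (f := fun i s => (c i + lambda i) * pi i s w)) => i.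
apply: cvgM; first exact: cvg_cst.
exact: (posterior_version lambda_gt0 mu0_gt0 mu1_gt0 mu_le lambda_ge sigma_exp cN cp indep i).2.
Qed.

Let tau_star_ge0 w : (0 <= tau_star w)%E.
Proof. by apply/ereal_infP => _ [t [t0 _] <-]; rewrite lee_fin. Qed.

(** The infimum is attained: if it is at most [t], monotonicity gives [Ys >= 0] at every time after
    [t], and right continuity gives it at [t]. *)
Lemma threshold_time_le w t : 0 <= t -> (tau_star w <= t%:E)%E = (0 <= Ys t w).
Proof.
move=> t0; apply/idP/idP => [tt|Y0]; last first.
  by apply: ereal_inf_lbound; exists t => //; split => //; rewrite -subr_ge0.
have later u : t < u -> 0 <= Ys u w.
  move=> tu; have : (tau_star w < u%:E)%E by apply: le_lt_trans tt _; rewrite lte_fin.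
  move=> /ereal_inf_lt[_ [v [v0 Yv] <-]]; rewrite lte_fin => vu.
  by apply: le_trans (Ys_nondecreasing w v0 (ltW vu)); rewrite subr_ge0.
rewrite -(cvg_lim _ (@Ys_right_continuous w t t0))//; apply: limr_ge.
  by apply/cvg_ex; exists (Ys t w); exact: Ys_right_continuous.
by near=> u; apply: later; near: u; exact: nbhs_right_gt.
Unshelve. all: by end_near. Qed.

Let tau_star_stopping : stopping_time (observed_filtration N) tau_star.
Proof.
split=> [|t t0]; first exact: tau_star_ge0.
have mY : measurable_fun setT (Ys t : g_sigma_algebraType (observed_events N t) -> R).
  apply: measurable_funB => //; apply: measurable_sum => i.
  apply: measurable_funM => //.
  exact: (observed_measurable_posterior lambda_gt0 mu0_gt0 mu_le lambda_ge cN i t0).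
rewrite (_ : mkset _ = setT `&` Ys t @^-1` `[0, +oo[); first exact: mY.
by apply/seteqP; split => w /=; rewrite in_itv/= andbT threshold_time_le// => -[].
Qed.

Let tau_star_bound : exists T : nat, forall w, (tau_star w <= T%:R%:E)%E.
Proof.
(* The threshold is reached in every coordinate once [c i * t >= 1]: then [(c i + lambda i) *
   (lambda i * t) >= lambda i * (1 + lambda i * t)], to be combined with [posterior_lb]. *)
pose b := \sum_(i < m) (c i)^-1.
have b0 : 0 <= b by apply: sumr_ge0 => i _; rewrite invr_ge0 ltW.
exists (Num.truncn b).+1 => w; rewrite threshold_time_le// subr_ge0.
apply: ler_sum => i _; set t := _.+1%:R.
have bt : b < t by case/andP: (truncn_itv b0).
have t0 : 0 < t by apply: le_lt_trans bt.
have ct : 1 <= c i * t.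
  rewrite -(mulfV (lt0r_neq0 (c_gt0 i))) ler_pM2l//; apply: ltW; apply: le_lt_trans bt.
  by rewrite /b (bigD1 i)//= lerDl sumr_ge0// => j _; rewrite invr_ge0 ltW.
have := posterior_lb lambda_gt0 mu0_gt0 mu_le lambda_ge cN i w (ltW t0).
have c0 := c_gt0 i; have l0 := lambda_gt0 i.
move=> /(ler_wpM2l (ltW (addr_gt0 c0 l0))); apply: le_trans.
rewrite mulrA ler_pdivlMr; last by rewrite addr_gt0// mulr_gt0.
have := ler_wpM2l (ltW l0) ct; lra.
Qed.

Let cost tau := (\int[P]_w stopped_value (fun t => \sum_(i < m) X i t w)%R (tau w))%E.

Let cost_le tau : stopping_time (observed_filtration N) tau -> (cost tau_star <= cost tau)%E.
Proof.
(* [Xs_growth] needs a coordinate. For [m = 0] the process, and with it the limit superior at [+oo],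
   is 0, so all costs are equal. *)
move=> st; have [m0|] := posnP m; last first.
  move=> m0; have [T tT] := tau_star_bound.
  apply: (optimal_stopping (Gen := observed_events N) observed_meas _ Xs_adapted Xs_integrable
    Xs_right_continuous K_ge0 Xs_bound Ys_integrable Xs_drift Zs_integrable Zs_bound E_Xs
    (ler0n R m) Zs_late (fun b e e0 => Xs_growth b m0 e0) st tau_star_stopping _ _ tT).
  - by move=> s t; exact: observed_filtration_le.
  - move=> w t t0; rewrite ltNge threshold_time_le// -ltNge; exact: ltW.
  - by move=> w t t0; rewrite threshold_time_le.
have zero (rho : Omega -> \bar R) : (forall w, 0 <= rho w)%E -> cost rho = 0%E.
  move=> rho0; apply: integral0_eq => w _.
  have -> : (fun t => \sum_(i < m) X i t w) = fun=> 0.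
    by apply/funext => t; rewrite big1// => -[i im]; exfalso; rewrite m0 in im.
  have := rho0 w; case: (rho w) => [r| |]//= _.
  apply/eqP; rewrite eq_le; apply/andP; split.
    rewrite /limf_esup; apply: ereal_inf_lbound; exists setT; first exact: filterT.
    rewrite (_ : _ @` _ = [set 0%E]) ?ereal_sup1//; apply/seteqP; split=> [_ [x _ <-]//|_ ->].
    by exists 0.
  apply: limf_esup_ge0 => //.
by rewrite !zero//; case: st.
Qed.

Lemma disorder_problem_solution :
  [/\ forall i, right_continuous_version P (observed_filtration N)
        (fun t => \1_[set w | sigma i w <= t]) (pi i),
      stopping_time (observed_filtration N) tau_star
    & cost tau_star =
        ereal_inf [set cost tau | tau in stopping_time (observed_filtration N)]].
Proof.
split.
- by move=> i; exact: (posterior_version lambda_gt0 mu0_gt0 mu1_gt0 mu_le lambda_ge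
    sigma_exp cN cp indep i).
- exact: tau_star_stopping.
apply/eqP; rewrite eq_le; apply/andP; split.
  by apply/ereal_infP => _ [tau st <-]; exact: cost_le.
by apply: ereal_inf_lbound; exists tau_star => //; exact: tau_star_stopping.
Qed.

End disorder_problem.

Unset Implicit Arguments.

Theorem mainTheorem6 (R : realType) (d : measure_display)
    (Omega : measurableType d) (P : probability Omega R) (m : nat)
    (lambda c mu0 mu1 : 'I_m -> R)
    (lambda_gt0 : forall i, 0 < lambda i) (c_gt0 : forall i, 0 < c i)
    (mu0_gt0 : forall i, 0 < mu0 i) (mu1_gt0 : forall i, 0 < mu1 i)
    (mu_le : forall i, 0 <= mu1 i - mu0 i)
    (lambda_ge : forall i, mu1 i - mu0 i <= lambda i)
    (sigma : 'I_m -> {RV P >-> R}) (N : 'I_m -> R -> Omega -> nat)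
    (sigma_exp : forall i (B : set R), measurable B ->
       distribution P (sigma i) B = exponential_prob (lambda i) B)
    (N_switch : forall i,
       switches_intensity P (full_filtration sigma N)
         (sigma i) (N i) (mu0 i) (mu1 i))
    (indep : independent_sigma_algebras P (coordinate_sigma_algebra sigma N))
    (X : 'I_m -> R -> Omega -> R)
    (X_version : forall i,
       right_continuous_version P (observed_filtration N)
         (penalty c sigma i) (X i)) :
  let pi := fun (i : 'I_m) (t : R) (w : Omega) =>
    posterior (lambda i) (mu0 i) (mu1 i) (fun s => N i s w) t in
  let tau_star := threshold_time lambda c pi in
  let cost := fun tau : Omega -> \bar R =>
    (\int[P]_w stopped_value (fun t => (\sum_(i < m) X i t w)%R) (tau w))%E in
  [/\ forall i, right_continuous_version P (observed_filtration N)
        (fun t => \1_[set w | sigma i w <= t]) (pi i),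
      stopping_time (observed_filtration N) tau_star
    & cost tau_star =
        ereal_inf [set cost tau | tau in stopping_time (observed_filtration N)]].
Proof.
exact: (disorder_problem_solution lambda_gt0 c_gt0 mu0_gt0 mu1_gt0 mu_le lambda_ge
  sigma_exp (fun i => let: And3 cN _ _ := N_switch i in cN)
  (fun i => let: And3 _ _ cp := N_switch i in cp) indep X_version).
Qed.
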